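(* Let $\{(y_i,X_i)\in\mathbb{R}^{1+p}: i=1,\ldots,n\}$ be i.i.d., with $p$ fixed, satisfying $y_i=X_i^T\beta_0+e_i$ for an unknown $\beta_0\in\mathbb{R}^p$, where $\mathbb{E}(y_i^4)<\infty$, $\mathbb{E}(\|X_i\|^4)<\infty$, $\mathbb{E}(X_iX_i^T)$ has full rank $p$, and $\mathbb{E}(e_iX_i)=0$. Let $\Pi$ be a random sketching matrix independent of the data, and let $m=m_n\to\infty$ with $m/n\to 0$ as $n\to\infty$. Let $\widehat\beta_{OLS}=(X^TX)^{-1}X^Ty$ and $\widetilde\beta_{OLS}=(X^T\Pi^T\Pi X)^{-1}X^T\Pi^T\Pi y$, and define $V_1:=[\mathbb{E}(X_iX_i^T)]^{-1}\mathbb{E}(e_i^2X_iX_i^T)[\mathbb{E}(X_iX_i^T)]^{-1}$ and $V_0:=\mathbb{E}(e_i^2)[\mathbb{E}(X_iX_i^T)]^{-1}$. Then, as $n\to\infty$: (i) if $\Pi$ is a Bernoulli sampling matrix, $m^{1/2}(\widetilde\beta_{OLS}-\widehat\beta_{OLS})\to_d N(0,V_1)$; (ii) if $\Pi$ is a countsketch matrix, $m^{1/2}(\widetilde\beta_{OLS}-\widehat\beta_{OLS})\to_d N(0,V_0)$.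
   Context: $y\in\mathbb{R}^n$ and $X\in\mathbb{R}^{n\times p}$ stack $y_i$ and $X_i^T$ as rows; $e$ stacks $e_i$. Bernoulli sampling (BS): $\Pi=\sqrt{n/m}\,B$, where $B$ is an $n\times n$ diagonal matrix whose diagonal entries are i.i.d. Bernoulli random variables with success probability $m/n$. Countsketch (CS): $\Pi$ is an $m\times n$ matrix whose columns are i.i.d.; each column has exactly one nonzero entry, located in a row chosen uniformly at random from $\{1,\ldots,m\}$, and taking the values $+1$ or $-1$ with equal probability (sign independent of location). *)

(* Defs.v *)
From HB Require Import structures.
From mathcomp Require Import all_boot all_order all_algebra.
From mathcomp Require Import all_classical all_reals all_analysis.
Set Implicit Arguments. Unset Strict Implicit. Unset Printing Implicit Defensive.
Import Order.TTheory GRing.Theory Num.Theory.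
Import numFieldNormedType.Exports.
Local Open Scope classical_set_scope.
Local Open Scope ring_scope.

Section defs.
Context {d : measure_display} {T : measurableType d} {R : realType}.

Definition Ereal (P : probability T R) (f : T -> R) : R := fine ('E_P[f])%E.

Definition sigma_gen (F : set (T -> R)) : set (set T) :=
  <<s [set f @^-1` B | f in F & B in [set B : set R | measurable B]] >>.

Definition mutually_independent {I : eqType} (P : probability T R)
    (G : I -> set (T -> R)) : Prop :=
  forall (s : seq I) (A : I -> set T), uniq s ->
    (forall i, i \in s -> sigma_gen (G i) (A i)) ->
    P (\big[setI/setT]_(i <- s) A i) = (\prod_(i <- s) fine (P (A i)))%:E.

(* identically distributed random vectors in R^(1+p): equal joint laws,
   expressed on the generating pi-system of measurable rectangles *)
Definition same_law_vec (P : probability T R) (p : nat)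
    (y1 : T -> R) (X1 : 'I_p -> T -> R) (y2 : T -> R) (X2 : 'I_p -> T -> R) :=
  forall (B0 : set R) (B : 'I_p -> set R), measurable B0 ->
    (forall j, measurable (B j)) ->
    P ([set w | B0 (y1 w)] `&` [set w | forall j, B j (X1 j w)]) =
    P ([set w | B0 (y2 w)] `&` [set w | forall j, B j (X2 j w)]).

End defs.

(* G is a centered Gaussian random vector with covariance matrix V
   (definition: every linear combination t^T G is N(0, t^T V t),
    the degenerate case variance 0 meaning a.s. equal to 0) *)
Definition gaussian_vector {d : measure_display} {T : measurableType d}
    {R : realType} (Q : probability T R) (p : nat)
    (G : T -> 'cV[R]_p) (V : 'M[R]_p) : Prop :=
  (forall i, measurable_fun setT (fun w => G w i 0)) /\
  forall t : 'cV[R]_p,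
    let s2 := (t^T *m V *m t) 0 0 in
    let L := fun w => (t^T *m G w) 0 0 in
    (s2 = 0 -> Q [set w | L w != 0] = 0%E) /\
    (0 < s2 -> forall A : set R, measurable A ->
        Q (L @^-1` A) = normal_prob 0 (Num.sqrt s2) A).

Definition cvg_dist_normal {d : measure_display} {T : measurableType d}
    {R : realType} (P : probability T R) (p : nat)
    (Z : nat -> T -> 'cV[R]_p) (V : 'M[R]_p) : Prop :=
  forall (d' : measure_display) (T' : measurableType d')
         (Q : probability T' R) (G : T' -> 'cV[R]_p),
    gaussian_vector Q G V ->
    forall f : 'cV[R]_p -> R, continuous f ->
      (exists M : R, forall x, `|f x| <= M) ->
      (fun n => (\int[P]_w (f (Z n w))%:E)%E) @ \oo -->
        (\int[Q]_w (f (G w))%:E)%E.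

Definition Xmat {T R : Type} {p : nat} (X : nat -> 'I_p -> T -> R) (n : nat)
    (w : T) : 'M[R]_(n, p) := \matrix_(i < n, j < p) X i j w.
Definition yvec {T R : Type} (y : nat -> T -> R) (n : nat) (w : T)
    : 'cV[R]_n := \col_(i < n) y i w.

Definition beta_ols {R : realType} {n p : nat} (X : 'M[R]_(n, p))
    (y : 'cV[R]_n) : 'cV[R]_p := invmx (X^T *m X) *m (X^T *m y).
Definition beta_sk {R : realType} {k n p : nat} (Pi : 'M[R]_(k, n))
    (X : 'M[R]_(n, p)) (y : 'cV[R]_n) : 'cV[R]_p :=
  invmx ((Pi *m X)^T *m (Pi *m X)) *m ((Pi *m X)^T *m (Pi *m y)).

(* Main.v *)
(** With [G = n^-1 (Pi X)^T Pi X] and [N = m^(1/2) n^-1 (Pi X)^T Pi e], the normalized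
    difference is [G^-1 N - m^(1/2) (beta_ols - beta0)], where [G] tends to [E X X^T] in
    probability and the last term vanishes because [m / n -> 0]. By Slutsky and Levy it suffices that
    [E cos (t^T (E X X^T)^-1 N + c)] converges to its Gaussian limit for all [t] and [c]
    (the phase [c] replaces complex exponentials).

    For Bernoulli sampling, [N] is a normalized sum of [n] i.i.d. vectors.

    For countsketch, splitting [(Pi X)^T Pi e] into equal and distinct indices leaves the full-sample
    score, which is negligible, plus the sum over buckets [k] of the sign-weighted products of
    distinct observations hashed to [k]. Given the hash, these are independent and centered,
    the bucket with [N_k] elements having variance proportional to [N_k (N_k - 1)] and fourth moment
    [O(N_k^4)]. Hence a Lyapunov bound holds given the hash; averaging it over the hash only needs
    the mean of [sum_k N_k^4] and the Cauchy bound [sum_k N_k^2 >= n^2 / m], whose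
    mean defect is at most [n]. *)

Require Import Defs.
From HB Require Import structures.
From mathcomp Require Import all_boot all_order all_algebra.
From mathcomp Require Import all_classical all_reals all_analysis.
From mathcomp Require Import measurable_realfun ring lra.
Import Order.TTheory GRing.Theory Num.Theory.
Import numFieldNormedType.Exports.
Local Open Scope classical_set_scope.
Local Open Scope ring_scope.

Set Implicit Arguments. Unset Strict Implicit. Unset Printing Implicit Defensive.

(** * Independence of blocks *)

(** The data have only four moments, so a summand [errf * v] of the Bernoulli score has just two,
    and its limit rests on a Lindeberg-type bound with the truncated remainder [tail2]. In
    countsketch every cross term multiplies two distinct, hence independent, observations; it keeps
    four moments, which makes a Lyapunov bound affordable. The same pairing explains the two
    covariances: a sampled observation meets its own error, whence E(e^2 X X^T), while a colliding
    one meets the error of another observation, so that the variance factorizes into E(e^2) E(X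
    X^T), up to a square of E(e X) = 0. Conditioning on the hash is done by splitting the space into
    the finitely many events that fix it, each independent of signs and data. The random signs kill
    all odd moments, which closes the fourth-moment recursion inside a bucket. The Levy step needs
    tightness, supplied by second moments, and trigonometric polynomials that approximate a test
    function on a box without exceeding its bound anywhere; Bernstein averages have this
    property. *)

Section sigma_independence.
Context {d : measure_display} {T : measurableType d} {R : realType}.
Variable P : probability T R.
Local Open Scope ereal_scope.

Lemma dynkin_indep (B : set T) : measurable B ->
  dynkin [set A : set T | measurable A /\ P (A `&` B) = P A * P B].
Proof.
move=> mB; split => /=.
- by split; [exact: measurableT|rewrite setTI probability_setT mul1e].
- move=> A [mA AB]; split; first exact: measurableC.
  have -> : ~` A `&` B = B `\` (A `&` B).
    by rewrite setDIr setDv setU0 setDE setIC.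
  rewrite measureD//; [|exact: measurableI|by rewrite -ge0_fin_numE ?fin_num_measure].
  rewrite setICA setIid. rewrite [X in _ - X = _]AB.
  rewrite probability_setC// muleBl ?mul1e ?fin_num_measure//.
- move=> F tF mF; split; first by apply: bigcup_measurable => k _; case: (mF k).
  rewrite setI_bigcupl measure_bigcup//; last 2 first.
  + by move=> k _; apply: measurableI => //; case: (mF k).
  + exact: trivIset_setIr.
  rewrite measure_bigcup//; last by move=> k _; case: (mF k).
  rewrite muleC -(fineK (fin_num_measure P B mB)) -nneseriesZl//.
  by apply: eq_eseriesr => k _; rewrite fineK ?fin_num_measure// muleC; case: (mF k).
Qed.

Lemma indep_sigma1 (C : set (set T)) (B : set T) :
  setI_closed C -> C `<=` measurable -> measurable B ->
  (forall A, C A -> P (A `&` B) = P A * P B) ->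
  forall A, <<s C >> A -> measurable A /\ P (A `&` B) = P A * P B.
Proof.
move=> CI Cm mB CB A; rewrite -setI_closed_g_dynkin_g_sigma_algebra// => /(_ [set A | measurable A /\ P (A `&` B) = P A * P B]).
apply; split; first exact: dynkin_indep.
by move=> D CD; split; [exact: Cm|exact: CB].
Qed.

(** The pi-lambda argument is run once in each variable: an event of one generated sigma-algebra is
    frozen while the other one is extended from its generators. *)
Lemma indep_sigma2 (C D : set (set T)) :
  setI_closed C -> C `<=` measurable -> setI_closed D -> D `<=` measurable ->
  (forall A B, C A -> D B -> P (A `&` B) = P A * P B) ->
  forall A B, <<s C >> A -> <<s D >> B -> P (A `&` B) = P A * P B.
Proof.
move=> CI Cm DI Dm CD A B CA DB.
have mB : measurable B.
  by move: B DB; apply: smallest_sub => //; exact: sigma_algebra_measurable.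
have [] // := @indep_sigma1 C B CI Cm mB _ A CA.
move=> {A CA} A CA; rewrite setIC muleC.
have mA := Cm _ CA.
have [] // := @indep_sigma1 D A DI Dm mA _ B DB.
by move=> {DB mB}B DB; rewrite setIC muleC; exact: CD.
Qed.

End sigma_independence.

Section blocks.
Context {d : measure_display} {T : measurableType d} {R : realType}.
Variables (P : probability T R) (I : finType) (G : I -> set (set T)).

(** Pi-systems rather than sigma-algebras, so that the signs and locations of a countsketch can
    enter as finite families of events. Membership of [setT] lets an index be dropped from a product
    formula. *)
Definition pi_family := forall i, [/\ G i setT, setI_closed (G i) & G i `<=` measurable].

Definition indep_family :=
  forall A : I -> set T, (forall i, G i (A i)) ->
  P (\big[setI/setT]_i A i) = (\prod_i fine (P (A i)))%:E.

Definition block (J : {set I}) : set (set T) :=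
  [set A | exists2 i, i \in J & G i A].

Hypothesis piG : pi_family.
Hypothesis indG : indep_family.

(** The union of generators in [block] is not closed under intersection; these finite intersections
    are, and they generate a sigma-algebra that contains the block's. *)
Let rect (J : {set I}) : set (set T) :=
  [set A | exists2 F : I -> set T, (forall i, G i (F i)) & A = \big[setI/setT]_(i in J) F i].

Let rectI J : setI_closed (rect J).
Proof.
move=> _ _ [F GF ->] [H GH ->]; exists (fun i => F i `&` H i).
  by move=> i; have [_ + _] := piG i; apply.
by rewrite big_split.
Qed.

Let rectm J : rect J `<=` measurable.
Proof.
move=> _ [F GF ->]; apply: bigsetI_measurable => i _.
by have [_ _] := piG i; apply.
Qed.

Lemma block_measurable J : block J `<=` measurable.
Proof. by move=> A [i iJ GA]; have [_ _] := piG i; apply. Qed.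

Lemma sub_block (J K : {set I}) : J \subset K -> <<s block J >> `<=` <<s block K >>.
Proof.
move=> JK; apply: sub_smallest2r; first exact: smallest_sigma_algebra.
move=> A [i iJ GA]; exists i => //. exact: (fintype.subsetP JK).
Qed.

Lemma indep_block (J1 J2 : {set I}) : {in J1, forall i, i \notin J2} ->
  forall A B, <<s block J1 >> A -> <<s block J2 >> B ->
  P (A `&` B) = (P A * P B)%E.
Proof.
move=> J12 A B sA sB.
have sub J : <<s block J >> `<=` <<s rect J >>.
  apply: sub_smallest2r; first exact: smallest_sigma_algebra.
  move=> C [i iJ GC].
  exists (fun j => if j == i then C else setT).
    by move=> j; case: eqP => [->//|_]; have [] := piG j.
  rewrite (bigD1 i)//= eqxx big1 ?setIT// => j /andP[_ ji].
  by rewrite (negbTE ji).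
apply: (@indep_sigma2 _ _ _ P (rect J1) (rect J2)) => //; try exact: sub.
move=> _ _ [F GF ->] [H GH ->].
have GT i : G i setT by have [] := piG i.
have rE (J : {set I}) (K : I -> set T) : (forall i, G i (K i)) ->
   P (\big[setI/setT]_(i in J) K i) = (\prod_(i in J) fine (P (K i)))%:E.
  move=> GK; rewrite big_mkcond/= indG; last by move=> i; case: ifP.
  congr EFin; rewrite [RHS]big_mkcond/=; apply: eq_bigr => i _.
  by case: ifP => //; rewrite probability_setT.
rewrite !rE// -EFinM.
have -> : \big[setI/setT]_(i in J1) F i `&` \big[setI/setT]_(i in J2) H i =
  \big[setI/setT]_i (if i \in J1 then F i else if i \in J2 then H i else setT).
  rewrite (big_mkcond (mem J1)) (big_mkcond (mem J2)) -big_split/=.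
  apply: eq_bigr => i _; case: ifP => [iJ1|_]; last by rewrite setTI.
  by rewrite (negbTE (J12 _ iJ1)) setIT.
rewrite indG; last by move=> i; case: ifP => // _; case: ifP.
congr EFin; rewrite (big_mkcond (mem J1)) (big_mkcond (mem J2)) -big_split/=.
apply: eq_bigr => i _; case: ifP => [iJ1|_].
  by rewrite (negbTE (J12 _ iJ1)) mulr1.
by rewrite mul1r; case: ifP => // _; rewrite probability_setT.
Qed.

End blocks.

Section expectation_indep.
Context {d : measure_display} {T : measurableType d} {R : realType}.
Variable P : probability T R.

Definition indep2 (f g : T -> R) := forall A B : set R, measurable A -> measurable B ->
  P (f @^-1` A `&` g @^-1` B) = (P (f @^-1` A) * P (g @^-1` B))%E.

(** Independence identifies the joint law of the pair with the product of the marginal laws, first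
    on rectangles and then everywhere; Tonelli gives integrability of the product and Fubini its
    value. *)
Lemma indep2_integral (f g : T -> R) : indep2 f g ->
  P.-integrable setT (EFin \o f) -> P.-integrable setT (EFin \o g) ->
  P.-integrable setT (EFin \o (fun w => f w * g w)) /\
  (\int[P]_w (f w * g w)%:E = \int[P]_w (f w)%:E * \int[P]_w (g w)%:E)%E.
Proof.
move=> fg intf intg.
have mf : measurable_fun setT f by exact/measurable_EFinP/(measurable_int P).
have mg : measurable_fun setT g by exact/measurable_EFinP/(measurable_int P).
pose h w := (f w, g w).
have mh : measurable_fun setT h by exact: measurable_fun_pair.
pose F : {mfun T >-> R} := HB.pack f (isMeasurableFun.Build _ _ _ _ f mf).
pose Gg : {mfun T >-> R} := HB.pack g (isMeasurableFun.Build _ _ _ _ g mg).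
pose H : {mfun T >-> (R * R)%type} := HB.pack h (isMeasurableFun.Build _ _ _ _ h mh).
pose m1 := distribution P F; pose m2 := distribution P Gg.
have prodE : forall X, measurable X -> (m1 \x m2)%E X = distribution P H X.
  apply: product_measure_unique => A B mA mB.
  by rewrite /m1 /m2 /distribution /pushforward/= -fg.
pose xy := fun z : R * R => (z.1 * z.2)%:E.
have mxy : measurable_fun setT xy.
  by apply/measurable_EFinP; apply: measurable_funM.
have i12 : (m1 \x m2)%E.-integrable setT xy.
  apply/integrable12ltyP => //.
  have -> : (\int[m1]_x \int[m2]_y `|xy (x, y)| = \int[m1]_x (`|x|%:E * \int[m2]_y `|y|%:E))%E.
    apply: eq_integral => x _; rewrite -ge0_integralZl//; last first.
      by apply/measurable_EFinP; exact: normr_measurable.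
    by apply: eq_integral => y _; rewrite /xy/= normrM.
  have n1 : (\int[m1]_x `|x|%:E < +oo)%E.
    rewrite /m1 ge0_integral_pushforward//=; last first.
      by apply/measurable_EFinP; exact: normr_measurable.
    by move/integrableP : intf => [].
  have n2 : (\int[m2]_x `|x|%:E < +oo)%E.
    rewrite /m2 ge0_integral_pushforward//=; last first.
      by apply/measurable_EFinP; exact: normr_measurable.
    by move/integrableP : intg => [].
  have fn2 : (\int[m2]_x `|x|%:E)%E \is a fin_num.
    by rewrite ge0_fin_numE// integral_ge0.
  rewrite -(fineK fn2) ge0_integralZr//; last 2 first.
  - by apply/measurable_EFinP; exact: normr_measurable.
  - by rewrite lee_fin fine_ge0// integral_ge0.
  apply: lte_mul_pinfty; [exact: integral_ge0|by rewrite ge0_fin_numE// integral_ge0|exact: ltry].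
have iH : (distribution P H).-integrable setT xy.
  apply/integrableP; split => //; rewrite (eq_measure_integral (m1 \x m2)%E).
    by move/integrableP : i12 => [].
  by move=> A mA _; symmetry; exact: prodE.
have ifg : P.-integrable setT (EFin \o (fun w => f w * g w)).
  apply/integrableP; split; first by apply/measurable_EFinP; exact: measurable_funM.
  move/integrableP : iH => [_].
  by rewrite /distribution ge0_integral_pushforward//; exact: measurableT_comp.
split=> //.
have -> : (\int[P]_w (f w * g w)%:E = \int[distribution P H]_z xy z)%E.
  by rewrite integral_distribution.
rewrite (eq_measure_integral (m1 \x m2)%E); last by move=> A mA _; symmetry; exact: prodE.
rewrite -integral12_prod_meas1//.
have fin1 := integrable_fin_num measurableT intf.
have fin2 := integrable_fin_num measurableT intg.
have im1 : m1.-integrable setT (EFin : R -> \bar R).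
  by apply: integrable_pushforward => //; exact: EFin_measurable.
have im2 : m2.-integrable setT (EFin : R -> \bar R).
  by apply: integrable_pushforward => //; exact: EFin_measurable.
have e1 : (\int[m1]_x x%:E = \int[P]_w (f w)%:E)%E.
  by rewrite integral_distribution//; exact: EFin_measurable.
have e2 : (\int[m2]_x x%:E = \int[P]_w (g w)%:E)%E.
  by rewrite integral_distribution//; exact: EFin_measurable.
rewrite /fubini_F/= -e1 -e2.
transitivity (\int[m1]_x (x%:E * \int[m2]_y y%:E))%E.
  apply: eq_integral => x _; rewrite /xy/=.
  by rewrite -integralZl//; apply: eq_integral => y _; rewrite EFinM.
by rewrite e2 -(fineK fin2) integralZr.
Qed.

End expectation_indep.

(** * Characteristic function estimates *)

Section trig_bounds.
Context {R : realType}.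
Implicit Types x u : R.

Lemma normr_sin_le x : `|sin x| <= `|x|.
Proof.
have H (y : R) : 0 < y -> `|sin y| <= `|y|.
  move=> y0.
  have [c _ E] := @MVT R sin cos 0 y y0 (fun z _ => is_derive_sin z)
    (continuous_subspaceT (@continuous_sin R)).
  move: E; rewrite sin0 !subr0 => ->.
  by rewrite normrM ler_piMl// ler_norml cos_geN1 cos_le1.
have [x0|x0|->] := ltgtP x 0; [|exact: H|by rewrite sin0].
by have := H (- x); rewrite sinN !normrN oppr_gt0; apply.
Qed.

Lemma cos_half x : 1 - cos x = (sin (x / 2)) ^+ 2 *+ 2.
Proof.
have -> : cos x = cos (x / 2 + x / 2) by rewrite -splitr.
by rewrite cosD -!expr2 cos2sin2; ring.
Qed.

Lemma cos_sub1 x : 0 <= 1 - cos x <= x ^+ 2 / 2.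
Proof.
rewrite cos_half; apply/andP; split; first by rewrite mulrn_wge0// sqr_ge0.
have : (sin (x / 2)) ^+ 2 <= (x / 2) ^+ 2.
  by rewrite -[leLHS]real_normK ?num_real// -[leRHS]real_normK ?num_real// lerXn2r ?nnegrE// normr_sin_le.
lra.
Qed.

(** The mean value theorem applied to [sin t - t] reduces this to [cos_sub1]. The constant 1/2 is
    not sharp but suffices. *)
Lemma sin_sub x : `|sin x - x| <= `|x| ^+ 3 / 2.
Proof.
have H (y : R) : 0 < y -> `|sin y - y| <= `|y| ^+ 3 / 2.
  move=> y0.
  have D z : z \in `]0, y[ -> is_derive z 1 (fun t : R => sin t - t) (cos z - 1).
    by move=> _; apply: is_deriveB; exact: is_derive_id.
  have C : {within `[0, y], continuous (fun t : R => sin t - t)}.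
    apply: continuous_subspaceT => z; apply: (@cvgB _ R^o); last exact: cvg_id.
    exact: continuous_sin.
  have [c cy] := MVT y0 D C.
  rewrite sin0 !subr0 => ->; rewrite normrM.
  rewrite distrC; have /andP[c0 c2] := cos_sub1 c.
  move: cy; rewrite in_itv/= => /andP[cgt0 cley].
  rewrite (ger0_norm c0) (ger0_norm (ltW y0)).
  have : c ^+ 2 <= y ^+ 2 by rewrite lerXn2r ?nnegrE// ltW.
  move=> cy2; have : 1 - cos c <= y ^+ 2 / 2 by lra.
  move=> /(ler_wpM2r (ltW y0)) /le_trans; apply; rewrite [y ^+ 3]exprSr; lra.
have [x0|x0|->] := ltgtP x 0; [|exact: H|by rewrite sin0 subrr normr0 expr0n/= mul0r].
by have := H (- x); rewrite sinN -opprD !normrN oppr_gt0; apply.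
Qed.

(** The usual remainder of a second-order expansion in the Lindeberg method: cubic near zero, yet
    integrable as soon as the second moment is finite. *)
Definition tail2 x : R := Num.min (x ^+ 2) (`|x| ^+ 3).

Lemma tail2_ge0 x : 0 <= tail2 x.
Proof. by rewrite /tail2 le_min sqr_ge0 exprn_ge0. Qed.

Lemma tail2_sqr x : tail2 x <= x ^+ 2.
Proof. by rewrite /tail2 ge_min lexx. Qed.

Lemma tail2_cube x : tail2 x <= `|x| ^+ 3.
Proof. by rewrite /tail2 ge_min lexx orbT. Qed.

Lemma tail2E x : tail2 x = if `|x| <= 1 then `|x| ^+ 3 else `|x| ^+ 2.
Proof.
rewrite /tail2 -[x ^+ 2]real_normK ?num_real//; have x0 := normr_ge0 x.
case: ifPn => [x1|]; first by rewrite min_r// (exprSr _ 2) ler_piMr// exprn_ge0.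
rewrite -ltNge => x1; rewrite min_l// (exprSr _ 2) ler_peMr// ?exprn_ge0//.
exact: ltW.
Qed.

Lemma sin_tail2 x : `|sin x - x| <= 2 * tail2 x.
Proof.
rewrite tail2E; have x0 := normr_ge0 x.
have e0 : 0 <= `|x| ^+ 3 by rewrite exprn_ge0.
case: ifPn => [x1|]; first by have := sin_sub x; lra.
rewrite -ltNge => x1; apply: (le_trans (ler_normB _ _)).
have := normr_sin_le x; nra.
Qed.

Lemma cos_tail2 x : `|cos x - 1 + x ^+ 2 / 2| <= 2 * tail2 x.
Proof.
rewrite tail2E; have x0 := normr_ge0 x.
have xx : x ^+ 2 = `|x| ^+ 2 by rewrite real_normK ?num_real.
case: ifPn => [x1|_]; last first.
  have /andP[] := cos_sub1 x; rewrite xx => h1 h2.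
  by rewrite ger0_norm; nra.
(* By the half-angle formula this is a difference of squares, so the bound on sine serves again. *)
have -> : cos x - 1 + x ^+ 2 / 2 = (x / 2 - sin (x / 2)) * (x / 2 + sin (x / 2)) * 2.
  by rewrite -[cos x - 1]opprB cos_half; field.
set a := x / 2.
have Ea : `|a| = `|x| / 2 by rewrite /a normrM (@gtr0_norm _ 2^-1)// invr_gt0.
rewrite !normrM (ger0_norm (ler0n _ 2)).
have h1 : `|a - sin a| <= `|a| ^+ 3 / 2 by rewrite distrC sin_sub.
have h2 : `|a + sin a| <= 2 * `|a|.
  by apply: (le_trans (ler_normD _ _)); have := normr_sin_le a; lra.
have h : `|a - sin a| * `|a + sin a| <= `|a| ^+ 3 / 2 * (2 * `|a|) by rewrite ler_pM.
have h3 : `|x| ^+ 3 * `|x| <= `|x| ^+ 3 * 1 by rewrite ler_wpM2l// exprn_ge0.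
move: h; rewrite Ea.
have -> : (`|x| / 2) ^+ 3 / 2 * (2 * (`|x| / 2)) = `|x| ^+ 3 * `|x| / 16 by field.
have h4 : 0 <= `|x| ^+ 3 by rewrite exprn_ge0.
lra.
Qed.

(** Both sides come from [1 + x <= expR x]: at [- u] it gives the sign, at [u] it gives
    [expR (- u) <= (1 + u)^-1]. *)
Lemma expRN_taylor u : 0 <= u -> `|expR (- u) - 1 + u| <= u ^+ 2.
Proof.
move=> u0; rewrite ger0_norm; last first.
  by have := expR_ge1Dx (- u); lra.
rewrite expRN.
have h : (expR u)^-1 <= (1 + u)^-1.
  by rewrite lef_pV2 ?posrE ?expR_gt0 ?expR_ge1Dx//; lra.
apply: (@le_trans _ _ ((1 + u)^-1 - 1 + u)); first by lra.
have u1 : 0 < 1 + u by lra.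
rewrite -(ler_pM2r u1) mulrDl mulrBl mulVf ?gt_eqF//; nra.
Qed.

Lemma expRN_lip (u v : R) : 0 <= u -> 0 <= v -> `|expR (- u) - expR (- v)| <= `|u - v|.
Proof.
have H (a b : R) : 0 <= a -> a <= b -> `|expR (- a) - expR (- b)| <= `|a - b|.
  move=> a0 ab.
  have -> : expR (- b) = expR (- a) * expR (a - b) by rewrite -expRD; congr expR; ring.
  rewrite -{1}[expR (- a)]mulr1 -mulrBr normrM.
  have : `|expR (- a)| <= 1 by rewrite ger0_norm ?expR_ge0// -expR0 ler_expR oppr_le0.
  have e1 : expR (a - b) <= 1 by rewrite -expR0 ler_expR subr_le0.
  have e2 := expR_ge1Dx (a - b).
  have : `|1 - expR (a - b)| <= `|a - b|.
    by rewrite ger0_norm ?subr_ge0// ler0_norm ?subr_le0//; lra.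
  have := normr_ge0 (1 - expR (a - b)); have := normr_ge0 (expR (- a)); nra.
move=> u0 v0; have [uv|/ltW vu] := leP u v; first exact: H.
by rewrite distrC (distrC u) H.
Qed.

End trig_bounds.

(** * Real-valued expectations and moment classes *)

Section real_expectation.
Context {d : measure_display} {T : measurableType d} {R : realType}.
Variable P : probability T R.
Implicit Types f g : T -> R.

(** Expectations are kept real so that [ring] and [lra] apply; the price is an explicit
    integrability fact for every linear step. *)
Definition itg f : Prop := P.-integrable setT (EFin \o f).
Definition Ex f : R := \int[P]_w f w.

Lemma ErealE f : Ereal P f = Ex f.
Proof. by rewrite /Ereal /Ex /Rintegral unlock. Qed.

Lemma itg_meas f : itg f -> measurable_fun setT f.
Proof. by move=> /measurable_int/measurable_EFinP. Qed.

Lemma eq_itg f g : f =1 g -> itg f -> itg g.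
Proof. by move=> /funext ->. Qed.

Lemma eq_Ex f g : f =1 g -> Ex f = Ex g.
Proof. by move=> /funext ->. Qed.

Lemma itgP f : itg f -> (\int[P]_w (f w)%:E)%E = (Ex f)%:E.
Proof. by move=> fi; rewrite /Ex /Rintegral fineK// integrable_fin_num. Qed.

Lemma itg_cst (k : R) : itg (fun=> k).
Proof. exact: finite_measure_integrable_cst. Qed.

Lemma Ex_cst (k : R) : Ex (fun=> k) = k.
Proof. by rewrite /Ex Rintegral_cst// [X in fine X](_ : _ = 1%E) ?mulr1//; exact: probability_setT. Qed.

Lemma itgD f g : itg f -> itg g -> itg (fun w => f w + g w).
Proof. by move=> fi gi; rewrite /itg (_ : _ \o _ = (EFin \o f) \+ (EFin \o g))%E//; exact: integrableD. Qed.

Lemma itgB f g : itg f -> itg g -> itg (fun w => f w - g w).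
Proof. by move=> fi gi; rewrite /itg (_ : _ \o _ = (EFin \o f) \- (EFin \o g))%E//; exact: integrableB. Qed.

Lemma itgZ (k : R) f : itg f -> itg (fun w => k * f w).
Proof. by move=> fi; rewrite /itg (_ : _ \o _ = (fun w => k%:E * (EFin \o f) w)%E)//; exact: integrableZl. Qed.

Lemma itg_norm f : itg f -> itg (fun w => `|f w|).
Proof. exact: integrable_norm. Qed.

Lemma itg_sum (I : Type) (s : seq I) (p : pred I) (F : I -> T -> R) :
  (forall i, p i -> itg (F i)) -> itg (fun w => \sum_(i <- s | p i) F i w).
Proof.
move=> Fi; elim: s => [|i s IH].
  by apply: eq_itg (itg_cst 0) => w; rewrite big_nil.
have [pi|pi] := boolP (p i).
  by apply: eq_itg (itgD (Fi _ pi) IH) => w; rewrite big_cons pi.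
by apply: eq_itg IH => w; rewrite big_cons (negbTE pi).
Qed.

Lemma itg_dom f g : measurable_fun setT f -> (forall w, `|f w| <= g w) -> itg g -> itg f.
Proof.
move=> mf fg gi; apply: le_integrable gi => //; first exact/measurable_EFinP.
move=> w _; rewrite /= lee_fin; apply: (le_trans (fg w)); exact: ler_norm.
Qed.

Lemma itg_bounded f (M : R) : measurable_fun setT f -> (forall w, `|f w| <= M) -> itg f.
Proof. by move=> mf fM; apply: itg_dom (itg_cst M). Qed.

Lemma ExD f g : itg f -> itg g -> Ex (fun w => f w + g w) = Ex f + Ex g.
Proof. exact: RintegralD. Qed.

Lemma ExB f g : itg f -> itg g -> Ex (fun w => f w - g w) = Ex f - Ex g.
Proof. exact: RintegralB. Qed.

Lemma ExZ (k : R) f : itg f -> Ex (fun w => k * f w) = k * Ex f.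
Proof. exact: RintegralZl. Qed.

Lemma Ex_sum (I : Type) (s : seq I) (p : pred I) (F : I -> T -> R) :
  (forall i, p i -> itg (F i)) ->
  Ex (fun w => \sum_(i <- s | p i) F i w) = \sum_(i <- s | p i) Ex (F i).
Proof.
move=> Fi; elim: s => [|i s IH].
  by rewrite big_nil -[RHS](Ex_cst 0); apply: eq_Ex => w; rewrite big_nil.
rewrite big_cons -IH; have [pi|pi] := boolP (p i).
  rewrite -ExD; [|exact: Fi|exact: itg_sum].
  by apply: eq_Ex => w; rewrite big_cons pi.
by apply: eq_Ex => w; rewrite big_cons (negbTE pi).
Qed.

Lemma Ex_ge0 f : (forall w, 0 <= f w) -> 0 <= Ex f.
Proof. by move=> f0; exact: Rintegral_ge0. Qed.

Lemma Ex_le f g : itg f -> itg g -> (forall w, f w <= g w) -> Ex f <= Ex g.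
Proof. by move=> fi gi fg; exact: le_Rintegral. Qed.

Lemma Ex_norm f : itg f -> `|Ex f| <= Ex (fun w => `|f w|).
Proof. by move=> fi; exact: le_normr_Rintegral. Qed.

Lemma Ex_bounded f (M : R) : measurable_fun setT f -> (forall w, `|f w| <= M) -> `|Ex f| <= M.
Proof.
move=> mf fM; have fi := itg_bounded mf fM.
by apply: (le_trans (Ex_norm fi)); rewrite -[leRHS]Ex_cst; apply: Ex_le => //; [exact: itg_norm|exact: itg_cst].
Qed.

Lemma Ex_indic (A : set T) : measurable A -> Ex \1_A = fine (P A).
Proof. by move=> mA; rewrite /Ex /Rintegral integral_indic// setIT. Qed.

Lemma itg_indic (A : set T) : measurable A -> itg (\1_A).
Proof.
move=> mA; apply: (@itg_bounded _ 1); first exact: measurable_indic.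
by move=> w; rewrite indicE ger0_norm// lern1 leq_b1.
Qed.

Lemma ExM f g : indep2 P f g -> itg f -> itg g ->
  itg (fun w => f w * g w) /\ Ex (fun w => f w * g w) = Ex f * Ex g.
Proof.
move=> fg fi gi; have [ifg E] := indep2_integral fg fi gi; split=> //.
by rewrite /Ex /Rintegral E fineM// integrable_fin_num.
Qed.

(** Measurability of [g] has to be supplied separately because [P] need not be complete. *)
Lemma itg_ae_eq f g (N : set T) : measurable_fun setT g -> measurable N -> P N = 0%E ->
  (forall w, ~ N w -> f w = g w) -> itg f -> itg g /\ Ex f = Ex g.
Proof.
move=> mg mN N0 fg fi; have mf := itg_meas fi.
have ae : ae_eq P setT (EFin \o f) (EFin \o g).
  exists N; split => // w /= /not_implyP[_ h].
  by apply: contrapT => /fg E; apply: h; rewrite E.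
split.
  apply/integrableP; split; first exact/measurable_EFinP.
  rewrite (@ae_eq_integral _ _ _ P _ (fun w => `|(EFin \o f) w|%E)) //.
  - by move/integrableP : fi => [].
  - by apply: measurableT_comp => //; exact/measurable_EFinP.
  - by apply: measurableT_comp => //; exact/measurable_EFinP.
  - by apply: filterS ae => w /= h wT; have [E] := h wT; rewrite E.
rewrite /Ex /Rintegral; congr fine.
by apply: ae_eq_integral => //; exact/measurable_EFinP.
Qed.

Lemma prob_markov f (a : R) : itg f -> (forall w, 0 <= f w) -> 0 < a ->
  measurable [set w | a < f w] /\ fine (P [set w | a < f w]) <= Ex f / a.
Proof.
move=> fi f0 a0; have mf := itg_meas fi.
have mA : measurable [set w | a < f w].
  rewrite (_ : [set w | _] = f @^-1` `]a, +oo[); last first.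
    by apply/seteqP; split => w /=; rewrite in_itv/= andbT.
  by rewrite -[X in measurable X]setTI; exact: mf.
split => //; rewrite -Ex_indic// ler_pdivlMr// mulrC -ExZ; last exact: itg_indic.
apply: Ex_le => // [|w]; first by apply: itgZ; exact: itg_indic.
rewrite indicE; case: (boolP (w \in _)) => [|_]; last by rewrite mulr0.
by rewrite inE/= mulr1 => /ltW.
Qed.

Definition L2 f := measurable_fun setT f /\ itg (fun w => f w ^+ 2).
Definition L4 f := measurable_fun setT f /\ itg (fun w => f w ^+ 4).

Lemma L2_cst (k : R) : L2 (fun=> k).
Proof. by split=> //; exact: itg_cst. Qed.

Lemma L4_cst (k : R) : L4 (fun=> k).
Proof. by split=> //; exact: itg_cst. Qed.

Lemma L2M f g : L2 f -> L2 g -> itg (fun w => f w * g w).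
Proof.
move=> [mf f2] [mg g2]; apply: itg_dom (itgD f2 g2); first exact: measurable_funM.
move=> w; rewrite normrM -[f w ^+ 2]real_normK ?num_real// -[g w ^+ 2]real_normK ?num_real//.
by have := sqr_ge0 (`|f w| - `|g w|); have := normr_ge0 (f w); have := normr_ge0 (g w); nra.
Qed.

Lemma L2_itg f : L2 f -> itg f.
Proof. by move=> /L2M/(_ (L2_cst 1)); apply: eq_itg => w; rewrite mulr1. Qed.

Lemma L2_meas f : L2 f -> measurable_fun setT f. Proof. by case. Qed.
Lemma L4_meas f : L4 f -> measurable_fun setT f. Proof. by case. Qed.

Lemma L4M f g : L4 f -> L4 g -> L2 (fun w => f w * g w).
Proof.
move=> [mf f4] [mg g4]; split; first exact: measurable_funM.
apply: itg_dom (itgD f4 g4); first by apply: measurable_funX; exact: measurable_funM.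
move=> w; rewrite normrX normrM exprMn.
rewrite !real_normK ?num_real//.
rewrite (exprM (f w) 2 2) (exprM (g w) 2 2).
have := sqr_ge0 (f w ^+ 2 - g w ^+ 2); have := sqr_ge0 (f w); have := sqr_ge0 (g w); nra.
Qed.

Lemma L4_L2 f : L4 f -> L2 f.
Proof. by move=> /L4M/(_ (L4_cst 1)); congr L2; apply/funext => w; rewrite mulr1. Qed.

Lemma L4_itg f : L4 f -> itg f. Proof. by move=> /L4_L2/L2_itg. Qed.

Lemma eq_L2 f g : f =1 g -> L2 f -> L2 g. Proof. by move=> /funext ->. Qed.
Lemma eq_L4 f g : f =1 g -> L4 f -> L4 g. Proof. by move=> /funext ->. Qed.

Lemma L2D f g : L2 f -> L2 g -> L2 (fun w => f w + g w).
Proof.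
move=> f2 g2; split; first by apply: measurable_funD; exact: L2_meas.
apply: eq_itg (itgD (itgD f2.2 g2.2) (itgZ 2 (L2M f2 g2))) => w.
by rewrite sqrrD -mulr_natl; ring.
Qed.

Lemma L4D f g : L4 f -> L4 g -> L4 (fun w => f w + g w).
Proof.
move=> f4 g4; split; first by apply: measurable_funD; exact: L4_meas.
have h := L2D (L2D (L4M f4 f4) (L4M g4 g4)) (L2D (L4M f4 g4) (L4M f4 g4)).
by apply: eq_itg h.2 => w; ring.
Qed.

Lemma L2Z (k : R) f : L2 f -> L2 (fun w => k * f w).
Proof.
move=> f2; split; first by apply: measurable_funM => //; exact: L2_meas.
by apply: eq_itg (itgZ (k ^+ 2) f2.2) => w; rewrite exprMn.
Qed.

Lemma L4Z (k : R) f : L4 f -> L4 (fun w => k * f w).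
Proof.
move=> f2; split; first by apply: measurable_funM => //; exact: L4_meas.
by apply: eq_itg (itgZ (k ^+ 4) f2.2) => w; rewrite exprMn.
Qed.

Lemma L2B f g : L2 f -> L2 g -> L2 (fun w => f w - g w).
Proof. by move=> f2 g2; apply: eq_L2 (L2D f2 (L2Z (-1) g2)) => w; rewrite mulN1r. Qed.

Lemma L4B f g : L4 f -> L4 g -> L4 (fun w => f w - g w).
Proof. by move=> f2 g2; apply: eq_L4 (L4D f2 (L4Z (-1) g2)) => w; rewrite mulN1r. Qed.

Lemma L4_sum (I : Type) (s : seq I) (p : pred I) (F : I -> T -> R) :
  (forall i, p i -> L4 (F i)) -> L4 (fun w => \sum_(i <- s | p i) F i w).
Proof.
move=> Fi; elim: s => [|i s IH].
  by apply: eq_L4 (L4_cst 0) => w; rewrite big_nil.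
have [pi|pi] := boolP (p i).
  by apply: eq_L4 (L4D (Fi _ pi) IH) => w; rewrite big_cons pi.
by apply: eq_L4 IH => w; rewrite big_cons (negbTE pi).
Qed.

Lemma indep2_comp f g (u v : R -> R) : measurable_fun setT u -> measurable_fun setT v ->
  indep2 P f g -> indep2 P (u \o f) (v \o g).
Proof.
move=> mu mv fg A B mA mB; apply: (fg (u @^-1` A) (v @^-1` B)).
  by rewrite -[X in measurable X]setTI; exact: mu.
by rewrite -[X in measurable X]setTI; exact: mv.
Qed.

(** Without independence such a product is only in [L2]. This gain is what provides fourth moments
    for cross terms when the data themselves have only four. *)
Lemma indep2_L4 f g : indep2 P f g -> L4 f -> L4 g -> L4 (fun w => f w * g w).
Proof.
move=> fg [mf f2] [mg g2]; split; first exact: measurable_funM.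
have h : indep2 P (fun w => f w ^+ 4) (fun w => g w ^+ 4).
  by apply: (indep2_comp (u := fun x => x ^+ 4) (v := fun x => x ^+ 4)) fg; exact: exprn_measurable.
by apply: eq_itg (ExM h f2 g2).1 => w; rewrite exprMn.
Qed.

End real_expectation.

Section block_measurability.
Context {d : measure_display} {T : measurableType d} {R : realType}.
Variables (P : probability T R) (I : finType) (G : I -> set (set T)).

(** Phrased as ordinary measurability for a generated sigma-algebra, so that the closure properties
    of measurable functions transfer to block-measurable ones without new proofs. *)
Definition bmeas (J : {set I}) (f : T -> R) :=
  @measurable_fun _ _ (g_sigma_algebraType (block G J)) R setT f.

Lemma bmeasP (J : {set I}) f : bmeas J f <->
  forall A, measurable A -> <<s block G J >> (f @^-1` A).
Proof.
split=> [fJ A mA|fJ _ A mA]; last by rewrite setTI; exact: fJ.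
by rewrite -[X in <<s _ >> X]setTI; exact: fJ.
Qed.

Lemma bmeas_sub (J K : {set I}) f : J \subset K -> bmeas J f -> bmeas K f.
Proof. by move=> JK /bmeasP fJ; apply/bmeasP => A mA; apply: (sub_block JK); exact: fJ. Qed.

Lemma bmeas1 (i : I) f : (forall A, measurable A -> G i (f @^-1` A)) -> bmeas [set i]%SET f.
Proof.
move=> fG; apply/bmeasP => A mA; apply: sub_sigma_algebra.
by exists i; [rewrite inE|exact: fG].
Qed.

Lemma bmeas_indic (i : I) (A : set T) : G i A -> bmeas [set i]%SET \1_A.
Proof.
move=> GA; rewrite /bmeas; apply: measurable_indic; apply: sub_sigma_algebra.
by exists i; rewrite ?inE.
Qed.

Hypothesis piG : pi_family G.
Hypothesis indG : indep_family P G.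

Lemma bmeas_meas (J : {set I}) f : bmeas J f -> measurable_fun setT f.
Proof.
move=> /bmeasP fJ _ A mA; rewrite setTI.
have h : <<s block G J >> `<=` @measurable _ T.
  by apply: smallest_sub; [exact: sigma_algebra_measurable|exact: block_measurable].
by apply: h; exact: fJ.
Qed.

Lemma bmeas_indep (J K : {set I}) f g : {in J, forall i, i \notin K} ->
  bmeas J f -> bmeas K g -> indep2 P f g.
Proof.
move=> JK /bmeasP fJ /bmeasP gK A B mA mB.
by apply: (indep_block piG indG JK); [exact: fJ|exact: gK].
Qed.

End block_measurability.

(** * A quantitative central limit theorem for cosines *)

Section clt_inequality.
Context {d : measure_display} {T : measurableType d} {R : realType}.
Variable P : probability T R.
Local Notation E := (Ex P).

Lemma itg_cos (f : T -> R) : measurable_fun setT f -> itg P (fun w => cos (f w)).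
Proof.
move=> mf; apply: (@itg_bounded _ _ _ _ _ 1).
  by apply: measurableT_comp mf; apply: continuous_measurable_fun; exact: continuous_cos.
by move=> w; rewrite ler_norml cos_geN1 cos_le1.
Qed.

Lemma itg_sin (f : T -> R) : measurable_fun setT f -> itg P (fun w => sin (f w)).
Proof.
move=> mf; apply: (@itg_bounded _ _ _ _ _ 1).
  by apply: measurableT_comp mf; apply: continuous_measurable_fun; exact: continuous_sin.
by move=> w; rewrite ler_norml sin_geN1 sin_le1.
Qed.

Lemma itg_tail2 (f : T -> R) : L2 P f -> itg P (fun w => tail2 (f w)).
Proof.
move=> [mf f2]; apply: itg_dom f2.
  by apply: measurable_minr; apply: measurable_funX => //; exact: measurableT_comp.
by move=> w; rewrite ger0_norm ?tail2_ge0// tail2_sqr.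
Qed.

Lemma Ex_cos_bound (f : T -> R) : measurable_fun setT f -> `|E (fun w => cos (f w))| <= 1.
Proof.
move=> mf; apply: Ex_bounded; first exact: itg_meas (itg_cos mf).
by move=> w; rewrite ler_norml cos_geN1 cos_le1.
Qed.

(** The cosine and the exponential share the expansion [1 - s / 2]; the error is the sum of the two
    remainders, and the exponential one is quadratic in the variance. *)
Lemma Ex_cos_near (f : T -> R) : L2 P f ->
  `|E (fun w => cos (f w)) - expR (- (E (fun w => f w ^+ 2) / 2))| <=
  2 * E (fun w => tail2 (f w)) + (E (fun w => f w ^+ 2)) ^+ 2.
Proof.
move=> f2; have [mf if2] := f2; set s := E (fun w => f w ^+ 2).
have s0 : 0 <= s by apply: Ex_ge0 => w; exact: sqr_ge0.
have ic := itg_cos mf; have it := itg_tail2 f2.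
have i1 : itg P (fun w => cos (f w) - 1 + f w ^+ 2 / 2).
  by apply: eq_itg (itgD (itgB ic (itg_cst P 1)) (itgZ 2^-1 if2)) => w; rewrite mulrC.
have E1 : E (fun w => cos (f w) - 1 + f w ^+ 2 / 2) = E (fun w => cos (f w)) - 1 + s / 2.
  have e1 : E (fun w => cos (f w) - 1) = E (fun w => cos (f w)) - 1.
    by rewrite ExB ?Ex_cst//; exact: itg_cst.
  have i2 := itgB ic (itg_cst P 1); have i3 := itgZ 2^-1 if2.
  rewrite -e1 (mulrC s) -(ExZ _ if2) -(ExD i2 i3).
  by apply: eq_Ex => w; rewrite (mulrC 2^-1).
have h1 : `|E (fun w => cos (f w)) - 1 + s / 2| <= 2 * E (fun w => tail2 (f w)).
  rewrite -E1; apply: (le_trans (Ex_norm i1)); rewrite -ExZ//.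
  by apply: Ex_le; [exact: itg_norm|exact: itgZ|move=> w; exact: cos_tail2].
have h2 : `|expR (- (s / 2)) - 1 + s / 2| <= (s / 2) ^+ 2 by apply: expRN_taylor; lra.
have h3 : (s / 2) ^+ 2 <= s ^+ 2 by nra.
have -> : E (fun w => cos (f w)) - expR (- (s / 2)) =
  (E (fun w => cos (f w)) - 1 + s / 2) - (expR (- (s / 2)) - 1 + s / 2) by ring.
by apply: (le_trans (ler_normB _ _)); apply: lerD => //; exact: le_trans h3.
Qed.

Lemma Ex_sin_near (f : T -> R) : L2 P f -> E f = 0 ->
  `|E (fun w => sin (f w))| <= 2 * E (fun w => tail2 (f w)).
Proof.
move=> f2 f0; have [mf if2] := f2.
have i1 : itg P (fun w => sin (f w) - f w) by apply: itgB; [exact: itg_sin|exact: L2_itg].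
have E1 : E (fun w => sin (f w) - f w) = E (fun w => sin (f w)).
  by rewrite ExB ?f0 ?subr0//; [exact: itg_sin|exact: L2_itg].
rewrite -E1; apply: (le_trans (Ex_norm i1)); rewrite -ExZ; last exact: itg_tail2.
by apply: Ex_le; [exact: itg_norm|apply: itgZ; exact: itg_tail2|move=> w; exact: sin_tail2].
Qed.

(* Adding the independent summands one at a time, with an arbitrary phase [c] so that sine terms are covered too. *)
Lemma clt_inequality (N : nat) (xi : nat -> T -> R) (c : R) :
  let S k w := \sum_(i < k) xi i w in
  let s k := E (fun w => xi k w ^+ 2) in
  (forall k, (k < N)%N -> L2 P (xi k)) ->
  (forall k, (k < N)%N -> E (xi k) = 0) ->
  (forall k, (k < N)%N -> indep2 P (S k) (xi k)) ->
  `|E (fun w => cos (S N w + c)) - expR (- ((\sum_(k < N) s k) / 2)) * cos c| <=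
  \sum_(k < N) (4 * E (fun w => tail2 (xi k w)) + s k ^+ 2).
Proof.
move=> S s xi2 xi0 ind.
suff : forall k, (k <= N)%N -> forall c, `|E (fun w => cos (S k w + c)) - expR (- ((\sum_(k < k) s k) / 2)) * cos c| <=
  \sum_(k < k) (4 * E (fun w => tail2 (xi k w)) + s k ^+ 2) by move/(_ N (leqnn N)).
move=> {c}; elim=> [|k IH] kN c.
  rewrite !big_ord0 mul0r oppr0 expR0 mul1r /S.
  under eq_Ex do rewrite big_ord0 add0r.
  by rewrite Ex_cst subrr normr0.
have mS : measurable_fun setT (S k).
  by apply: measurable_sum => i; apply: L2_meas; apply: xi2; exact: ltn_trans (ltn_ord i) kN.
have mSc (a : R) : measurable_fun setT (fun w => S k w + a) by exact: measurable_funD.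
have x2 := xi2 _ kN; have mx := L2_meas x2.
have mcos (a : R) : measurable_fun setT (fun x : R => cos (x + a)).
  apply: (measurableT_comp (f := cos)); last exact: measurable_funD.
  by apply: continuous_measurable_fun; exact: continuous_cos.
have Ecos : E (fun w => cos (S k w + c) * cos (xi k w)) =
    E (fun w => cos (S k w + c)) * E (fun w => cos (xi k w)).
  apply: (ExM _ _ _).2; [|exact: itg_cos|exact: itg_cos].
  apply: (indep2_comp (u := fun x => cos (x + c)) (v := cos)) (ind _ kN) => //.
  by apply: continuous_measurable_fun; exact: continuous_cos.
have Esin : E (fun w => cos (S k w + (c + pi / 2)) * sin (xi k w)) =
    E (fun w => cos (S k w + (c + pi / 2))) * E (fun w => sin (xi k w)).
  apply: (ExM _ _ _).2; [|exact: itg_cos|exact: itg_sin].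
  apply: (indep2_comp (u := fun x => cos (x + (c + pi / 2))) (v := sin)) (ind _ kN) => //.
  by apply: continuous_measurable_fun; exact: continuous_sin.
(* Addition formula, with minus the sine of the partial sum written as a cosine shifted by [pi / 2];
   independence then splits each product. *)
have -> : E (fun w => cos (S k.+1 w + c)) =
    E (fun w => cos (S k w + c)) * E (fun w => cos (xi k w)) +
    E (fun w => cos (S k w + (c + pi / 2))) * E (fun w => sin (xi k w)).
  rewrite -Ecos -Esin -ExD.
  - apply: eq_Ex => w; rewrite /S big_ord_recr/= addrA cosDpihalf.
    by rewrite addrAC cosD mulNr.
  - apply: (ExM _ _ _).1; [|exact: itg_cos|exact: itg_cos].
    apply: (indep2_comp (u := fun x => cos (x + c)) (v := cos)) (ind _ kN) => //.
    by apply: continuous_measurable_fun; exact: continuous_cos.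
  - apply: (ExM _ _ _).1; [|exact: itg_cos|exact: itg_sin].
    apply: (indep2_comp (u := fun x => cos (x + (c + pi / 2))) (v := sin)) (ind _ kN) => //.
    by apply: continuous_measurable_fun; exact: continuous_sin.
rewrite !big_ord_recr/= [X in expR (- X)]mulrDl opprD expRD.
set u := E (fun w => cos (S k w + c)); set v := E (fun w => cos (S k w + _)).
set a := E (fun w => cos (xi k w)); set b := E (fun w => sin (xi k w)).
set e1 := expR _; set e2 := expR _.
have h1 : `|u - e1 * cos c| <= \sum_(k < k) (4 * E (fun w => tail2 (xi k w)) + s k ^+ 2) by apply: IH; exact: ltnW.
have h2 : `|a - e2| <= 2 * E (fun w => tail2 (xi k w)) + s k ^+ 2 by exact: Ex_cos_near.
have h3 : `|b| <= 2 * E (fun w => tail2 (xi k w)) by apply: Ex_sin_near => //; exact: xi0.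
have hu : `|u| <= 1 by exact: Ex_cos_bound.
have hv : `|v| <= 1 by exact: Ex_cos_bound.
have he : `|e2| <= 1.
  rewrite ger0_norm ?expR_ge0// -expR0 ler_expR oppr_le0 divr_ge0//.
  by apply: Ex_ge0 => w; exact: sqr_ge0.
(* The earlier error is damped by [e2 <= 1], so errors only add up. The factor [b] is of remainder
   size because the new summand is centered. *)
have -> : u * a + v * b - e1 * e2 * cos c = (u - e1 * cos c) * e2 + (u * (a - e2) + v * b) by ring.
apply: (le_trans (ler_normD _ _)); apply: lerD.
  by rewrite normrM; apply: le_trans h1; rewrite ler_piMr.
apply: (le_trans (ler_normD _ _)); rewrite !normrM.
have : `|u| * `|a - e2| <= `|a - e2| by rewrite ler_piMl.
have : `|v| * `|b| <= `|b| by rewrite ler_piMl.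
lra.
Qed.

End clt_inequality.

(** * Convergence in distribution from cosines *)

Section uniform_continuity.
Context {R : realType} (p : nat).

(** Compactness of the box yields one radius for all its points. Only [x] is confined to the box;
    [y] may leave it slightly. *)
Lemma box_ucont (f : 'cV[R]_p -> R) (L eps : R) : continuous f -> 0 < eps ->
  exists2 e : R, 0 < e & forall x y : 'cV[R]_p, (forall i, `|x i 0| <= L) ->
    (forall i, `|x i 0 - y i 0| < e) -> `|f x - f y| < eps.
Proof.
move=> cf eps0.
have cK := @rV_compact R p (fun=> `[- L, L]%classic) (fun=> @segment_compact R (- L) L).
pose Q (e : R) (v : 'rV[R]_p) := forall y : 'rV[R]_p, (forall i, `|v 0 i - y 0 i| < e) -> `|f v^T - f y^T| < eps.
(* Compactness is used as a near-covering property along radii tending to zero from the right: a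
   radius good near each point becomes one good for the whole box. *)
have cov := iffLR (compact_near_coveringP _) cK R (0^'+) Q _.
have : \forall e \near 0^'+, [set v : 'rV[R]_p | forall i, `[- L, L]%classic (v ord0 i)] `<=` Q e.
  apply: cov => v _.
  have /cvgrPdist_lt /(_ (eps / 2)) := cf v^T.
  have e2 : 0 < eps / 2 by rewrite divr_gt0.
  move=> /(_ e2) /(@nbhs_ballP _ 'cV[R]_p)[r /= r0 vr].
  have vr' (y : 'rV[R]_p) : (forall i, `|v 0 i - y 0 i| < r) -> `|f v^T - f y^T| < eps / 2.
    move=> h; apply: vr; split=> // i j; rewrite !mxE ord1; exact: h.
  exists (ball v (r / 2), [set e | e < r / 2]) => /=.
    split; first by apply: nbhsx_ballx; rewrite divr_gt0.
    by apply: nbhs_right_lt; rewrite divr_gt0.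
  move=> [u e] /= [[_ vu] er] y uy.
  have h1 : `|f v^T - f u^T| < eps / 2.
    by apply: vr' => i; have := vu 0 i; rewrite /ball/= => /lt_trans; apply; lra.
  have h2 : `|f v^T - f y^T| < eps / 2.
    apply: vr' => i; have := vu 0 i; rewrite /ball/= => h.
    have := uy i; have := ler_distD (u 0 i) (v 0 i) (y 0 i); lra.
  by have := ler_distD (f v^T) (f u^T) (f y^T); rewrite distrC in h1; lra.
move=> /(@nbhs_ballP _ R^o)[e /= e0 he].
exists (e / 2); first by rewrite divr_gt0.
move=> x y xL xy.
have e2 : 0 < e / 2 by rewrite divr_gt0.
have /= := he (e / 2); rewrite /ball/= sub0r normrN gtr0_norm// => /(_ _ e2).
have e3 : e / 2 < e by lra.
move=> /(_ e3 x^T) H.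
have xb : forall i, `[- L, L]%classic (x^T 0 i).
  by move=> i /=; rewrite in_itv/= mxE -ler_norml.
have := H xb y^T; rewrite !trmxK; apply => i; rewrite !mxE.
exact: xy.
Qed.

End uniform_continuity.

Section trigonometric_polynomials.
Context {R : realType} (p : nat).
Implicit Types (f g : 'cV[R]_p -> R) (t x a : 'cV[R]_p).

(** An inductive closure, with no normal form, so that boundedness, measurability and convergence of
    expectations each follow by induction from the cosine case. *)
Inductive trigpoly : ('cV[R]_p -> R) -> Prop :=
| trigpoly_cos t c : trigpoly (fun x => cos ((t^T *m x) 0 0 + c))
| trigpoly_add f g : trigpoly f -> trigpoly g -> trigpoly (fun x => f x + g x)
| trigpoly_scale k f : trigpoly f -> trigpoly (fun x => k * f x).

Lemma eq_trigpoly f g : f =1 g -> trigpoly f -> trigpoly g.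
Proof. by move=> /funext ->. Qed.

Lemma trigpoly_cst (k : R) : trigpoly (fun=> k).
Proof.
apply: eq_trigpoly (trigpoly_scale k (trigpoly_cos 0 0)) => x.
by rewrite trmx0 mul0mx mxE addr0 cos0 mulr1.
Qed.

(** Products of generators are linearized by the product-to-sum formula; the phases make sines
    unnecessary. *)
Lemma trigpoly_mul f g : trigpoly f -> trigpoly g -> trigpoly (fun x => f x * g x).
Proof.
move=> tf; elim: tf g => {f} [t c|f1 f2 tf1 IH1 tf2 IH2|k f tf IH] g tg.
- elim: tg => {g} [u b|g1 g2 _ IH1 _ IH2|k g _ IH].
  + have := trigpoly_add (trigpoly_scale 2^-1 (trigpoly_cos (t + u) (c + b)))
                         (trigpoly_scale 2^-1 (trigpoly_cos (t - u) (c - b))).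
    apply: eq_trigpoly => x; rewrite !linearD/= linearN/= mulmxDl mulmxBl !mxE.
    set A := \sum_j _; set B := \sum_j _.
    have -> : A + B + (c + b) = (A + c) + (B + b) by ring.
    have -> : A - B + (c - b) = (A + c) - (B + b) by ring.
    by rewrite cosB cosD; lra.
  + by apply: eq_trigpoly (trigpoly_add IH1 IH2) => x; rewrite mulrDr.
  + by apply: eq_trigpoly (trigpoly_scale k IH) => x; rewrite mulrCA.
- by apply: eq_trigpoly (trigpoly_add (IH1 _ tg) (IH2 _ tg)) => x; rewrite mulrDl.
- by apply: eq_trigpoly (trigpoly_scale k (IH _ tg)) => x; rewrite mulrA.
Qed.

Lemma trigpoly_sin_coord (i : 'I_p) (k : R) : trigpoly (fun x => sin (k * x i 0)).
Proof.
apply: eq_trigpoly (trigpoly_cos (k *: delta_mx i 0) (- (pi / 2))) => x.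
have -> : ((k *: (delta_mx i 0 : 'cV[R]_p))^T *m x) 0 0 = k * x i 0.
  rewrite mxE (bigD1 i)//= big1 ?addr0 => [|j ji].
    by rewrite !mxE !eqxx mulr1.
  by rewrite !mxE (negbTE ji) mulr0 mul0r.
by rewrite -[_ * _ - _]opprB cosN cosB cos_pihalf sin_pihalf mul0r add0r mul1r.
Qed.

(* Expectation of [g] after a random walk from [a] that tries to move by [h] along
   each coordinate listed in [s], succeeding with probability [v j]: a multivariate
   Bernstein operator. *)
Fixpoint walk (s : seq 'I_p) g (v : 'I_p -> R) (h : R) a : R :=
  if s is j :: s' then
    v j * walk s' g v h (a + h *: delta_mx j 0) + (1 - v j) * walk s' g v h a
  else g a.

Lemma walk_le s f g v h a : (forall j, 0 <= v j <= 1) -> (forall x, f x <= g x) ->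
  walk s f v h a <= walk s g v h a.
Proof.
move=> v01 fg; elim: s a => [//|j s IH] a /=; have /andP[v0 v1] := v01 j.
by apply: lerD; rewrite ler_wpM2l// subr_ge0.
Qed.

Lemma walk_cst s (k : R) v h a : walk s (fun=> k) v h a = k.
Proof. by elim: s a => [//|j s IH] a /=; rewrite !IH; ring. Qed.

(** Squared bias plus variance: coordinate [i] moves by [h] times a binomial variable with as many
    trials as [i] occurs in [s]. *)
Lemma walk_quadratic s (e C : R) (c : 'I_p -> R) v h a :
  walk s (fun x => e + C * \sum_i (x i 0 - c i) ^+ 2) v h a =
  e + C * \sum_i ((a i 0 + h * (count_mem i s)%:R * v i - c i) ^+ 2 +
                  (count_mem i s)%:R * h ^+ 2 * v i * (1 - v i)).
Proof.
elim: s a => [|j s IH] a /=.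
  congr (_ + _ * _); apply: eq_bigr => i _.
  by rewrite mulr0 !mul0r !addr0.
rewrite !IH.
have -> (A B : R) : v j * (e + C * A) + (1 - v j) * (e + C * B) =
  e + C * (v j * A + (1 - v j) * B) by ring.
congr (_ + _ * _); rewrite !mulr_sumr -big_split/=; apply: eq_bigr => i _.
rewrite !mxE eqxx andbT eq_sym natrD; have [->|ij] := eqVneq j i.
    by rewrite [nat_of_bool true]/=; ring.
by rewrite [nat_of_bool false]/=; ring.
Qed.

Lemma trigpoly_walk s g (v : 'cV[R]_p -> 'I_p -> R) h a :
  (forall j, trigpoly (fun x => v x j)) -> trigpoly (fun x => walk s g (v x) h a).
Proof.
move=> tv; elim: s a => [|j s IH] a /=; first exact: trigpoly_cst.
apply: trigpoly_add; apply: trigpoly_mul => //.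
apply: eq_trigpoly (trigpoly_add (trigpoly_cst 1) (trigpoly_scale (-1) (tv j))) => x.
by rewrite mulN1r.
Qed.

Lemma clip_lip (L a b : R) :
  `|Num.max (- L) (Num.min L a) - Num.max (- L) (Num.min L b)| <= `|a - b|.
Proof.
have lip (F : R -> R) : (forall s t : R, s <= t -> F s <= F t) -> (forall s t : R, s <= t -> F t - F s <= t - s) ->
    forall s t : R, `|F s - F t| <= `|s - t|.
  move=> mF lF s t; case: (leP s t) => st; last have {}st := ltW st.
    by rewrite distrC [leRHS]distrC !ger0_norm ?subr_ge0 ?mF ?lF.
  by rewrite !ger0_norm ?subr_ge0 ?mF ?lF.
apply: le_trans (lip (Num.max (- L)) _ _ _ _) (lip (Num.min L) _ _ _ _) => s t st.
- by rewrite le_max2.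
- by case: (leP (- L) s) => h1; case: (leP (- L) t) => h2; lra.
- by rewrite le_min2.
- by case: (leP L s) => h1; case: (leP L t) => h2; lra.
Qed.

Lemma clip_bound (L a : R) : 0 <= L -> `|Num.max (- L) (Num.min L a)| <= L.
Proof.
move=> L0; rewrite ler_norml.
by case: (leP L a) => ?; [case: (leP (- L) L)|case: (leP (- L) a)] => ?; apply/andP; split; lra.
Qed.

Lemma clip_id (L a : R) : `|a| <= L -> Num.max (- L) (Num.min L a) = a.
Proof.
rewrite ler_norml => /andP[h1 h2].
by case: (leP L a) => ?; [case: (leP (- L) L)|case: (leP (- L) a)] => ?; lra.
Qed.

(** The approximant is a Bernstein average of values of [f], with success probabilities that are
    trigonometric in [x]. Being an average, it obeys the bound [M] on the whole space and not only
    on the box, which controls its contribution from the tails. *)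
Lemma trig_approx f (M eps L : R) : continuous f -> (forall x, `|f x| <= M) ->
  0 < eps -> 0 < L ->
  exists2 F, trigpoly F & (forall x, `|F x| <= M) /\
    (forall x, (forall i, `|x i 0| <= L) -> `|F x - f x| <= eps).
Proof.
move=> cf fM eps0 L0.
have M0 : 0 <= M by apply: le_trans (fM 0).
have e4 : 0 < eps / 4 by lra.
have [e1 e10 ucf1] := box_ucont (L + 1) cf e4.
pose e := Num.min e1 1.
have e0 : 0 < e by rewrite lt_min e10 ltr01.
have ele1 : e <= 1 by rewrite ge_min lexx orbT.
have ucf (x y : 'cV[R]_p) : (forall i, `|x i 0| <= L + 1) ->
    (forall i, `|x i 0 - y i 0| < e) -> `|f x - f y| < eps / 4.
  by move=> xL xy; apply: ucf1 => // i; apply: lt_le_trans (xy i) _; rewrite ge_min lexx.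
(* Clipping at [L + 1] makes [g] uniformly continuous everywhere and leaves room for a target point
   within [e <= 1] of the box of side [L]. *)
pose cl (a : R) := Num.max (- (L + 1)) (Num.min (L + 1) a).
have L1 : 0 <= L + 1 by lra.
pose g (y : 'cV[R]_p) := f (\col_j cl (y j 0)).
(* As in the Chebyshev inequality: if some coordinate differs by at least [e], the quadratic term
   alone exceeds the trivial bound [2 * M]. *)
pose C := 2 * M / e ^+ 2.
have C0 : 0 <= C by rewrite divr_ge0 ?sqr_ge0// mulr_ge0.
have gC (y z : 'cV[R]_p) : `|g y - g z| <= eps / 4 + C * \sum_i (y i 0 - z i 0) ^+ 2.
  have s0 (P : pred 'I_p) : 0 <= \sum_(i | P i) (y i 0 - z i 0) ^+ 2 by apply: sumr_ge0 => i _; exact: sqr_ge0.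
  have [h|/existsNP[i /negP]] := pselect (forall i, `|y i 0 - z i 0| < e).
    have h1 : `|g y - g z| < eps / 4.
      apply: ucf => i; rewrite !mxE; first exact: clip_bound.
      exact: le_lt_trans (clip_lip _ _ _) (h i).
    have : 0 <= C * \sum_i (y i 0 - z i 0) ^+ 2 by rewrite mulr_ge0.
    by move: h1; lra.
  rewrite -leNgt => h.
  have h1 : `|g y - g z| <= 2 * M.
    by apply: (le_trans (ler_normB _ _)); have := fM (\col_j cl (y j 0)); have := fM (\col_j cl (z j 0)); rewrite /g; lra.
  have h2 : e ^+ 2 <= (y i 0 - z i 0) ^+ 2.
    by rewrite -[leRHS]real_normK ?num_real// lerXn2r ?nnegrE// ltW.
  have h3 : e ^+ 2 <= \sum_i (y i 0 - z i 0) ^+ 2.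
    by rewrite (bigD1 i)//=; have := s0 (fun j => j != i); lra.
  have h4 : 2 * M <= C * \sum_i (y i 0 - z i 0) ^+ 2.
    rewrite /C mulrAC ler_pdivlMr ?exprn_gt0//.
    by apply: ler_wpM2l => //; rewrite mulr_ge0.
  lra.
(* The cubic remainder of [K * sin (K^-1 * x)] is at most [L ^+ 3 / 2 / K ^+ 2], hence below [e] for
   this [K >= 1]. The frequency is low enough for the sine to act as the identity on the box. *)
pose K := L ^+ 3 / e + 1.
have Le : 0 <= L ^+ 3 / e by rewrite divr_ge0 ?exprn_ge0 ?ltW.
have K1 : 1 <= K by rewrite /K; lra.
have K0 : 0 < K by lra.
have Ksin (x : R) : `|x| <= L -> `|K * sin (K^-1 * x) - x| < e.
  move=> xL.
  have -> : K * sin (K^-1 * x) - x = K * (sin (K^-1 * x) - K^-1 * x).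
    by rewrite mulrBr mulrA mulfV ?gt_eqF// mul1r.
  rewrite normrM gtr0_norm//.
  have h := sin_sub (K^-1 * x).
  apply: (le_lt_trans (ler_wpM2l (ltW K0) h)).
  rewrite normrM gtr0_norm ?invr_gt0// exprMn.
  have -> : K * (K^-1 ^+ 3 * `|x| ^+ 3 / 2) = `|x| ^+ 3 / 2 * K^-1 ^+ 2.
    by field; rewrite gt_eqF.
  have x3 : `|x| ^+ 3 <= L ^+ 3 by rewrite lerXn2r ?nnegrE// ltW.
  have Ki : K^-1 ^+ 2 <= K^-1.
    by rewrite expr2 ler_piMl ?invr_ge0 ?(ltW K0)// invf_le1.
  have x30 : 0 <= `|x| ^+ 3 by rewrite exprn_ge0.
  apply: (@le_lt_trans _ _ (L ^+ 3 / 2 * K^-1)).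
    by apply: ler_pM; [lra|rewrite exprn_ge0 ?invr_ge0 ?(ltW K0)|lra|exact: Ki].
  rewrite ltr_pdivrMr//.
  have -> : e * K = L ^+ 3 + e by rewrite /K mulrDr mulr1 mulrCA mulfV ?gt_eqF// mulr1.
  have : 0 <= L ^+ 3 by rewrite exprn_ge0 ?ltW.
  lra.
(* [B / N] will bound [C] times the total variance of the walk after [N] rounds, which fixes the
   choice of [N]. *)
pose B := C * (p%:R * K ^+ 2).
have B0 : 0 <= B by rewrite mulr_ge0// mulr_ge0// sqr_ge0.
pose N := (Num.truncn (B / (eps / 4))).+1.
have N0 : (0 : R) < N%:R by rewrite ltr0n.
have BN : B / N%:R <= eps / 4.
  rewrite ler_pdivrMr// mulrC -ler_pdivrMr//; apply/ltW.
  exact: truncnS_gt.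
pose s := flatten (nseq N (enum 'I_p)).
have cs i : count_mem i s = N.
  rewrite count_flatten map_nseq count_uniq_mem ?enum_uniq// mem_enum.
  by rewrite sumn_nseq mul1n.
pose v (x : 'cV[R]_p) (j : 'I_p) := (1 + sin (K^-1 * x j 0)) / 2.
have v01 x j : 0 <= v x j <= 1.
  by rewrite /v; have := sin_geN1 (K^-1 * x j 0); have := sin_le1 (K^-1 * x j 0); lra.
(* Starting at [- K] with [N] steps of length [2 * K / N] per coordinate, the mean endpoint is [- K
   + 2 * K * v x j = K * sin (K^-1 * x j 0)], so the bias vanishes. *)
pose a : 'cV[R]_p := const_mx (- K).
pose h := 2 * K / N%:R.
exists (fun x => walk s g (v x) h a).
  apply: trigpoly_walk => j.
  have := trigpoly_scale 2^-1 (trigpoly_add (trigpoly_cst 1) (trigpoly_sin_coord j K^-1)).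
  by apply: eq_trigpoly => x; rewrite /v mulrC.
have gM y : - M <= g y <= M by rewrite -ler_norml; exact: fM.
split=> [x|x xL].
  have lo : walk s (fun=> - M) (v x) h a <= walk s g (v x) h a.
    by apply: walk_le => // y; have /andP[] := gM y.
  have up : walk s g (v x) h a <= walk s (fun=> M) (v x) h a.
    by apply: walk_le => // y; have /andP[] := gM y.
  by rewrite !walk_cst in lo up; rewrite ler_norml lo up.
pose c (i : 'I_p) := K * sin (K^-1 * x i 0).
pose z : 'cV[R]_p := \col_i c i.
have Wq (b D : R) : walk s (fun y => b + D * \sum_i (y i 0 - c i) ^+ 2) (v x) h a =
    b + D * \sum_i (N%:R * h ^+ 2 * v x i * (1 - v x i)).
  rewrite walk_quadratic; congr (_ + _ * _); apply: eq_bigr => i _.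
  rewrite cs mxE (_ : - K + h * N%:R * v x i - c i = 0) ?expr0n ?add0r//.
  by rewrite /h /v /c; field; rewrite gt_eqF.
have Vb : \sum_i (N%:R * h ^+ 2 * v x i * (1 - v x i)) <= p%:R * K ^+ 2 / N%:R.
  have -> : p%:R * K ^+ 2 / N%:R = \sum_(i < p) (K ^+ 2 / N%:R).
    by rewrite sumr_const card_ord -[RHS]mulr_natl mulrA.
  apply: ler_sum => i _.
  have -> : N%:R * h ^+ 2 * v x i * (1 - v x i) = K ^+ 2 / N%:R * (4 * (v x i * (1 - v x i))).
    by rewrite /h; field; rewrite gt_eqF.
  apply: ler_piMr; first by rewrite divr_ge0 ?sqr_ge0 ?(ltW N0).
  by have := sqr_ge0 (2 * v x i - 1); nra.
have CV : C * \sum_i (N%:R * h ^+ 2 * v x i * (1 - v x i)) <= eps / 4.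
  by apply: le_trans BN; rewrite /B -(mulrA C); exact: ler_wpM2l.
(* The walk is monotone in the function it averages, so the quadratic majorant and minorant of [g]
   around [z] can be averaged exactly. *)
have Wg : `|walk s g (v x) h a - g z| <= eps / 2.
  have up : walk s g (v x) h a <= (g z + eps / 4) + C * \sum_i (N%:R * h ^+ 2 * v x i * (1 - v x i)).
    rewrite -Wq; apply: walk_le => // y; have := gC y z; rewrite ler_norml => /andP[_].
    by under eq_bigr do rewrite mxE; lra.
  have lo : (g z - eps / 4) + (- C) * \sum_i (N%:R * h ^+ 2 * v x i * (1 - v x i)) <= walk s g (v x) h a.
    rewrite -Wq; apply: walk_le => // y; have := gC y z; rewrite ler_norml => /andP[+ _].
    by under eq_bigr do rewrite mxE; lra.
  by rewrite ler_norml; lra.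
have zE : g z = f z.
  congr f; apply/colP => i; rewrite !mxE; apply: clip_id.
  have := Ksin _ (xL i); have := xL i; rewrite -/(c i) => h1 h2.
  have := ler_normD (c i - x i 0) (x i 0); rewrite subrK; lra.
have xz : `|f x - f z| < eps / 4.
  apply: ucf => i; first by have := xL i; lra.
  by rewrite mxE distrC Ksin.
rewrite zE in Wg.
have := ler_distD (f z) (walk s g (v x) h a) (f x); rewrite (distrC (f z)); lra.
Qed.

End trigonometric_polynomials.

Section vector_measurability.
Context {d : measure_display} {T : measurableType d} {R : realType} (p : nat).
Implicit Types Z : T -> 'cV[R]_p.

Lemma measurable_dot Z (t : 'cV[R]_p) (c : R) :
  (forall i, measurable_fun setT (fun w => Z w i 0)) ->
  measurable_fun setT (fun w => (t^T *m Z w) 0 0 + c).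
Proof.
move=> mZ; apply: measurable_funD => //.
rewrite (_ : (fun w => _) = fun w => \sum_j t j 0 * Z w j 0).
  by apply: measurable_sum => j; exact: measurable_funM.
by apply/funext => w; rewrite mxE; apply: eq_bigr => j _; rewrite mxE.
Qed.

Lemma measurable_trigpoly Z F : (forall i, measurable_fun setT (fun w => Z w i 0)) ->
  trigpoly F -> measurable_fun setT (fun w => F (Z w)).
Proof.
move=> mZ; elim=> {F} [t c|f g _ IHf _ IHg|k f _ IH].
- apply: (measurableT_comp (f := cos)); last exact: measurable_dot.
  by apply: continuous_measurable_fun; exact: continuous_cos.
- exact: measurable_funD.
- exact: measurable_funM.
Qed.

(** Approximation by trigonometric polynomials on growing boxes exhibits [f (Z w)] as a pointwise
    limit of measurable functions, starting from measurable coordinates alone. *)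
Lemma measurable_continuous_bounded Z (f : 'cV[R]_p -> R) (M : R) :
  (forall i, measurable_fun setT (fun w => Z w i 0)) ->
  continuous f -> (forall x, `|f x| <= M) -> measurable_fun setT (fun w => f (Z w)).
Proof.
move=> mZ cf fM.
have H n : exists F : 'cV[R]_p -> R, trigpoly F /\
    (forall x : 'cV[R]_p, (forall i, `|x i 0| <= n.+1%:R) -> `|F x - f x| <= n.+1%:R^-1).
  have e0 : (0 : R) < n.+1%:R^-1 by rewrite invr_gt0 ltr0n.
  have L0 : (0 : R) < n.+1%:R by rewrite ltr0n.
  by have [F tF [_ h]] := trig_approx cf fM e0 L0; exists F.
have [F FP] := choice H.
apply: (@measurable_fun_cvg _ _ _ setT (fun n w => F n (Z w))).
  by move=> n; apply: measurable_trigpoly => //; have [] := FP n.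
move=> w _; apply/cvgrPdist_le => e e0.
near=> n.
have [_ h] := FP n; rewrite distrC; apply: (le_trans (h _ _)).
  move=> i; apply: (@le_trans _ _ (\sum_j `|Z w j 0|)).
    by rewrite (bigD1 i)//= lerDl sumr_ge0.
  apply: (@le_trans _ _ n%:R); last by rewrite ler_nat.
  near: n; exact: nbhs_infty_ger.
apply/ltW; near: n; exact: near_infty_natSinv_lt (PosNum e0).
Unshelve. all: end_near. Qed.

End vector_measurability.

Section levy.
Context {R : realType} (p : nat).

Lemma Ex_approx (d : measure_display) (T : measurableType d) (P : probability T R)
    (f g : T -> R) (M eps : R) (A : set T) :
  measurable_fun setT f -> measurable_fun setT g -> measurable A ->
  (forall w, `|f w| <= M) -> (forall w, `|g w| <= M) ->
  (forall w, ~ A w -> `|f w - g w| <= eps) -> 0 <= eps ->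
  `|Ex P f - Ex P g| <= eps + 2 * M * fine (P A).
Proof.
move=> mf mg mA fM gM fg e0.
have fi := itg_bounded P mf fM; have gi := itg_bounded P mg gM.
rewrite -ExB//; apply: le_trans (Ex_norm (itgB fi gi)) _.
rewrite -[X in X + _](Ex_cst P) -Ex_indic// -ExZ; last exact: itg_indic.
rewrite -ExD; [|exact: itg_cst|by apply: itgZ; exact: itg_indic].
apply: Ex_le => [||w].
- exact/itg_norm/itgB.
- by apply: itgD; [exact: itg_cst|apply: itgZ; exact: itg_indic].
rewrite indicE; have [wA|wA] := boolP (w \in A).
  by apply: (le_trans (ler_normB _ _)); have := fM w; have := gM w; rewrite /= mulr1; lra.
by rewrite mulr0 addr0 fg// => /mem_set; rewrite (negbTE wA).
Qed.

(** The events that the coordinate sum exceeds [n] decrease to the empty set, and continuity from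
    above applies. *)
Lemma tight_vector (d : measure_display) (T : measurableType d) (P : probability T R)
    (G : T -> 'cV[R]_p) (eps : R) :
  (forall i, measurable_fun setT (fun w => G w i 0)) -> 0 < eps ->
  exists2 L : R, 0 < L & exists2 A : set T, measurable A &
    fine (P A) <= eps /\ forall w, ~ A w -> forall i, `|G w i 0| <= L.
Proof.
move=> mG e0.
pose F n := [set w | n%:R < \sum_i `|G w i 0|].
have mS : measurable_fun setT (fun w => \sum_i `|G w i 0|).
  by apply: measurable_sum => i; exact: measurableT_comp.
have mF n : measurable (F n).
  rewrite (_ : F n = (fun w => \sum_i `|G w i 0|) @^-1` `]n%:R, +oo[).
    by rewrite -[X in measurable X]setTI; exact: mS.
  by apply/seteqP; split => w; rewrite /F/= in_itv/= andbT.
have : (P \o F) x @[x --> \oo] --> P (\bigcap_n F n).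
  apply: nonincreasing_cvg_mu => //; last 2 first.
  - exact: bigcap_measurableType.
  - move=> a b ab; apply/subsetPset => w; rewrite /F/=; apply: le_lt_trans.
    by rewrite ler_nat.
  - by rewrite -ge0_fin_numE// fin_num_measure.
have -> : \bigcap_n F n = set0.
  rewrite -subset0 => w H.
  have := H (Num.truncn (\sum_i `|G w i 0|)).+1 I; rewrite /F/= ltNge => /negP; apply.
  exact/ltW/truncnS_gt.
rewrite measure0 => /fine_cvgP[_] /cvgrPdist_le /(_ _ e0)[N _ HN].
have := HN N.+1 (leqnSn N); rewrite /= sub0r normrN => h.
exists N.+1%:R; first by rewrite ltr0n.
exists (F N.+1) => //; split; first exact: le_trans (ler_norm _) h.
move=> w /negP; rewrite -leNgt => H i; apply: le_trans H.
by rewrite (bigD1 i)//= lerDl sumr_ge0.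
Qed.

(** Tightness is a hypothesis here, since moment bounds provide it in the applications. On a box
    that carries both laws up to a small mass, [f] may be exchanged for a trigonometric polynomial
    with the same bound. *)
Lemma levy_continuity (d : measure_display) (T : measurableType d) (P : probability T R)
    (Z : nat -> T -> 'cV[R]_p) (d' : measure_display) (T' : measurableType d')
    (Q : probability T' R) (G : T' -> 'cV[R]_p) :
  (forall i, measurable_fun setT (fun w => G w i 0)) ->
  (\forall n \near \oo, forall i, measurable_fun setT (fun w => Z n w i 0)) ->
  (forall eps, 0 < eps -> exists2 L : R, 0 < L & \forall n \near \oo,
     exists2 A : set T, measurable A &
     fine (P A) <= eps /\ forall w, ~ A w -> forall i, `|Z n w i 0| <= L) ->
  (forall (t : 'cV[R]_p) (c : R), Ex P (fun w => cos ((t^T *m Z n w) 0 0 + c)) @[n --> \oo] -->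
     Ex Q (fun w => cos ((t^T *m G w) 0 0 + c))) ->
  forall f : 'cV[R]_p -> R, continuous f -> (exists M : R, forall x, `|f x| <= M) ->
  (fun n => (\int[P]_w (f (Z n w))%:E)%E) @ \oo --> (\int[Q]_w (f (G w))%:E)%E.
Proof.
move=> mG mZ tZ cvgZ f cf [M fM].
have mfG := measurable_continuous_bounded mG cf fM.
have M0 : 0 <= M by apply: le_trans (fM 0).
have trigE (F : 'cV[R]_p -> R) : trigpoly F -> Ex P (fun w => F (Z n w)) @[n --> \oo] --> Ex Q (fun w => F (G w)).
  have bdd (H : 'cV[R]_p -> R) : trigpoly H -> exists K : R, forall x, `|H x| <= K.
    elim=> {H} [t c|h1 h2 _ [K1 H1] _ [K2 H2]|k h _ [K H]].
    - by exists 1 => x; rewrite ler_norml cos_geN1 cos_le1.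
    - by exists (K1 + K2) => x; apply: le_trans (ler_normD _ _) _; exact: lerD.
    - by exists (`|k| * K) => x; rewrite normrM ler_wpM2l.
  have itgt (d0 : measure_display) (T0 : measurableType d0) (P0 : probability T0 R) (Z0 : T0 -> 'cV[R]_p) (H : 'cV[R]_p -> R) :
      (forall i, measurable_fun setT (fun w => Z0 w i 0)) -> trigpoly H -> itg P0 (fun w => H (Z0 w)).
    by move=> m0 tH; have [K HK] := bdd _ tH; apply: (@itg_bounded _ _ _ _ _ K) => //; exact: measurable_trigpoly.
  elim=> {F} [t c|h1 h2 t1 IH1 t2 IH2|k h th IH]; first exact: cvgZ.
  - rewrite ExD; [|exact: itgt|exact: itgt].
    apply: (cvg_trans _ (cvgD IH1 IH2)); apply: near_eq_cvg; near=> n.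
    by rewrite /= ExD//; apply: itgt => //; near: n.
  - rewrite ExZ; last exact: itgt.
    apply: (cvg_trans _ (cvgM (cvg_cst k) IH)); apply: near_eq_cvg; near=> n.
    by rewrite /= ExZ//; apply: itgt => //; near: n.
rewrite (itgP (itg_bounded Q mfG (fun w => fM (G w)))).
suff H : Ex P (fun w => f (Z n w)) @[n --> \oo] --> Ex Q (fun w => f (G w)).
  apply: cvg_EFin; last exact: H.
  near=> n; rewrite itgP//; apply: (@itg_bounded _ _ _ _ _ M) => //.
  by apply: (measurable_continuous_bounded _ cf fM); near: n.
apply/cvgrPdist_le => e e0.
(* Each exchange of [f] for [F] costs [e / 8] on the box and [2 * M * eta <= e / 4] outside; with
   [e / 8] for the polynomial the total is below [e]. The [+ 1] covers [M = 0]. *)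
pose eta := e / (8 * (M + 1)).
have eta0 : 0 < eta by rewrite divr_gt0// mulr_gt0//; lra.
have Meta : 2 * M * eta <= e / 4.
  rewrite /eta mulrA ler_pdivrMr; last by rewrite mulr_gt0//; lra.
  by nra.
have [L1 L10 tL1] := tZ _ eta0.
have [L2 L20 [A2 mA2 [PA2 GA2]]] := tight_vector Q mG eta0.
pose L := L1 + L2.
have e8 : 0 < e / 8 by lra.
have L0 : 0 < L by rewrite addr_gt0.
have [F tF [FM Ff]] := trig_approx cf fM e8 L0.
have /cvgrPdist_le /(_ _ e8) cF := trigE _ tF.
have hG : `|Ex Q (fun w => F (G w)) - Ex Q (fun w => f (G w))| <= e / 8 + 2 * M * fine (Q A2).
  apply: Ex_approx => //; [exact: measurable_trigpoly| |by lra].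
  move=> w /GA2 h; apply: Ff => i; apply: le_trans (h i) _; rewrite /L; lra.
have hG' : 2 * M * fine (Q A2) <= 2 * M * eta by apply: ler_wpM2l => //; rewrite mulr_ge0.
near=> n.
have hZ : exists2 A : set T, measurable A &
    fine (P A) <= eta /\ forall w, ~ A w -> forall i, `|Z n w i 0| <= L1 by near: n.
have [A mA [PA ZA]] := hZ.
have mZn : forall i, measurable_fun setT (fun w => Z n w i 0) by near: n.
have h1 : `|Ex P (fun w => F (Z n w)) - Ex P (fun w => f (Z n w))| <= e / 8 + 2 * M * fine (P A).
  apply: Ex_approx => //; [exact: measurable_trigpoly|exact: measurable_continuous_bounded mZn cf fM| |by lra].
  move=> w /ZA h; apply: Ff => i; apply: le_trans (h i) _; rewrite /L; lra.
have h1' : 2 * M * fine (P A) <= 2 * M * eta by apply: ler_wpM2l => //; rewrite mulr_ge0.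
have h2 : `|Ex Q (fun w => F (G w)) - Ex P (fun w => F (Z n w))| <= e / 8 by near: n.
have -> : Ex Q (fun w => f (G w)) - Ex P (fun w => f (Z n w)) =
  (Ex Q (fun w => F (G w)) - Ex P (fun w => F (Z n w))) +
  (Ex P (fun w => F (Z n w)) - Ex P (fun w => f (Z n w))) -
  (Ex Q (fun w => F (G w)) - Ex Q (fun w => f (G w))) by ring.
apply: le_trans (ler_normB _ _) _; apply: le_trans (lerD (ler_normD _ _) (lexx _)) _.
lra.
Unshelve. all: end_near. Qed.

End levy.

(** * Characteristic function of a centered normal law *)

Section gaussian_characteristic_function.
Context {R : realType}.
Variable s : R.
Hypothesis s0 : 0 < s.
Notation mu := (@lebesgue_measure R).
Let f (x : R) := normal_pdf 0 s x.
Let k : R := normal_peak s.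

Let fE x : f x = k * expR (- (x ^+ 2) / (s ^+ 2 *+ 2)).
Proof. by rewrite /f normal_pdfE ?gt_eqF// /normal_fun subr0. Qed.

Let f_ge0 x : 0 <= f x. Proof. exact: normal_pdf_ge0. Qed.

Let intf : mu.-integrable setT (EFin \o f). Proof. exact: integrable_normal_pdf. Qed.

Let mf : measurable_fun setT f. Proof. exact: measurable_normal_pdf. Qed.

Let deriv_f (x : R) : is_derive x 1 f (- (x / s ^+ 2) * f x).
Proof.
have -> : f = fun x => k * expR (- (s ^+ 2 *+ 2)^-1 * x ^+ 2).
  by apply/funext => y; rewrite fE; congr (k * expR _); rewrite !mulNr mulrC.
have sn0 : s != 0 by rewrite gt_eqF.
apply: is_derive_eq; rewrite /GRing.scale/=.
by field.
Qed.

Let integrable_bounded (g : R -> R) (M : R) : measurable_fun setT g -> (forall x, `|g x| <= M) ->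
  mu.-integrable setT (EFin \o (fun x => g x * f x)).
Proof.
move=> mg gM.
have h : mu.-integrable setT (EFin \o (fun x => M * f x)).
  rewrite (_ : _ \o _ = (fun x => M%:E * (EFin \o f) x)%E)//; exact: integrableZl.
apply: le_integrable h => //; first by apply/measurable_EFinP; exact: measurable_funM.
move=> x _; rewrite /= lee_fin !normrM; apply: ler_wpM2r => //.
exact: le_trans (gM x) (ler_norm _).
Qed.

(** Dominated by a multiple of the normal density with doubled standard deviation: three quarters of
    the exponent are spent on absorbing the factor [|x|]. *)
Let integrable_absM : mu.-integrable setT (EFin \o (fun x => `|x| * f x)).
Proof.
have s20 : 0 < 2 * s by rewrite mulr_gt0.
(* Chosen so that [C * (1 + 3 * x ^+ 2 / (8 * s ^+ 2))] is at least [1 + x ^+ 2], hence at least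
   [|x|]. *)
pose C := 1 + 8 * s ^+ 2 / 3.
have C1 : 1 <= C by rewrite lerDl divr_ge0// mulr_ge0// sqr_ge0.
pose g x := (k * C / normal_peak (2 * s)) * normal_pdf 0 (2 * s) x.
have h : mu.-integrable setT (EFin \o g).
  rewrite (_ : _ \o _ = (fun x => (k * C / normal_peak (2 * s))%:E * (EFin \o normal_pdf 0 (2 * s)) x)%E)//.
  by apply: integrableZl => //; exact: integrable_normal_pdf.
apply: le_integrable h => //.
  by apply/measurable_EFinP; apply: measurable_funM => //; exact: normr_measurable.
move=> x _; rewrite /= lee_fin ger0_norm ?mulr_ge0//; apply: le_trans (ler_norm _).
rewrite /g normal_pdfE ?gt_eqF// mulrA mulfVK ?gt_eqF ?normal_peak_gt0 ?gt_eqF//.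
rewrite fE mulrCA -!mulrA ler_wpM2l ?normal_peak_ge0// /normal_fun subr0.
have -> : - x ^+ 2 / (s ^+ 2 *+ 2) =
  - x ^+ 2 / ((2 * s) ^+ 2 *+ 2) + - (3 * x ^+ 2 / (8 * s ^+ 2)).
  by field; rewrite gt_eqF.
rewrite expRD [expR _ * expR _]mulrC mulrA ler_wpM2r ?expR_ge0// expRN.
rewrite ler_pdivrMr ?expR_gt0//.
have h1 := expR_ge1Dx (3 * x ^+ 2 / (8 * s ^+ 2)).
apply: (@le_trans _ _ (C * (1 + 3 * x ^+ 2 / (8 * s ^+ 2)))); last by rewrite ler_wpM2l// (le_trans _ C1).
have h2 : x ^+ 2 <= C * (3 * x ^+ 2 / (8 * s ^+ 2)).
  have -> : C * (3 * x ^+ 2 / (8 * s ^+ 2)) = x ^+ 2 + 3 * x ^+ 2 / (8 * s ^+ 2).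
    by rewrite /C; field; rewrite gt_eqF.
  by rewrite lerDl divr_ge0// mulr_ge0// sqr_ge0.
have h3 := sqr_ge0 (`|x| - 1); rewrite -[x ^+ 2]real_normK ?num_real// in h2 *.
by have := normr_ge0 x; nra.
Qed.

Variable c : R.
Let F (t x : R) := cos (t * x + c) * f x.
Let H t := \int[mu]_x F t x.

Let mcos t : measurable_fun setT (fun x : R => cos (t * x + c)).
Proof.
apply: (measurableT_comp (f := cos)); last exact: measurable_funD.
by apply: continuous_measurable_fun; exact: continuous_cos.
Qed.

Let msin t : measurable_fun setT (fun x : R => sin (t * x + c)).
Proof.
apply: (measurableT_comp (f := sin)); last exact: measurable_funD.
by apply: continuous_measurable_fun; exact: continuous_sin.
Qed.

Let intF t : mu.-integrable setT (EFin \o F t).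
Proof.
by apply: (@integrable_bounded _ 1) => // x; rewrite ler_norml cos_geN1 cos_le1.
Qed.

Let dF (t x : R) : is_derive t 1 (F ^~ x) (- x * sin (t * x + c) * f x).
Proof.
have h : is_derive t 1 (fun t => cos (t * x + c)) (- x * sin (t * x + c)).
  by apply: is_derive_eq; rewrite /GRing.scale/= ; ring.
rewrite /F; apply: is_derive_eq; rewrite /GRing.scale/=; ring.
Qed.

Let mxsin (t : R) : mu.-integrable setT (EFin \o (fun x => x * sin (t * x + c) * f x)).
Proof.
apply: le_integrable integrable_absM => //.
  by apply/measurable_EFinP; apply: measurable_funM => //; apply: measurable_funM => //; exact: msin.
move=> x _; rewrite /= lee_fin !normrM normr_id; apply: ler_wpM2r => //.
by rewrite ler_piMr// ler_norml sin_geN1 sin_le1.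
Qed.

Let dH (t : R) : is_derive t 1 H (- \int[mu]_x (x * sin (t * x + c) * f x)).
Proof.
have It : `]t - 1, t + 1[%classic t by rewrite /= in_itv/=; lra.
have ub (u x : R) : `]t - 1, t + 1[%classic u -> setT x -> `|partial1of2 F u x| <= `|x| * f x.
  move=> _ _; have [_] := dF u x; rewrite partial1of2E => ->.
  rewrite !normrM normrN (ger0_norm (f_ge0 x)); apply: ler_wpM2r => //.
  by rewrite ler_piMr// ler_norml sin_geN1 sin_le1.
have dr (u x : R) : `]t - 1, t + 1[%classic u -> setT x -> derivable (F ^~ x) u 1.
  by move=> _ _; have [] := dF u x.
have G0 (x : R) : 0 <= `|x| * f x by rewrite mulr_ge0.
have h1 := @derivable_under_integral R _ _ mu F setT measurableT t (t - 1) (t + 1) It (fun u _ => intF u) dr _ G0 integrable_absM ub.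
have h2 := @differentiation_under_integral R _ _ mu F setT measurableT t (t - 1) (t + 1) It (fun u _ => intF u) dr _ G0 integrable_absM ub.
apply: DeriveDef; first exact: h1.
rewrite -derive1E h2 -mulN1r -RintegralZl//.
apply: eq_Rintegral => x _; have [_] := dF t x; rewrite partial1of2E => ->; ring.
Qed.

(** Integration by parts in disguise: [g t] vanishes at both infinities, so its derivative [g' t]
    integrates to zero, which expresses the derivative of [H] through [H] itself. *)
Let g t (x : R) := sin (t * x + c) * f x.
Let g' t (x : R) := t * F t x - (s ^+ 2)^-1 * (x * sin (t * x + c) * f x).

Let dg (t x : R) : is_derive x 1 (g t) (g' t x).
Proof.
have h : is_derive x 1 (fun x => sin (t * x + c)) (t * cos (t * x + c)).
  by apply: is_derive_eq; rewrite /GRing.scale/= ; ring.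
apply: (is_derive_eq (is_deriveM h (deriv_f x))); rewrite /g' /F /GRing.scale/=.
by field; rewrite gt_eqF.
Qed.

Let intg' t : mu.-integrable setT (EFin \o g' t).
Proof.
rewrite (_ : _ \o _ = (fun x => t%:E * (EFin \o F t) x - (s ^+ 2)^-1%:E * (EFin \o (fun x => x * sin (t * x + c) * f x)%R) x)%E)//.
by apply: integrableB => //; exact: integrableZl.
Qed.

Let f_cvg0 : (fun n : nat => f n%:R) @ \oo --> (0 : R) /\ (fun n : nat => f (- n%:R)) @ \oo --> (0 : R).
Proof.
suff h : (fun n : nat => f n%:R) @ \oo --> (0 : R).
  by split => //; rewrite (_ : (fun n => _) = (fun n : nat => f n%:R))//; apply/funext => n; rewrite !fE sqrrN.
apply/cvgrPdist_le => e e0.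
near=> n.
have n0 : (0 : R) < n%:R by rewrite ltr0n; near: n; exists 1%N.
rewrite sub0r normrN ger0_norm// fE mulNr expRN.
rewrite ler_pdivrMr ?expR_gt0//.
pose K := k * (s ^+ 2 *+ 2) / e.
have nK : K <= n%:R by near: n; exact: nbhs_infty_ger.
have nn : (1 : R) <= n%:R by rewrite ler1n; near: n; exists 1%N.
have s2 : 0 < s ^+ 2 *+ 2 by rewrite pmulrn_lgt0// exprn_gt0.
have h := expR_ge1Dx (n%:R ^+ 2 / (s ^+ 2 *+ 2)).
apply: (@le_trans _ _ (e * (n%:R ^+ 2 / (s ^+ 2 *+ 2)))); last by rewrite ler_wpM2l ?(ltW e0)//; lra.
have nK2 : K <= n%:R ^+ 2 by apply: (le_trans nK); rewrite expr2 ler_peMr// ltW.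
by rewrite mulrA ler_pdivlMr//; move: nK2; rewrite /K ler_pdivrMr// (mulrC e).
Unshelve. all: end_near. Qed.

Let int_g'0 t : \int[mu]_x g' t x = 0.
Proof.
pose gn (n : nat) (x : R) : \bar R := ((g' t \_ `[- n%:R, n%:R]%classic) x)%:E.
have mg' : measurable_fun setT (g' t) by apply/measurable_EFinP; exact: measurable_int (intg' t).
have mgn n : measurable_fun setT (gn n).
  apply/measurable_EFinP; apply/(measurable_restrictT _ _).1 => //; exact: measurable_funTS.
have gncvg : {ae mu, forall x, setT x -> gn ^~ x @ \oo --> (EFin \o g' t) x}.
  apply: aeW => x _; apply: cvg_near_cst; near=> n.
  rewrite /gn patchE ifT// inE/= in_itv/= -ler_norml.
  by near: n; exact: nbhs_infty_ger.
have gnub : {ae mu, forall x n, setT x -> (`|gn n x| <= `|(EFin \o g' t) x|)%E}.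
  apply: aeW => x n _; rewrite /gn patchE; case: ifPn => //= _.
  by rewrite normr0 lee_fin.
have ig : mu.-integrable setT (abse \o (EFin \o g' t)) by exact: integrable_abse.
have mi : measurable_fun setT (EFin \o g' t) by exact/measurable_EFinP.
have [_ _ DC] := @dominated_convergence _ _ _ mu setT measurableT gn _ _ mgn mi gncvg ig gnub.
(* The index is shifted because the fundamental theorem asks for a nondegenerate interval, which
   fails at zero. *)
have E1 n : (\int[mu]_x gn n.+1 x = (g t n.+1%:R - g t (- n.+1%:R))%:E)%E.
  rewrite /gn -[RHS](@continuous_FTC2 _ (g' t) (g t) (- n.+1%:R) n.+1%:R).
  - rewrite [RHS]integral_mkcond; apply: eq_integral => x _.
    by rewrite restrict_EFin.
  - by rewrite -subr_gt0 opprK addr_gt0// ltr0n.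
  - apply: continuous_subspaceT => x.
    have cf : {for x, continuous f} by apply: continuous_normal_pdf; rewrite gt_eqF.
    have cl : {for x, continuous (fun x : R => t * x + c)}.
      by apply: differentiable_continuous; apply/derivable1_diffP; exact: ex_derive.
    have cc : {for x, continuous (fun x : R => cos (t * x + c))}.
      by apply: continuous_comp => //; exact: continuous_cos.
    have css : {for x, continuous (fun x : R => sin (t * x + c))}.
      by apply: continuous_comp => //; exact: continuous_sin.
    rewrite /g' /F; apply: cvgB; apply: cvgM; try exact: cvg_cst.
      exact: cvgM.
    by apply: cvgM => //; apply: cvgM => //; exact: cvg_id.
  - have cg x : {for x, continuous (g t)}.
      by apply: differentiable_continuous; apply/derivable1_diffP; have [] := dg t x.
    split => [x _||].
    + by have [] := dg t x.
    + by apply: cvg_at_right_filter; exact: cg.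
    + by apply: cvg_at_left_filter; exact: cg.
  - by move=> x _; rewrite derive1E; have [_ ->] := dg t x.
have cvg0 : (fun n => \int[mu]_x gn n x)%E @ \oo --> (0 : R)%:E.
  rewrite -(cvg_shiftS (fun n => \int[mu]_x gn n x)%E) /=.
  under eq_fun do rewrite E1.
  apply: cvg_EFin; first exact: nearW.
  rewrite -[X in _ --> X](subrr (0 : R)).
  have bnd (u : nat -> R) : (fun n => f (u n)) @ \oo --> (0 : R) -> (fun n => g t (u n)) @ \oo --> (0 : R).
    move=> /cvgrPdist_le fu; apply/cvgrPdist_le => e e0; apply: filterS (fu e e0) => n.
    rewrite !sub0r !normrN; apply: le_trans; rewrite /g normrM ler_piMl//.
    by rewrite ler_norml sin_geN1 sin_le1.
  have [c1 c2] := f_cvg0.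
  apply: (@cvgB _ R^o).
  - by rewrite (cvg_shiftS (fun n => g t n%:R)); exact: bnd c1.
  - by rewrite (cvg_shiftS (fun n => g t (- n%:R))); exact: bnd c2.
have h1 := cvg_lim (@ereal_hausdorff R) cvg0.
have h2 := cvg_lim (@ereal_hausdorff R) DC.
have h : (\int[mu]_x (EFin \o g' t) x = 0)%E := etrans (esym (h2 _)) (h1 _).
by rewrite /Rintegral [X in fine X]h.
Unshelve. all: end_near. Qed.

Let dH' (t : R) : is_derive t 1 H (- (s ^+ 2 * t) * H t).
Proof.
have h := dH t; apply: is_derive_eq.
have := int_g'0 t; rewrite /g' RintegralB//; last 2 first.
- by rewrite (_ : _ \o _ = (fun x => t%:E * (EFin \o F t) x)%E)//; exact: integrableZl.
- by rewrite (_ : _ \o _ = (fun x => (s ^+ 2)^-1%:E * (EFin \o (fun x => x * sin (t * x + c) * f x)%R) x)%E)//; exact: integrableZl.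
rewrite !RintegralZl// => /eqP; rewrite subr_eq0 => /eqP E.
have sn : s ^+ 2 != 0 by rewrite expf_neq0// gt_eqF.
have -> : \int[mu]_x (x * sin (t * x + c) * f x) = s ^+ 2 * (t * H t).
  by rewrite /H E mulrA mulfV// mul1r.
ring.
Qed.

(** The equation [H' = - s ^+ 2 * t * H] makes [h] constant. The value at one is enough, the
    frequency being already contained in the linear form whose law is considered. *)
Let H1 : H 1 = expR (- (s ^+ 2 / 2)) * cos c.
Proof.
pose h t := H t * expR (s ^+ 2 / 2 * t ^+ 2).
have E : h 1 = h 0.
  apply: is_derive_0_is_cst => t.
  have d1 := dH' t.
  by rewrite /h; apply: is_derive_eq; rewrite /GRing.scale/=; field.
have H0 : H 0 = cos c.
  rewrite /H /F; under eq_Rintegral do rewrite mul0r add0r.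
  rewrite RintegralZl// -[RHS]mulr1; congr (_ * _).
  by rewrite /Rintegral integral_normal_pdf.
move: E; rewrite /h expr1n mulr1 expr0n/= mulr0 expR0 mulr1 H0 => <-.
by rewrite mulrCA -expRD addNr expR0 mulr1.
Qed.

Lemma normal_cos (d : measure_display) (T : measurableType d) (Q : probability T R) (L : T -> R) :
  measurable_fun setT L ->
  (forall A : set R, measurable A -> Q (L @^-1` A) = normal_prob 0 s A) ->
  Ex Q (fun w => cos (L w + c)) = expR (- (s ^+ 2 / 2)) * cos c.
Proof.
move=> mL QL; rewrite -H1.
have mc : measurable_fun setT (fun x : R => cos (x + c)).
  by have := mcos 1; under eq_fun do rewrite mul1r.
(* Adding one makes the integrand nonnegative, as the change of variables through the Radon-Nikodym
   derivative requires. *)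
pose u x := (cos (x + c) + 1)%:E.
have u0 x : (0 <= u x)%E by rewrite lee_fin; have := cos_geN1 (x + c); lra.
have mu_ : measurable_fun setT u by apply/measurable_EFinP; exact: measurable_funD.
have dom := normal_prob_dominates 0 s.
have cov := @Radon_Nikodym_SigmaFinite.change_of_variables _ _ _ (normal_prob 0 s) mu dom u setT u0 measurableT mu_.
have rn : ae_eq mu setT (Radon_Nikodym_SigmaFinite.f (normal_prob 0 s) mu) (EFin \o f).
  apply: integral_ae_eq => //.
  - exact: Radon_Nikodym_SigmaFinite.f_integrable.
  - exact/measurable_EFinP.
  - by move=> E _ mE; rewrite -Radon_Nikodym_SigmaFinite.f_integral.
have E1 : (\int[normal_prob 0 s]_x u x = \int[mu]_x (u x * (f x)%:E))%E.
  rewrite -cov; apply: ae_eq_integral => //.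
  - by apply: emeasurable_funM => //; apply: measurable_int (Radon_Nikodym_SigmaFinite.f_integrable dom).
  - by apply: emeasurable_funM => //; exact/measurable_EFinP.
  - by apply: filterS rn => x /[apply] /= ->.
have E2 : (\int[Q]_w u (L w) = \int[normal_prob 0 s]_x u x)%E.
  have mL' : @measurable_fun _ _ T (measurableTypeR R) setT L := mL.
  rewrite -(@ge0_integral_pushforward _ _ T (measurableTypeR R) R L mL' Q setT u)//.
  by rewrite (@eq_measure_integral _ (measurableTypeR R) R setT (normal_prob 0 s)) => [|A mA _]; [|exact: QL].
have ic := itg_cos Q (measurable_funD mL (measurable_cst c)).
have EQ : (\int[Q]_w u (L w) = (Ex Q (fun w => cos (L w + c)) + 1)%:E)%E.
  rewrite -(Ex_cst Q 1) -(ExD ic (itg_cst Q 1)) -itgP//.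
  exact: itgD ic (itg_cst Q 1).
have Emu : (\int[mu]_x (u x * (f x)%:E) = (H 1 + 1)%:E)%E.
  transitivity (\int[mu]_x ((F 1 x)%:E + (f x)%:E))%E.
    by apply: eq_integral => x _; rewrite -EFinM -EFinD /F mul1r mulrDl mul1r.
  rewrite integralD_EFin// integral_normal_pdf EFinD; congr (_ + _)%E.
  by apply/esym/fineK; apply: integrable_fin_num => //; exact: intF.
by move: EQ; rewrite E2 E1 Emu => -[] /addIr ->.
Qed.

End gaussian_characteristic_function.

(** * Convergence in probability and Slutsky *)

Section convergence_in_probability.
Context {d : measure_display} {T : measurableType d} {R : realType}.
Variable P : probability T R.
Implicit Types xi zeta : nat -> T -> R.

(* [off eps Q]: [Q] holds outside a measurable event of probability at most [eps];
   no measurability of [Q] is needed. *)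
Definition off (eps : R) (Q : T -> Prop) : Prop :=
  exists2 A : set T, measurable A & fine (P A) <= eps /\ forall w, ~ A w -> Q w.

(** Convergence in probability in Ky Fan form: one [eps] bounds both the deviation and the
    exceptional mass. Its companion [bip] is boundedness in probability, that is, tightness along
    large [n]. *)
Definition cvp xi (c : R) := forall eps, 0 < eps -> \forall n \near \oo, off eps (fun w => `|xi n w - c| <= eps).

Definition bip xi := forall eps, 0 < eps ->
  exists2 K : R, 0 < K & \forall n \near \oo, off eps (fun w => `|xi n w| <= K).

Lemma fine_PU (A B : set T) : measurable A -> measurable B ->
  fine (P (A `|` B)) <= fine (P A) + fine (P B).
Proof.
move=> mA mB; rewrite -fineD ?fin_num_measure// fine_le ?fin_numD ?fin_num_measure//.
- exact: measurableU.
- exact: measureU2.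
Qed.

Lemma off_and (e1 e2 : R) (Q1 Q2 : T -> Prop) : off e1 Q1 -> off e2 Q2 ->
  off (e1 + e2) (fun w => Q1 w /\ Q2 w).
Proof.
move=> [A mA [PA AQ]] [B mB [PB BQ]]; exists (A `|` B); first exact: measurableU.
split; first by apply: le_trans (fine_PU mA mB) _; exact: lerD.
by move=> w /not_orP[/AQ q1 /BQ q2].
Qed.

Lemma off_imp (e1 e2 : R) (Q1 Q2 : T -> Prop) : e1 <= e2 -> (forall w, Q1 w -> Q2 w) ->
  off e1 Q1 -> off e2 Q2.
Proof.
move=> e12 Q12 [A mA [PA AQ]]; exists A => //; split; first exact: le_trans e12.
by move=> w /AQ/Q12.
Qed.

Lemma off_true (e : R) (Q : T -> Prop) : 0 <= e -> (forall w, Q w) -> off e Q.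
Proof. by move=> e0 q; exists set0 => //; rewrite measure0. Qed.

Lemma cvp_off xi zeta c :
  (forall eps, 0 < eps -> \forall n \near \oo, off eps (fun w => xi n w = zeta n w)) ->
  cvp xi c -> cvp zeta c.
Proof.
move=> xz cx eps e0; have e2 : 0 < eps / 2 by rewrite divr_gt0.
near=> n.
have h1 : off (eps / 2) (fun w => xi n w = zeta n w) by near: n; exact: xz.
have h2 : off (eps / 2) (fun w => `|xi n w - c| <= eps / 2) by near: n; exact: cx.
by apply: off_imp (off_and h1 h2); [lra|move=> w [<-]; lra].
Unshelve. all: end_near. Qed.

Lemma eq_cvp xi zeta c : (\forall n \near \oo, xi n =1 zeta n) -> cvp xi c -> cvp zeta c.
Proof.
move=> xz; apply: cvp_off => eps e0; apply: filterS xz => n h.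
by apply: off_true => //; exact: ltW.
Qed.

Lemma cvp_cst (c : R) : cvp (fun _ _ => c) c.
Proof.
move=> eps e0; apply: nearW => n; apply: off_true => [|w]; first exact: ltW.
by rewrite subrr normr0 ltW.
Qed.

Lemma cvpD xi zeta a b : cvp xi a -> cvp zeta b -> cvp (fun n w => xi n w + zeta n w) (a + b).
Proof.
move=> ca cb eps e0; have e2 : 0 < eps / 2 by rewrite divr_gt0.
near=> n.
have h1 : off (eps / 2) (fun w => `|xi n w - a| <= eps / 2) by near: n; exact: ca.
have h2 : off (eps / 2) (fun w => `|zeta n w - b| <= eps / 2) by near: n; exact: cb.
apply: off_imp (off_and h1 h2) => [|w [x1 x2]]; first lra.
rewrite opprD addrACA; apply: le_trans (ler_normD _ _) _; lra.
Unshelve. all: end_near. Qed.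

Lemma cvpM xi zeta a b : cvp xi a -> cvp zeta b -> cvp (fun n w => xi n w * zeta n w) (a * b).
Proof.
move=> ca cb eps e0.
(* With deviations [e <= 1] the product errs by at most [e * (1 + |a| + |b|)], and the factor two
   leaves room for the exceptional mass [e + e]. *)
pose K := 2 * (1 + `|a| + `|b|).
have K2 : 2 <= K by rewrite /K; have := normr_ge0 a; have := normr_ge0 b; lra.
have K0 : 0 < K by lra.
pose e := Num.min 1 (eps / K).
have ee : 0 < e by rewrite lt_min ltr01 divr_gt0.
have e1 : e <= 1 by rewrite ge_min lexx.
have eK : e * K <= eps by rewrite -ler_pdivlMr// ge_min lexx orbT.
near=> n.
have h1 : off e (fun w => `|xi n w - a| <= e) by near: n; exact: ca.
have h2 : off e (fun w => `|zeta n w - b| <= e) by near: n; exact: cb.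
apply: off_imp (off_and h1 h2) => [|w [x1 x2]]; first by nra.
have -> : xi n w * zeta n w - a * b =
  (xi n w - a) * (zeta n w - b) + a * (zeta n w - b) + b * (xi n w - a) by ring.
apply: le_trans (ler_normD _ _) _; apply: le_trans (lerD (ler_normD _ _) (lexx _)) _.
rewrite !normrM.
have p1 : `|xi n w - a| * `|zeta n w - b| <= e * 1 by rewrite ler_pM// (le_trans x2).
have p2 : `|a| * `|zeta n w - b| <= `|a| * e by rewrite ler_wpM2l.
have p3 : `|b| * `|xi n w - a| <= `|b| * e by rewrite ler_wpM2l.
by move: eK; rewrite /K; nra.
Unshelve. all: end_near. Qed.

Lemma cvpV xi a : a != 0 -> cvp xi a -> cvp (fun n w => (xi n w)^-1) a^-1.
Proof.
move=> a0 ca eps e0; have na : 0 < `|a| by rewrite normr_gt0.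
(* The three bounds keep [xi] at distance [|a| / 2] from zero, limit the exceptional mass, and
   compensate the denominator [xi * a]. *)
pose e := Num.min (`|a| / 2) (Num.min eps (eps * (`|a| ^+ 2 / 2))).
have ee : 0 < e by rewrite !lt_min divr_gt0//= e0/= mulr_gt0// divr_gt0// exprn_gt0.
have e1 : e <= `|a| / 2 by rewrite !ge_min lexx.
have e2 : e <= eps by rewrite !ge_min lexx orbT.
have e3 : e <= eps * (`|a| ^+ 2 / 2) by rewrite !ge_min lexx !orbT.
near=> n.
have h1 : off e (fun w => `|xi n w - a| <= e) by near: n; exact: ca.
apply: off_imp h1 => // w x1.
have xa : `|a| / 2 <= `|xi n w|.
  by have := ler_distD (xi n w) a 0; rewrite !subr0 (distrC a); lra.
have x0 : 0 < `|xi n w| by lra.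
have xn0 : xi n w != 0 by rewrite -normr_gt0.
have -> : (xi n w)^-1 - a^-1 = (a - xi n w) / (xi n w * a) by field; rewrite xn0 a0.
rewrite normrM normfV normrM ler_pdivrMr ?mulr_gt0// distrC.
apply: (le_trans x1); apply: (le_trans e3); rewrite ler_wpM2l ?(ltW e0)//.
by rewrite expr2; nra.
Unshelve. all: end_near. Qed.

Lemma cvp_sum (I : Type) (r : seq I) (F : I -> nat -> T -> R) (c : I -> R) :
  (forall i, cvp (F i) (c i)) -> cvp (fun n w => \sum_(i <- r) F i n w) (\sum_(i <- r) c i).
Proof.
move=> Fc; elim: r => [|i r IH].
  rewrite big_nil; apply: eq_cvp (cvp_cst 0); apply: nearW => n w.
  by rewrite big_nil.
rewrite big_cons; apply: eq_cvp (cvpD (Fc i) IH); apply: nearW => n w.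
by rewrite big_cons.
Qed.

Lemma cvp_sum0 (I : Type) (r : seq I) (F : I -> nat -> T -> R) :
  (forall i, cvp (F i) 0) -> cvp (fun n w => \sum_(i <- r) F i n w) 0.
Proof. by move=> /(cvp_sum r); rewrite big1. Qed.

Lemma cvp_prod (I : Type) (r : seq I) (F : I -> nat -> T -> R) (c : I -> R) :
  (forall i, cvp (F i) (c i)) -> cvp (fun n w => \prod_(i <- r) F i n w) (\prod_(i <- r) c i).
Proof.
move=> Fc; elim: r => [|i r IH].
  rewrite big_nil; apply: eq_cvp (cvp_cst 1); apply: nearW => n w.
  by rewrite big_nil.
rewrite big_cons; apply: eq_cvp (cvpM (Fc i) IH); apply: nearW => n w.
by rewrite big_cons.
Qed.

Lemma bip_cst (c : R) : bip (fun _ _ => c).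
Proof.
move=> eps e0; exists (`|c| + 1); first by have := normr_ge0 c; lra.
by apply: nearW => n; apply: off_true => [|w]; [exact: ltW|rewrite lerDl].
Qed.

Lemma bip_cvp xi c : cvp xi c -> bip xi.
Proof.
move=> cx eps e0; exists (`|c| + eps); first by have := normr_ge0 c; lra.
apply: filterS (cx _ e0) => n; apply: off_imp => // w h.
by have := ler_normD (xi n w - c) c; rewrite subrK; lra.
Qed.

Lemma bipD xi zeta : bip xi -> bip zeta -> bip (fun n w => xi n w + zeta n w).
Proof.
move=> bx bz eps e0; have e2 : 0 < eps / 2 by rewrite divr_gt0.
have [K K0 hK] := bx _ e2; have [L L0 hL] := bz _ e2.
exists (K + L); first exact: addr_gt0.
near=> n.
have h1 : off (eps / 2) (fun w => `|xi n w| <= K) by near: n.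
have h2 : off (eps / 2) (fun w => `|zeta n w| <= L) by near: n.
apply: off_imp (off_and h1 h2) => [|w [x1 x2]]; first lra.
by apply: le_trans (ler_normD _ _) _; exact: lerD.
Unshelve. all: end_near. Qed.

Lemma bipZ (k : R) xi : bip xi -> bip (fun n w => k * xi n w).
Proof.
move=> bx eps e0; have [K K0 hK] := bx _ e0.
exists ((`|k| + 1) * K); first by rewrite mulr_gt0//; have := normr_ge0 k; lra.
apply: filterS hK => n; apply: off_imp => // w h.
by rewrite normrM; have := normr_ge0 k; have := normr_ge0 (xi n w); nra.
Qed.

Lemma bip_sum (I : Type) (r : seq I) (F : I -> nat -> T -> R) :
  (forall i, bip (F i)) -> bip (fun n w => \sum_(i <- r) F i n w).
Proof.
move=> Fc; elim: r => [|i r IH].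
  rewrite (_ : (fun n w => _) = (fun _ _ => 0)); first exact: bip_cst.
  by apply/funext => n; apply/funext => w; rewrite big_nil.
rewrite (_ : (fun n w => _) = (fun n w => F i n w + \sum_(i <- r) F i n w)); first exact: bipD.
by apply/funext => n; apply/funext => w; rewrite big_cons.
Qed.

Lemma cvp0_bip xi zeta : cvp xi 0 -> bip zeta -> cvp (fun n w => xi n w * zeta n w) 0.
Proof.
move=> cx bz eps e0; have e2 : 0 < eps / 2 by rewrite divr_gt0.
have [K K0 hK] := bz _ e2.
pose e := Num.min (eps / 2) (eps / K).
have ee : 0 < e by rewrite lt_min e2 divr_gt0.
have eK : e * K <= eps by rewrite -ler_pdivlMr// ge_min lexx orbT.
have eh : e <= eps / 2 by rewrite ge_min lexx.
near=> n.
have h1 : off e (fun w => `|xi n w - 0| <= e) by near: n; exact: cx.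
have h2 : off (eps / 2) (fun w => `|zeta n w| <= K) by near: n.
apply: off_imp (off_and h1 h2) => [|w]; first lra.
rewrite !subr0 normrM => -[x1 x2]; apply: le_trans eK.
by rewrite ler_pM.
Unshelve. all: end_near. Qed.

Lemma off_L2 (f : T -> R) (eps K : R) : L2 P f -> 0 < K ->
  Ex P (fun w => f w ^+ 2) <= eps * K ^+ 2 -> off eps (fun w => `|f w| <= K).
Proof.
move=> f2 K0 h; have K20 : 0 < K ^+ 2 by rewrite exprn_gt0.
have [mA hA] := prob_markov f2.2 (fun w => sqr_ge0 (f w)) K20.
exists [set w | K ^+ 2 < f w ^+ 2] => //; split.
  by apply: le_trans hA _; rewrite ler_pdivrMr.
move=> w /negP; rewrite -leNgt => hw.
by rewrite -(@ler_pXn2r _ 2)// ?nnegrE ?(ltW K0)// real_normK ?num_real.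
Qed.

Lemma cvp_L2 xi (c : R) (v : nat -> R) : (\forall n \near \oo,
    L2 P (fun w => xi n w - c) /\ Ex P (fun w => (xi n w - c) ^+ 2) <= v n) ->
  v @ \oo --> (0 : R) -> cvp xi c.
Proof.
move=> h /cvgrPdist_le v0 eps e0.
have e3 : 0 < eps * eps ^+ 2 by rewrite mulr_gt0// exprn_gt0.
near=> n.
have [h1 h2] : L2 P (fun w => xi n w - c) /\ Ex P (fun w => (xi n w - c) ^+ 2) <= v n by near: n.
apply: off_L2 => //; apply: (le_trans h2).
have : `|0 - v n| <= eps * eps ^+ 2 by near: n; exact: v0.
by rewrite sub0r normrN => /(le_trans (ler_norm _)).
Unshelve. all: end_near. Qed.

Lemma bip_L2 xi (C : R) : (\forall n \near \oo,
    L2 P (xi n) /\ Ex P (fun w => xi n w ^+ 2) <= C) -> bip xi.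
Proof.
move=> h eps e0.
(* Chebyshev asks for the square root only; the [+ 1] keeps the threshold positive when [C] is
   zero. *)
have K0 : 0 < Num.sqrt (`|C| / eps) + 1 by have := sqrtr_ge0 (`|C| / eps); lra.
exists (Num.sqrt (`|C| / eps) + 1) => //.
apply: filterS h => n [h1 h2]; apply: off_L2 => //; apply: (le_trans h2).
apply: (@le_trans _ _ `|C|); first exact: ler_norm.
have s2 : (Num.sqrt (`|C| / eps)) ^+ 2 = `|C| / eps by rewrite sqr_sqrtr// divr_ge0// ltW.
by rewrite mulrC -ler_pdivrMr// -[leLHS]s2; apply: lerXn2r; rewrite ?nnegrE ?addr_ge0 ?sqrtr_ge0 ?lerDl.
Qed.

Section matrices.
Variable p : nat.
Implicit Types M : nat -> T -> 'M[R]_p.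

Definition cvp_mx (q r : nat) (M : nat -> T -> 'M[R]_(q, r)) (S : 'M[R]_(q, r)) :=
  forall i j, cvp (fun n w => M n w i j) (S i j).

Lemma cvp_det q (M : nat -> T -> 'M[R]_q) (S : 'M[R]_q) : cvp_mx M S -> cvp (fun n w => \det (M n w)) (\det S).
Proof.
move=> MS; rewrite /determinant; apply: cvp_sum => s; apply: cvpM; first exact: cvp_cst.
by apply: cvp_prod => i; exact: MS.
Qed.

(** Cramer's rule: entries of the inverse are polynomials in the entries divided by the determinant,
    and the determinant stays away from zero off a small event. On that event [invmx] returns its
    argument, which the argument never inspects. *)
Lemma cvp_invmx M (S : 'M[R]_p) : S \in unitmx -> cvp_mx M S ->
  (forall eps, 0 < eps -> \forall n \near \oo, off eps (fun w => M n w \in unitmx)) /\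
  cvp_mx (fun n w => invmx (M n w)) (invmx S).
Proof.
move=> uS MS; have cd := cvp_det MS.
have d0 : \det S != 0 by move: uS; rewrite unitmxE unitfE.
have unitM eps : 0 < eps -> \forall n \near \oo, off eps (fun w => M n w \in unitmx).
  move=> e0; pose e := Num.min eps (`|\det S| / 2).
  have dS0 : 0 < `|\det S| by rewrite normr_gt0.
  have ee : 0 < e by rewrite lt_min e0 divr_gt0.
  apply: filterS (cd _ ee) => n; apply: off_imp; first by rewrite ge_min lexx.
  move=> w h; rewrite unitmxE unitfE; apply/eqP => d1; move: h.
  rewrite d1 sub0r normrN leNgt => /negP; apply.
  rewrite gt_min; apply/orP; right; lra.
split=> // i j.
apply: (@cvp_off (fun n w => (\det (M n w))^-1 * (\adj (M n w)) i j)).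
  by move=> eps /unitM; apply: filterS => n; apply: off_imp => // w uM; rewrite /invmx uM [RHS]mxE.
rewrite /invmx uS [X in cvp _ X]mxE; apply: cvpM; first exact: cvpV.
rewrite mxE /cofactor.
have h : cvp (fun n w => (-1) ^+ (j + i) * \det (row' j (col' i (M n w)))) ((-1) ^+ (j + i) * \det (row' j (col' i S))).
  apply: cvpM; first exact: cvp_cst.
  apply: cvp_det => a b; rewrite [X in cvp _ X]mxE [X in cvp _ X]mxE.
  by apply: eq_cvp (MS _ _); apply: nearW => n w; rewrite !mxE.
by apply: eq_cvp h; apply: nearW => n w; rewrite mxE.
Qed.

End matrices.

End convergence_in_probability.

Section matrix_measurability.
Context {d : measure_display} {T : measurableType d} {R : realType}.

Definition mmx (q r : nat) (M : T -> 'M[R]_(q, r)) :=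
  forall i j, measurable_fun setT (fun w => M w i j).

(** The identity [x^-1 = x * expR (- ln (x ^+ 2))] holds at zero as well, where the inverse is zero
    by convention. *)
Lemma measurable_inv (f : T -> R) : measurable_fun setT f -> measurable_fun setT (fun w => (f w)^-1).
Proof.
move=> mf; rewrite (_ : (fun w => _) = fun w => f w * expR (- ln (f w ^+ 2))).
  apply: measurable_funM => //; apply: measurableT_comp; first exact: measurable_expR.
  apply: measurableT_comp => //; apply: measurableT_comp; first exact: measurable_ln.
  exact: measurable_funX.
apply/funext => w; have [->|f0] := eqVneq (f w) 0; first by rewrite invr0 mul0r.
rewrite expRN lnK ?posrE; first by field.
by rewrite exprn_even_gt0.
Qed.

Lemma mmx_mul (q r s : nat) (M : T -> 'M[R]_(q, r)) (N : T -> 'M[R]_(r, s)) :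
  mmx M -> mmx N -> mmx (fun w => M w *m N w).
Proof.
move=> mM mN i j; rewrite (_ : (fun w => _) = fun w => \sum_k M w i k * N w k j).
  by apply: measurable_sum => k; exact: measurable_funM.
by apply/funext => w; rewrite mxE.
Qed.

Lemma mmx_tr (q r : nat) (M : T -> 'M[R]_(q, r)) : mmx M -> mmx (fun w => (M w)^T).
Proof. by move=> mM i j; under eq_fun do rewrite mxE; exact: mM. Qed.

Lemma mmx_det (q : nat) (M : T -> 'M[R]_q) : mmx M -> measurable_fun setT (fun w => \det (M w)).
Proof.
move=> mM; rewrite /determinant; apply: measurable_sum => s; apply: measurable_funM => //.
by apply: measurable_prod => i _; exact: mM.
Qed.

Lemma mmx_inv (q : nat) (M : T -> 'M[R]_q) : mmx M -> mmx (fun w => invmx (M w)).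
Proof.
move=> mM i j.
(* The first branch is the default value of [invmx] on singular matrices. *)
rewrite (_ : (fun w => _) = fun w => if \det (M w) == 0 then M w i j else (\det (M w))^-1 * (\adj (M w)) i j).
  apply: measurable_fun_ifT => //.
    by apply: measurable_fun_eqr => //; exact: mmx_det.
  apply: measurable_funM; first exact/measurable_inv/mmx_det.
  rewrite (_ : (fun w => _) = fun w => (-1) ^+ (j + i) * \det (row' j (col' i (M w)))).
    apply: measurable_funM => //; apply: mmx_det => a b.
    by rewrite (_ : (fun w => _) = fun w => M w (lift j a) (lift i b))//; apply/funext => w; rewrite !mxE.
  by apply/funext => w; rewrite mxE.
by apply/funext => w; rewrite /invmx unitmxE unitfE; case: eqP => //= _; rewrite mxE.
Qed.

End matrix_measurability.

Section slutsky.
Context {d : measure_display} {T : measurableType d} {R : realType}.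
Variables (P : probability T R) (p : nat).

Lemma gaussian_vector_cos (d' : measure_display) (T' : measurableType d') (Q : probability T' R)
    (G : T' -> 'cV[R]_p) (V : 'M[R]_p) (t : 'cV[R]_p) (c : R) :
  gaussian_vector Q G V -> 0 <= (t^T *m V *m t) 0 0 ->
  Ex Q (fun w => cos ((t^T *m G w) 0 0 + c)) = expR (- ((t^T *m V *m t) 0 0 / 2)) * cos c.
Proof.
move=> [mG /(_ t)/= [G0 G1]]; set s2 := (_ *m _ *m _) 0 0 in G0 G1 * => s20.
have mL : measurable_fun setT (fun w => (t^T *m G w) 0 0).
  by have := measurable_dot t 0 mG; under eq_fun do rewrite addr0.
have [s2_gt0|s2_le0] := ltP 0 s2.
  rewrite (normal_cos (s := Num.sqrt s2)) ?sqrtr_gt0//; last exact: G1.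
  by rewrite sqr_sqrtr.
have s2E : s2 = 0 by apply/le_anti; rewrite s2_le0.
rewrite s2E mul0r oppr0 expR0 mul1r -[RHS](Ex_cst Q).
have mL0 : measurable [set w | (t^T *m G w) 0 0 != 0].
  rewrite (_ : [set w | _] = (fun w => (t^T *m G w) 0 0) @^-1` (~` [set 0])).
    by rewrite -[X in measurable X]setTI; apply: mL => //; exact: measurableC.
  by apply/seteqP; split => w /= /eqP.
have mg : measurable_fun setT (fun w => cos ((t^T *m G w) 0 0 + c)).
  by apply: itg_meas (itg_cos Q _); exact: measurable_funD.
have hfg : forall w, ~ [set w | (t^T *m G w) 0 0 != 0] w -> cos c = cos ((t^T *m G w) 0 0 + c).
  by move=> w /negP; rewrite negbK => /eqP ->; rewrite add0r.
by have [_ ->] := itg_ae_eq mg mL0 (G0 s2E) hfg (itg_cst Q (cos c)).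
Qed.

Lemma cvg_dist_normal_cos (Z : nat -> T -> 'cV[R]_p) (V : 'M[R]_p) :
  (forall t : 'cV[R]_p, 0 <= (t^T *m V *m t) 0 0) ->
  (\forall n \near \oo, forall i, measurable_fun setT (fun w => Z n w i 0)) ->
  (forall i, bip P (fun n w => Z n w i 0)) ->
  (forall (t : 'cV[R]_p) (c : R), Ex P (fun w => cos ((t^T *m Z n w) 0 0 + c)) @[n --> \oo] -->
     expR (- ((t^T *m V *m t) 0 0 / 2)) * cos c) ->
  cvg_dist_normal P Z V.
Proof.
move=> V0 mZ bZ cZ d' T' Q G gG f cf fM.
have [mG _] := gG.
apply: levy_continuity => //; last first.
  by move=> t c; rewrite (gaussian_vector_cos c gG (V0 t)); exact: cZ.
move=> eps e0.
(* The exceptional mass is shared among the [p] coordinates; the successor avoids a division by zero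
   when [p = 0]. *)
have ep : 0 < eps / p.+1%:R by rewrite divr_gt0// ltr0n.
have bZ' i : exists K : R, 0 < K /\ \forall n \near \oo, off P (eps / p.+1%:R) (fun w => `|Z n w i 0| <= K).
  by have [K K0 hK] := bZ i _ ep; exists K.
have [K KP] := choice bZ'.
exists (1 + \sum_i K i).
  by rewrite ltr_pwDl// sumr_ge0// => i _; have [/ltW] := KP i.
have H (s : seq 'I_p) : \forall n \near \oo, off P ((size s)%:R * (eps / p.+1%:R))
    (fun w => forall i, i \in s -> `|Z n w i 0| <= K i).
  elim: s => [|i s IH]; first by apply: nearW => n; apply: off_true; rewrite ?mul0r.
  near=> n.
  have h1 : off P ((size s)%:R * (eps / p.+1%:R)) (fun w => forall i, i \in s -> `|Z n w i 0| <= K i) by near: n.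
  have h2 : off P (eps / p.+1%:R) (fun w => `|Z n w i 0| <= K i) by near: n; have [] := KP i.
  apply: off_imp (off_and h1 h2) => [|w [w1 w2] j].
    by rewrite /= -[(size s).+1%:R]natr1 mulrDl mul1r.
  by rewrite inE => /orP[/eqP ->//|/w1].
have := H (enum 'I_p); rewrite size_enum_ord; apply: filterS => n.
apply: off_imp.
  by rewrite mulrCA ler_piMr ?(ltW e0)// ler_pdivrMr ?ltr0n// mul1r ler_nat.
move=> w h i; apply: le_trans (h i _) _; first by rewrite mem_enum.
rewrite (bigD1 i)//= addrCA lerDl addr_ge0// sumr_ge0// => j _.
by have [/ltW] := KP j.
Unshelve. all: end_near. Qed.

Lemma cos_lip (a b : R) : `|cos a - cos b| <= `|a - b|.
Proof.
have H (x y : R) : x < y -> `|cos x - cos y| <= `|x - y|.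
  move=> xy.
  have [z _ E] := @MVT R cos (- sin) x y xy (fun z _ => is_derive_cos z) (continuous_subspaceT (@continuous_cos R)).
  rewrite distrC E normrM distrC ler_piMl// fctE normrN.
  by rewrite ler_norml sin_geN1 sin_le1.
have [/H//|ba|->] := ltgtP a b; last by rewrite !subrr.
by rewrite distrC (distrC a); exact: H.
Qed.

(** Cosine is Lipschitz, so the cosine expectations of [Z] and [Y] merge as soon as every linear
    form of [Z - Y] tends to zero in probability; tightness of [Z] is inherited from [Y]. *)
Lemma slutsky_normal (Z Y : nat -> T -> 'cV[R]_p) (V : 'M[R]_p) :
  (forall t : 'cV[R]_p, 0 <= (t^T *m V *m t) 0 0) ->
  (\forall n \near \oo, mmx (Z n)) -> (\forall n \near \oo, mmx (Y n)) ->
  (forall i, cvp P (fun n w => Z n w i 0 - Y n w i 0) 0) ->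
  (forall i, bip P (fun n w => Y n w i 0)) ->
  (forall (t : 'cV[R]_p) (c : R), Ex P (fun w => cos ((t^T *m Y n w) 0 0 + c)) @[n --> \oo] -->
     expR (- ((t^T *m V *m t) 0 0 / 2)) * cos c) ->
  cvg_dist_normal P Z V.
Proof.
move=> V0 mZ mY ZY bY cY; apply: cvg_dist_normal_cos => //.
- by apply: filterS mZ => n mZ i; exact: mZ.
- move=> i; have := bipD (bip_cvp (ZY i)) (bY i); congr bip.
  by apply/funext => n; apply/funext => w; rewrite subrK.
move=> t c; apply/cvgrPdist_le => e e0.
have e8 : 0 < e / 8 by rewrite divr_gt0.
have cv : cvp P (fun n w => \sum_i t i 0 * (Z n w i 0 - Y n w i 0)) 0.
  by apply: cvp_sum0 => i; have := cvpM (cvp_cst P (t i 0)) (ZY i); rewrite mulr0.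
near=> n.
have mZn : mmx (Z n) by near: n.
have mYn : mmx (Y n) by near: n.
have h1 : `|expR (- ((t^T *m V *m t) 0 0 / 2)) * cos c - Ex P (fun w => cos ((t^T *m Y n w) 0 0 + c))| <= e / 8.
  by near: n; apply: (cvgrPdist_le _ _).1 => //; exact: cY.
have [A mA [PA HA]] : off P (e / 8) (fun w => `|\sum_i t i 0 * (Z n w i 0 - Y n w i 0) - 0| <= e / 8).
  by near: n; exact: cv.
have mcos (W : T -> 'cV[R]_p) : mmx W -> measurable_fun setT (fun w => cos ((t^T *m W w) 0 0 + c)).
  by move=> mW; apply: itg_meas (itg_cos P _); apply: measurable_dot => i; exact: mW.
have h2 : `|Ex P (fun w => cos ((t^T *m Y n w) 0 0 + c)) - Ex P (fun w => cos ((t^T *m Z n w) 0 0 + c))| <= e / 8 + 2 * 1 * fine (P A).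
  apply: Ex_approx; rewrite ?(ltW e8)//; try exact: mcos.
  - by move=> w; rewrite ler_norml cos_geN1 cos_le1.
  - by move=> w; rewrite ler_norml cos_geN1 cos_le1.
  move=> w /HA; rewrite subr0 => h; apply: (le_trans (cos_lip _ _)).
  rewrite opprD addrACA subrr addr0 distrC; apply: le_trans h.
  rewrite [in X in X <= _]mxE [X in _ - X]mxE -sumrB.
  rewrite le_eqVlt; apply/orP; left; apply/eqP; congr `|_|.
  by apply: eq_bigr => i _; rewrite !mxE mulrBr.
have := ler_distD (Ex P (fun w => cos ((t^T *m Y n w) 0 0 + c))) (expR (- ((t^T *m V *m t) 0 0 / 2)) * cos c) (Ex P (fun w => cos ((t^T *m Z n w) 0 0 + c))).
lra.
Unshelve. all: end_near. Qed.

End slutsky.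

(** * Least squares in terms of Gram matrices and scores *)

Section regression.
Context {R : realType}.

Lemma beta_skE (k n p : nat) (Pi : 'M[R]_(k, n)) (X : 'M[R]_(n, p)) (y : 'cV[R]_n) (b : 'cV[R]_p) :
  (Pi *m X)^T *m (Pi *m X) \in unitmx ->
  beta_sk Pi X y - b = invmx ((Pi *m X)^T *m (Pi *m X)) *m ((Pi *m X)^T *m (Pi *m (y - X *m b))).
Proof.
move=> uG; rewrite /beta_sk !mulmxBr; congr (_ - _).
by rewrite (mulmxA Pi) (mulmxA _ _ b) mulKmx.
Qed.

(** Ordinary least squares becomes the sketch by the identity, so one expansion around [beta0]
    serves both estimators. *)
Lemma beta_ols_sk (n p : nat) (X : 'M[R]_(n, p)) (y : 'cV[R]_n) :
  beta_ols X y = beta_sk 1%:M X y.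
Proof. by rewrite /beta_ols /beta_sk !mul1mx. Qed.

Definition gram (k n p : nat) (Pi : 'M[R]_(k, n)) (X : 'M[R]_(n, p)) : 'M[R]_p :=
  n%:R^-1 *: ((Pi *m X)^T *m (Pi *m X)).

Definition score (m k n p : nat) (Pi : 'M[R]_(k, n)) (X : 'M[R]_(n, p)) (e : 'cV[R]_n) : 'cV[R]_p :=
  (Num.sqrt m%:R / n%:R) *: ((Pi *m X)^T *m (Pi *m e)).

Lemma beta_sk_score (m k n p : nat) (Pi : 'M[R]_(k, n)) (X : 'M[R]_(n, p)) (y : 'cV[R]_n) (b : 'cV[R]_p) :
  (0 < n)%N -> gram Pi X \in unitmx ->
  Num.sqrt m%:R *: (beta_sk Pi X y - b) = invmx (gram Pi X) *m score m Pi X (y - X *m b).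
Proof.
move=> n0 uG.
have n0' : (n%:R : R) != 0 by rewrite pnatr_eq0 -lt0n.
have uG' : (Pi *m X)^T *m (Pi *m X) \in unitmx.
  move: uG; rewrite /gram; set A := _ *m _ => uG.
  have -> : A = n%:R *: (n%:R^-1 *: A) by rewrite scalerA mulfV// scale1r.
  by rewrite unitmxZ ?unitfE.
rewrite (beta_skE _ _ uG') /gram /score invmxZ//.
rewrite -scalemxAl -!scalemxAr scalerA; congr (_ *: _).
by rewrite invrK mulrCA mulfV// mulr1.
Qed.

Context {d : measure_display} {T : measurableType d}.
Variables (P : probability T R) (p : nat).
Variables (y : nat -> T -> R) (X : nat -> 'I_p -> T -> R) (beta0 : 'cV[R]_p) (m : nat -> nat).
Hypothesis my : forall i, measurable_fun setT (y i).
Hypothesis mX : forall i j, measurable_fun setT (X i j).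

Definition errv n w : 'cV[R]_n := yvec y n w - Xmat X n w *m beta0.

(** The row count [k n] stays free because a Bernoulli sketch has [n] rows and a countsketch has
    [m n]. *)
Lemma regression_clt (S V : 'M[R]_p) (k : nat -> nat) (Pi : forall n, T -> 'M[R]_(k n, n)) :
  S \in unitmx ->
  (forall t : 'cV[R]_p, 0 <= (t^T *m V *m t) 0 0) ->
  (\forall n \near \oo, mmx (Pi n)) ->
  cvp_mx P (fun n w => gram (Pi n w) (Xmat X n w)) S ->
  cvp_mx P (fun n w => gram (1%:M : 'M[R]_n) (Xmat X n w)) S ->
  (forall i, bip P (fun n w => score (m n) (Pi n w) (Xmat X n w) (errv n w) i 0)) ->
  (forall i, cvp P (fun n w => score (m n) (1%:M : 'M[R]_n) (Xmat X n w) (errv n w) i 0) 0) ->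
  (forall (t : 'cV[R]_p) (c : R),
     Ex P (fun w => cos ((t^T *m (invmx S *m score (m n) (Pi n w) (Xmat X n w) (errv n w))) 0 0 + c)) @[n --> \oo] -->
     expR (- ((t^T *m V *m t) 0 0 / 2)) * cos c) ->
  cvg_dist_normal P (fun n w => Num.sqrt (m n)%:R *:
    (beta_sk (Pi n w) (Xmat X n w) (yvec y n w) - beta_ols (Xmat X n w) (yvec y n w))) V.
Proof.
move=> uS V0 mPi cG cH bN cO cN.
have mXm n : mmx (Xmat X n).
  by move=> i j; under eq_fun do rewrite mxE; exact: mX.
have myv n : mmx (yvec y n).
  by move=> i j; under eq_fun do rewrite mxE; exact: my.
have mcst q r (A : 'M[R]_(q, r)) : mmx (fun _ : T => A) by move=> i j.
have mD q r (A B : T -> 'M[R]_(q, r)) : mmx A -> mmx B -> mmx (fun w => A w - B w).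
  by move=> mA mB i j; under eq_fun do rewrite !mxE; exact: measurable_funB.
have mZ q r a (A : T -> 'M[R]_(q, r)) : mmx A -> mmx (fun w => a *: A w).
  by move=> mA i j; under eq_fun do rewrite !mxE; exact: measurable_funM.
have mev n : mmx (errv n).
  by apply: mD => //; apply: mmx_mul.
have msk n k0 (Q : T -> 'M[R]_(k0, n)) : mmx Q -> mmx (fun w => beta_sk (Q w) (Xmat X n w) (yvec y n w)).
  by move=> mQ; do ?[apply: mmx_mul|apply: mmx_inv|apply: mmx_tr|exact: mQ|exact: mXm|exact: myv].
have [uM cM] := cvp_invmx uS cG.
have [uH cHi] := cvp_invmx uS cH.
apply: (@slutsky_normal _ _ _ _ _ _ (fun n w => invmx S *m score (m n) (Pi n w) (Xmat X n w) (errv n w))) => //.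
- apply: filterS mPi => n mP; apply: mZ; apply: mD; first exact: msk.
  under eq_fun do rewrite beta_ols_sk; exact: msk.
- apply: filterS mPi => n mP; apply: mmx_mul; first exact: mcst.
  by apply: mZ; do ?[apply: mmx_mul|apply: mmx_tr|exact: mP|exact: mXm|exact: mev].
- move=> i.
  (* The gap between the normalized difference and [invmx S] times the score: the error of the
     inverse Gram matrix against a bounded score, minus the negligible full-sample term. The formula
     holds where both Gram matrices are invertible, hence [cvp_off]. *)
  apply: (@cvp_off _ _ _ _ (fun n w =>
     \sum_j (invmx (gram (Pi n w) (Xmat X n w)) i j - invmx S i j) * score (m n) (Pi n w) (Xmat X n w) (errv n w) j 0
     + - \sum_j invmx (gram (1%:M : 'M[R]_n) (Xmat X n w)) i j * score (m n) (1%:M : 'M[R]_n) (Xmat X n w) (errv n w) j 0)).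
    move=> eps e0; have e2 : 0 < eps / 2 by rewrite divr_gt0.
    near=> n.
    have h1 : off P (eps / 2) (fun w => gram (Pi n w) (Xmat X n w) \in unitmx) by near: n; exact: uM.
    have h2 : off P (eps / 2) (fun w => gram (1%:M : 'M[R]_n) (Xmat X n w) \in unitmx) by near: n; exact: uH.
    have n0 : (0 < n)%N by near: n; exists 1%N.
    apply: off_imp (off_and h1 h2) => [|w [w1 w2]]; first lra.
    have e1 := @beta_sk_score (m n) _ _ _ _ _ (yvec y n w) beta0 n0 w1.
    have e3 := @beta_sk_score (m n) _ _ _ _ _ (yvec y n w) beta0 n0 w2.
    rewrite beta_ols_sk.
    have -> : beta_sk (Pi n w) (Xmat X n w) (yvec y n w) - beta_sk 1%:M (Xmat X n w) (yvec y n w) =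
      (beta_sk (Pi n w) (Xmat X n w) (yvec y n w) - beta0) - (beta_sk 1%:M (Xmat X n w) (yvec y n w) - beta0).
      by rewrite opprB addrA subrK.
    rewrite scalerBr e1 e3 -/(errv n w) !mxE.
    rewrite [RHS]addrAC -[in RHS]sumrB; congr (_ - _).
    by apply: eq_bigr => j _; rewrite mulrBl.
  have c1 : cvp P (fun n w => \sum_j (invmx (gram (Pi n w) (Xmat X n w)) i j - invmx S i j) *
      score (m n) (Pi n w) (Xmat X n w) (errv n w) j 0) 0.
    apply: cvp_sum0 => j; apply: cvp0_bip; last exact: bN.
    by have := cvpD (cM i j) (cvp_cst P (- invmx S i j)); rewrite subrr.
  have c2 : cvp P (fun n w => \sum_j invmx (gram (1%:M : 'M[R]_n) (Xmat X n w)) i j *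
      score (m n) (1%:M : 'M[R]_n) (Xmat X n w) (errv n w) j 0) 0.
    apply: cvp_sum0 => j.
    by have := cvpM (cHi i j) (cO j); rewrite mulr0.
  have := cvpD c1 (cvpM (cvp_cst P (-1)) c2); rewrite mulr0 addr0.
  by apply: eq_cvp; apply: nearW => n w; rewrite mulN1r.
move=> i.
rewrite (_ : (fun n w => _) = fun n w => \sum_j invmx S i j * score (m n) (Pi n w) (Xmat X n w) (errv n w) j 0).
  by apply: bip_sum => j; exact: bipZ.
by apply/funext => n; apply/funext => w; rewrite mxE.
Unshelve. all: end_near. Qed.

End regression.

(** * The observations *)

Section identical_distribution.
Context {d : measure_display} {T : measurableType d} {R : realType}.
Variables (P : probability T R) (p : nat).

Definition obs (y : T -> R) (X : 'I_p -> T -> R) (w : T) : p.+1.-tuple R :=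
  [tuple of y w :: [tuple X j w | j < p]].

Lemma obsS y X w j : tnth (obs y X w) (lift ord0 j) = X j w.
Proof. by rewrite tnthS tnth_mktuple. Qed.

Lemma measurable_obs y X : measurable_fun setT y -> (forall j, measurable_fun setT (X j)) ->
  measurable_fun setT (obs y X).
Proof.
move=> my mX; apply/measurable_fun_tnthP => i.
have [k|] := unliftP ord0 i.
  by move=> ->; rewrite (_ : _ \o _ = X k)//; apply/funext => w /=; exact: obsS.
by move=> ->; rewrite (_ : _ \o _ = y).
Qed.

Definition rectangle : set (set (p.+1.-tuple R)) :=
  [set A | exists (B0 : set R) (B : 'I_p -> set R), [/\ measurable B0, (forall j, measurable (B j)) &
     A = [set t | B0 (tnth t ord0)] `&` [set t | forall j, B j (tnth t (lift ord0 j))]]].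

Lemma rectangleI : setI_closed rectangle.
Proof.
move=> _ _ [B0 [B [mB0 mB ->]]] [C0 [C [mC0 mC ->]]].
exists (B0 `&` C0), (fun j => B j `&` C j); split.
- exact: measurableI.
- by move=> j; exact: measurableI.
apply/seteqP; split => t /=; first by move=> [[? ?] [? ?]].
by move=> [[? ?] h]; split; split => // j; have [] := h j.
Qed.

Lemma rectangle_measurable : rectangle `<=` measurable.
Proof.
move=> _ [B0 [B [mB0 mB ->]]]; apply: measurableI.
  by rewrite -[X in measurable X]setTI; exact: (measurable_tnth ord0).
rewrite (_ : [set t | _] = \big[setI/setT]_(j < p) [set t : p.+1.-tuple R | B j (tnth t (lift ord0 j))]).
  apply: bigsetI_measurable => j _.
  by rewrite -[X in measurable X]setTI; exact: (measurable_tnth (lift ord0 j)).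
rewrite -bigcap_seq; apply/seteqP; split => t /= h.
  by move=> j _; exact: h.
by move=> j; apply: h; rewrite /= mem_index_enum.
Qed.

Lemma measurable_rectangle : (measurable : set (set (p.+1.-tuple R))) `<=` <<s rectangle >>.
Proof.
apply: smallest_sub; first exact: smallest_sigma_algebra.
rewrite -bigcup_seq => A [i /= _ [B mB <-]].
apply: sub_sigma_algebra; rewrite setTI.
have [k|] := unliftP ord0 i => ->.
  exists setT, (fun j => if j == k then B else setT); split => //.
    by move=> j; case: ifP.
  apply/seteqP; split => t /=; last by move=> [_ /(_ k)]; rewrite eqxx.
  by move=> h; split=> // j; case: eqP => [->|].
exists B, (fun=> setT); split => //.
by apply/seteqP; split => t /=; [|case].
Qed.

Variables (y1 y2 : T -> R) (X1 X2 : 'I_p -> T -> R).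
Hypothesis my1 : measurable_fun setT y1.
Hypothesis my2 : measurable_fun setT y2.
Hypothesis mX1 : forall j, measurable_fun setT (X1 j).
Hypothesis mX2 : forall j, measurable_fun setT (X2 j).
Hypothesis law : same_law_vec P y1 X1 y2 X2.

(** The rectangles that define [same_law_vec] form a pi-system generating the sigma-algebra of
    tuples, so equality on them determines the whole joint law. *)
Lemma same_law_measure (A : set (p.+1.-tuple R)) : measurable A ->
  P (obs y1 X1 @^-1` A) = P (obs y2 X2 @^-1` A).
Proof.
move=> mA.
have mo1 := measurable_obs my1 mX1; have mo2 := measurable_obs my2 mX2.
pose F1 : {mfun T >-> p.+1.-tuple R} := HB.pack (obs y1 X1) (isMeasurableFun.Build _ _ _ _ _ mo1).
pose F2 : {mfun T >-> p.+1.-tuple R} := HB.pack (obs y2 X2) (isMeasurableFun.Build _ _ _ _ _ mo2).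
pose m1 : {measure set (p.+1.-tuple R) -> \bar R} := distribution P F1.
pose m2 : {measure set (p.+1.-tuple R) -> \bar R} := distribution P F2.
suff : m1 A = m2 A by [].
apply: (@g_sigma_algebra_measure_unique _ _ _ rectangle rectangle_measurable (fun=> setT)).
- move=> _; exists setT, (fun=> setT); split => //.
  by apply/seteqP; split.
- by apply/seteqP; split => // t _; exists 0%N.
- exact: rectangleI.
- move=> _ [B0 [B [mB0 mB ->]]]; rewrite /m1 /m2 /distribution /pushforward/=.
  have := law mB0 mB; congr (P _ = P _).
    apply/seteqP; split => w /= [h1 h2]; split => // j; first by rewrite obsS.
    by have := h2 j; rewrite obsS.
  apply/seteqP; split => w /= [h1 h2]; split => // j; first by rewrite obsS.
  by have := h2 j; rewrite obsS.
- by move=> _; rewrite /m1 /distribution /pushforward/= probability_setT ltry.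
- exact: measurable_rectangle.
Qed.

Lemma same_law_Ex (f : R -> ('I_p -> R) -> R) :
  measurable_fun setT (fun t : p.+1.-tuple R => f (tnth t ord0) (fun j => tnth t (lift ord0 j))) ->
  itg P (fun w => f (y2 w) (X2^~ w)) ->
  itg P (fun w => f (y1 w) (X1^~ w)) /\
  Ex P (fun w => f (y1 w) (X1^~ w)) = Ex P (fun w => f (y2 w) (X2^~ w)).
Proof.
set g := (fun t => _) => mg i2.
have mo1 := measurable_obs my1 mX1; have mo2 := measurable_obs my2 mX2.
have e1 : (fun w => f (y1 w) (X1^~ w)) = g \o obs y1 X1.
  by apply/funext => w; rewrite /g /= ; congr f; apply/funext => j; rewrite obsS.
have e2 : (fun w => f (y2 w) (X2^~ w)) = g \o obs y2 X2.
  by apply/funext => w; rewrite /g /= ; congr f; apply/funext => j; rewrite obsS.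
rewrite e1 e2 in i2 *.
pose F1 : {mfun T >-> p.+1.-tuple R} := HB.pack (obs y1 X1) (isMeasurableFun.Build _ _ _ _ _ mo1).
pose F2 : {mfun T >-> p.+1.-tuple R} := HB.pack (obs y2 X2) (isMeasurableFun.Build _ _ _ _ _ mo2).
have m12 : forall A : set (p.+1.-tuple R), measurable A -> A `<=` setT ->
    distribution P F1 A = distribution P F2 A.
  by move=> A mA _; exact: same_law_measure.
have mgE : measurable_fun setT (EFin \o g) by exact/measurable_EFinP.
have i1 : itg P (g \o obs y1 X1).
  apply/integrableP; split; first by apply/measurable_EFinP; exact: (measurableT_comp mg mo1).
  have mabs : measurable_fun setT (fun t => `|(EFin \o g) t|)%E by exact: measurableT_comp.
  have := @ge0_integral_distribution _ _ _ _ _ P F1 _ mabs (fun t => abse_ge0 _).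
  rewrite /= => <-.
  rewrite (eq_measure_integral (distribution P F2))//.
  rewrite (@ge0_integral_distribution _ _ _ _ _ P F2 _ mabs (fun t => abse_ge0 _)).
  by move/integrableP : i2 => [].
split=> //; rewrite /Ex /Rintegral; congr fine.
have := @integral_distribution _ _ _ _ _ P F1 _ mgE i1.
have := @integral_distribution _ _ _ _ _ P F2 _ mgE i2.
rewrite /= => <- <-.
exact: eq_measure_integral.
Qed.

End identical_distribution.

Section uncorrelated_sums.
Context {d : measure_display} {T : measurableType d} {R : realType}.
Variable P : probability T R.

Lemma Ex_sqr_sum (I : eqType) (r : seq I) (xi : I -> T -> R) :
  uniq r -> (forall i, i \in r -> L2 P (xi i)) ->
  (forall i l, i \in r -> l \in r -> i != l -> Ex P (fun w => xi i w * xi l w) = 0) ->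
  L2 P (fun w => \sum_(i <- r) xi i w) /\
  Ex P (fun w => (\sum_(i <- r) xi i w) ^+ 2) = \sum_(i <- r) Ex P (fun w => xi i w ^+ 2).
Proof.
elim: r => [_ _ _|i r IH /= /andP[ir ur] x2 x0].
  rewrite big_nil; split.
    by apply: eq_L2 (L2_cst P 0) => w; rewrite big_nil.
  rewrite (@eq_Ex _ _ _ _ _ (fun=> 0)) ?Ex_cst// => w.
  by rewrite big_nil expr0n.
have sr l : l \in r -> l \in i :: r by rewrite inE orbC => ->.
have ii : i \in i :: r by rewrite inE eqxx.
have [L2r Er] := IH ur (fun l lr => x2 l (sr _ lr)) (fun l k lr kr => x0 l k (sr _ lr) (sr _ kr)).
have Li := x2 i ii.
split; first by apply: eq_L2 (L2D Li L2r) => w; rewrite big_cons.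
rewrite big_cons -Er.
have cross : Ex P (fun w => xi i w * \sum_(l <- r) xi l w) = 0.
  rewrite (@eq_Ex _ _ _ _ _ (fun w => \sum_(l <- r | l \in r) xi i w * xi l w)); last first.
    by move=> w; rewrite mulr_sumr big_seq.
  rewrite Ex_sum; last by move=> l lr; apply: L2M => //; exact/x2/sr.
  rewrite big1// => l lr; apply: x0 => //; first exact: sr.
  by apply: contraNneq ir => ->.
rewrite (@eq_Ex _ _ _ _ _ (fun w => (xi i w ^+ 2 + 2 * (xi i w * \sum_(l <- r) xi l w)) + (\sum_(l <- r) xi l w) ^+ 2)); last first.
  by move=> w; rewrite big_cons; ring.
have i1 := L2M Li L2r.
rewrite (ExD (itgD Li.2 (itgZ 2 i1)) L2r.2) (ExD Li.2 (itgZ 2 i1)) (ExZ 2 i1) cross.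
by rewrite mulr0 addr0.
Qed.

Lemma Ex_sqr_center (f : T -> R) : L2 P f ->
  Ex P (fun w => (f w - Ex P f) ^+ 2) = Ex P (fun w => f w ^+ 2) - Ex P f ^+ 2.
Proof.
move=> f2; have fi := L2_itg f2; set a := Ex P f.
rewrite (@eq_Ex _ _ _ _ _ (fun w => (f w ^+ 2 - (2 * a) * f w) + a ^+ 2)); last by move=> w; ring.
rewrite (ExD (itgB f2.2 (itgZ _ fi)) (itg_cst _ _)) (ExB f2.2 (itgZ _ fi)) (ExZ _ fi) Ex_cst -/a.
ring.
Qed.

End uncorrelated_sums.

Section regression_data.
Context {d : measure_display} {T : measurableType d} {R : realType}.
Variables (P : probability T R) (p : nat).
Variables (y : nat -> T -> R) (X : nat -> 'I_p -> T -> R) (beta0 : 'cV[R]_p).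
Hypothesis my : forall i, measurable_fun setT (y i).
Hypothesis mX : forall i j, measurable_fun setT (X i j).
Hypothesis law : forall i, same_law_vec P (y i) (X i) (y 0%N) (X 0%N).
Hypothesis ind : mutually_independent P (fun i : nat => [set y i] `|` [set X i j | j in [set: 'I_p]]).
Hypothesis y4 : (\int[P]_w ((y 0%N w) ^+ 4)%:E < +oo)%E.
Hypothesis X4 : (\int[P]_w ((\sum_j (X 0%N j w) ^+ 2) ^+ 2)%:E < +oo)%E.

Definition datagen (i : nat) : set (T -> R) := [set y i] `|` [set X i j | j in [set: 'I_p]].

Definition datameas (i : nat) (f : T -> R) : Prop :=
  forall A, measurable A -> sigma_gen (datagen i) (f @^-1` A).

(* Functions of a single observation, as functions of the tuple [(y, X_1, .., X_p)]. *)
Definition obsfun (f : R -> ('I_p -> R) -> R) : Prop :=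
  measurable_fun setT (fun t : p.+1.-tuple R => f (tnth t ord0) (fun j => tnth t (lift ord0 j))).

Lemma obsfun_y : obsfun (fun u _ => u). Proof. exact: (measurable_tnth ord0). Qed.
Lemma obsfun_X j : obsfun (fun _ v => v j). Proof. exact: (measurable_tnth (lift ord0 j)). Qed.
Lemma obsfun_cst (k : R) : obsfun (fun _ _ => k). Proof. exact: measurable_cst. Qed.
Lemma obsfunB f g : obsfun f -> obsfun g -> obsfun (fun u v => f u v - g u v).
Proof. exact: measurable_funB. Qed.
Lemma obsfunM f g : obsfun f -> obsfun g -> obsfun (fun u v => f u v * g u v).
Proof. exact: measurable_funM. Qed.
Lemma obsfunX k f : obsfun f -> obsfun (fun u v => f u v ^+ k).
Proof. by move=> mf; exact: measurable_funX. Qed.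
Lemma obsfun_sum (J : Type) (r : seq J) (F : J -> R -> ('I_p -> R) -> R) :
  (forall j, obsfun (F j)) -> obsfun (fun u v => \sum_(j <- r) F j u v).
Proof. by move=> mF; apply: measurable_sum => j; exact: mF. Qed.
Lemma obsfun_comp (g : R -> R) f : measurable_fun setT g -> obsfun f -> obsfun (fun u v => g (f u v)).
Proof. by move=> mg mf; exact: measurableT_comp. Qed.

Definition ob (f : R -> ('I_p -> R) -> R) (i : nat) (w : T) : R := f (y i w) (X i ^~ w).

Definition errf (u : R) (v : 'I_p -> R) : R := u - \sum_j v j * beta0 j 0.
Definition linf (a : 'cV[R]_p) (u : R) (v : 'I_p -> R) : R := \sum_j a j 0 * v j.

Lemma obsfun_err : obsfun errf.
Proof.
apply: obsfunB; first exact: obsfun_y.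
by apply: obsfun_sum => j; apply: obsfunM; [exact: obsfun_X|exact: obsfun_cst].
Qed.

Lemma obsfun_lin a : obsfun (linf a).
Proof. by apply: obsfun_sum => j; apply: obsfunM; [exact: obsfun_cst|exact: obsfun_X]. Qed.

Lemma errvE n w (i : 'I_n) : errv y X beta0 n w i 0 = ob errf i w.
Proof.
rewrite /errv /ob /errf !mxE; congr (_ - _).
by apply: eq_bigr => j _; rewrite mxE.
Qed.

Lemma sigma_gen_measurable i : sigma_gen (datagen i) `<=` measurable.
Proof.
apply: smallest_sub; first exact: sigma_algebra_measurable.
move=> _ [f + [B mB <-]] => -[->|[j _ <-]]; rewrite -[X in measurable X]setTI; first exact: my.
exact: mX.
Qed.

Lemma ob_meas f i : obsfun f -> measurable_fun setT (ob f i).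
Proof.
move=> mf; have := measurableT_comp mf (measurable_obs (my i) (mX i)).
congr (measurable_fun _ _); apply/funext => w; rewrite /ob /=; congr f.
by apply/funext => j; rewrite obsS.
Qed.

Lemma ob_datameas f i : obsfun f -> datameas i (ob f i).
Proof.
move=> mf A mA.
pose g : set (set T) := [set f @^-1` B | f in datagen i & B in [set B : set R | measurable B]].
have gy : @measurable_fun _ _ (g_sigma_algebraType g) R setT (y i).
  by move=> _ B mB; rewrite setTI; apply: sub_sigma_algebra; exists (y i); [left|exists B].
have gX j : @measurable_fun _ _ (g_sigma_algebraType g) R setT (X i j).
  by move=> _ B mB; rewrite setTI; apply: sub_sigma_algebra; exists (X i j); [right; exists j|exists B].
have h := measurableT_comp mf (measurable_obs gy gX).
have E : ob f i = (fun t : p.+1.-tuple R => f (tnth t ord0) (fun j => tnth t (lift ord0 j))) \o obs (y i) (X i).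
  by apply/funext => w; rewrite /ob /=; congr f; apply/funext => j; rewrite obsS.
by rewrite E -[X in sigma_gen _ X]setTI; exact: h.
Qed.

Lemma ob_law f i : obsfun f -> itg P (ob f 0) -> itg P (ob f i) /\ Ex P (ob f i) = Ex P (ob f 0).
Proof. by move=> mf f0; exact: same_law_Ex (my i) (my 0%N) (mX i) (mX 0%N) (law i) _ mf f0. Qed.

Lemma ob_indep f g i l : i != l -> obsfun f -> obsfun g -> indep2 P (ob f i) (ob g l).
Proof.
move=> il mf mg A B mA mB.
have hA := ob_datameas (i := i) mf mA; have hB := ob_datameas (i := l) mg mB.
pose C k := if k == i then ob f i @^-1` A else ob g l @^-1` B.
have := ind (s := [:: i; l]) (A := C).
rewrite /= inE il => /(_ isT).
rewrite !big_cons !big_nil setIT mulr1 /C eqxx eq_sym (negbTE il).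
have fA : P (ob f i @^-1` A) \is a fin_num by apply: fin_num_measure; exact: sigma_gen_measurable hA.
have fB : P (ob g l @^-1` B) \is a fin_num by apply: fin_num_measure; exact: sigma_gen_measurable hB.
rewrite EFinM !fineK//; apply => k; rewrite !inE => /orP[] /eqP ->; first by rewrite eqxx.
by rewrite eq_sym (negbTE il).
Qed.

Lemma L4_y0 : L4 P (ob (fun u _ => u) 0).
Proof.
split; first exact: my; apply/integrableP; split.
  by apply/measurable_EFinP; apply: measurable_funX; exact: my.
apply: le_lt_trans y4; rewrite le_eqVlt; apply/orP; left; apply/eqP.
by apply: eq_integral => w _; rewrite /= ger0_norm// exprn_even_ge0.
Qed.

Lemma L4_X0 j : L4 P (ob (fun _ v => v j) 0).
Proof.
split; first exact: mX.
have i4 : itg P (fun w => (\sum_j (X 0%N j w) ^+ 2) ^+ 2).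
  apply/integrableP; split.
    apply/measurable_EFinP; apply: measurable_funX; apply: measurable_sum => k.
    by apply: measurable_funX; exact: mX.
  apply: le_lt_trans X4; rewrite le_eqVlt; apply/orP; left; apply/eqP.
  by apply: eq_integral => w _; rewrite /= ger0_norm// sqr_ge0.
apply: itg_dom i4; first by apply: measurable_funX; exact: mX.
move=> w; rewrite ger0_norm ?exprn_even_ge0// /ob (exprM _ 2 2).
have h : X 0%N j w ^+ 2 <= \sum_j (X 0%N j w) ^+ 2.
  by rewrite (bigD1 j)//= lerDl sumr_ge0// => k _; exact: sqr_ge0.
by rewrite lerXn2r ?nnegrE ?sqr_ge0// (le_trans _ h)// sqr_ge0.
Qed.

Lemma L4_err0 : L4 P (ob errf 0).
Proof.
apply: L4B; first exact: L4_y0.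
apply: (L4_sum (index_enum 'I_p) (p := xpredT) (F := fun j w => X 0%N j w * beta0 j 0)) => j _.
by apply: eq_L4 (L4Z (beta0 j 0) (L4_X0 j)) => w; rewrite mulrC.
Qed.

Lemma L4_lin0 a : L4 P (ob (linf a) 0).
Proof.
apply: (L4_sum (index_enum 'I_p) (p := xpredT) (F := fun j w => a j 0 * X 0%N j w)) => j _.
exact: L4Z (L4_X0 j).
Qed.

Lemma L2_law f i : obsfun f -> L2 P (ob f 0) -> L2 P (ob f i).
Proof.
move=> mf [_ f4]; split; first exact: ob_meas.
exact: (ob_law i (obsfunX 2 mf) f4).1.
Qed.

(** Independence makes the variance additive, and a variance is at most the second moment. *)
Lemma ob_mean_var (f : R -> ('I_p -> R) -> R) (n : nat) : obsfun f -> L2 P (ob f 0) ->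
  L2 P (fun w => \sum_(i < n) (ob f i w - Ex P (ob f 0))) /\
  Ex P (fun w => (\sum_(i < n) (ob f i w - Ex P (ob f 0))) ^+ 2) <= n%:R * Ex P (fun w => ob f 0 w ^+ 2).
Proof.
move=> mf f2; set a := Ex P (ob f 0).
have mg : obsfun (fun u v => f u v - a) by apply: obsfunB => //; exact: obsfun_cst.
have g2 : L2 P (ob (fun u v => f u v - a) 0) by apply: L2B => //; exact: L2_cst.
have g2i i := L2_law i mg g2.
have g0 : Ex P (ob (fun u v => f u v - a) 0) = 0.
  rewrite (ExB (L2_itg f2) (itg_cst _ _)) Ex_cst; exact: subrr.
have [h1 h2] := @Ex_sqr_sum _ _ _ P 'I_n (index_enum 'I_n) (fun i => ob (fun u v => f u v - a) i)
  (index_enum_uniq _) (fun i _ => g2i i) (fun i l _ _ il =>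
   etrans (ExM (ob_indep il mg mg) (L2_itg (g2i i)) (L2_itg (g2i l))).2
   (etrans (congr1 (fun x => x * _) (etrans (ob_law i mg (L2_itg g2)).2 g0)) (mul0r _))).
split; first exact: h1.
rewrite h2 (eq_bigr (fun=> Ex P (fun w => ob (fun u v => f u v - a) 0 w ^+ 2))); last first.
  by move=> i _; exact: (ob_law i (obsfunX 2 mg) g2.2).2.
rewrite sumr_const card_ord -[leLHS]mulr_natl; apply: ler_wpM2l => //.
rewrite (_ : Ex P _ = Ex P (fun w => ob f 0 w ^+ 2) - a ^+ 2).
  by rewrite gerBl sqr_ge0.
exact: Ex_sqr_center.
Qed.

Variable m : nat -> nat.
Hypothesis mn0 : (fun n => (m n)%:R / n%:R : R) @ \oo --> (0 : R).
Hypothesis eX0 : forall j, Ex P (ob (fun u v => errf u v * v j) 0) = 0.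

Let Sxx : 'M[R]_p := \matrix_(j, k) Ex P (ob (fun _ v => v j * v k) 0).

Lemma obsfun_XX j k : obsfun (fun _ v => v j * v k).
Proof. by apply: obsfunM; exact: obsfun_X. Qed.

Lemma obsfun_eX j : obsfun (fun u v => errf u v * v j).
Proof. by apply: obsfunM; [exact: obsfun_err|exact: obsfun_X]. Qed.

Lemma L2_XX j k : L2 P (ob (fun _ v => v j * v k) 0).
Proof. exact: L4M (L4_X0 j) (L4_X0 k). Qed.

Lemma L2_eX j : L2 P (ob (fun u v => errf u v * v j) 0).
Proof. exact: L4M L4_err0 (L4_X0 j). Qed.

Lemma gram_ols (n : nat) w j k :
  gram (1%:M : 'M[R]_n) (Xmat X n w) j k = n%:R^-1 * \sum_(i < n) ob (fun _ v => v j * v k) i w.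
Proof.
by rewrite /gram !mul1mx !mxE; congr (_ * _); apply: eq_bigr => i _; rewrite !mxE.
Qed.

Lemma score_ols (n : nat) w j :
  score (m n) (1%:M : 'M[R]_n) (Xmat X n w) (errv y X beta0 n w) j 0 =
  Num.sqrt (m n)%:R / n%:R * \sum_(i < n) ob (fun u v => errf u v * v j) i w.
Proof.
rewrite /score !mul1mx mxE [X in _ * X]mxE; congr (_ * _); apply: eq_bigr => i _.
by rewrite errvE !mxE mulrC.
Qed.

Lemma cvg_cinv (c : R) : (fun n : nat => c / n%:R) @ \oo --> (0 : R).
Proof.
apply/cvgrPdist_le => e e0; near=> n.
have n0 : (0 : R) < n%:R by rewrite ltr0n; near: n; exists 1%N.
rewrite sub0r normrN normrM (@ger0_norm _ n%:R^-1) ?invr_ge0 ?(ltW n0)//.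
rewrite ler_pdivrMr// mulrC -ler_pdivrMr//.
by near: n; exact: nbhs_infty_ger.
Unshelve. all: end_near. Qed.

Lemma cvp_gram_ols : cvp_mx P (fun n w => gram (1%:M : 'M[R]_n) (Xmat X n w)) Sxx.
Proof.
move=> j k; rewrite mxE; set f := (fun _ v => v j * v k).
have mf : obsfun f := obsfun_XX j k; have f2 : L2 P (ob f 0) := L2_XX j k.
apply: cvp_L2 (cvg_cinv (Ex P (fun w => ob f 0 w ^+ 2))).
near=> n.
have n0 : (n%:R : R) != 0 by rewrite pnatr_eq0 -lt0n; near: n; exists 1%N.
have [h1 h2] := ob_mean_var n mf f2.
have E w : gram (1%:M : 'M[R]_n) (Xmat X n w) j k - Ex P (ob f 0) = n%:R^-1 * \sum_(i < n) (ob f i w - Ex P (ob f 0)).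
  rewrite gram_ols sumrB sumr_const card_ord mulrBr; congr (_ - _).
  by rewrite -[Ex P (ob f 0) *+ n]mulr_natl mulrA mulVf// mul1r.
split; first by apply: eq_L2 (L2Z n%:R^-1 h1) => w; rewrite E.
rewrite (@eq_Ex _ _ _ _ _ (fun w => (n%:R^-1) ^+ 2 * (\sum_(i < n) (ob f i w - Ex P (ob f 0))) ^+ 2)); last first.
  by move=> w; rewrite E exprMn.
rewrite (ExZ _ h1.2).
apply: (le_trans (ler_wpM2l (sqr_ge0 _) h2)).
by rewrite le_eqVlt; apply/orP; left; apply/eqP; field.
Unshelve. all: end_near. Qed.

(** The scaling [sqrt m / n] leaves second moment at most [m / n] times a constant; this is where
    the full sample is seen to be much more precise than the sketch. *)
Lemma cvp_score_ols j :
  cvp P (fun n w => score (m n) (1%:M : 'M[R]_n) (Xmat X n w) (errv y X beta0 n w) j 0) 0.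
Proof.
set f := (fun u v => errf u v * v j).
have mf : obsfun f := obsfun_eX j; have f2 : L2 P (ob f 0) := L2_eX j.
have Ef : Ex P (ob f 0) = 0 := eX0 j.
have lim0 : (fun n => (m n)%:R / n%:R * Ex P (fun w => ob f 0 w ^+ 2)) @ \oo --> (0 : R).
  rewrite -[X in _ --> X](mul0r (Ex P (fun w => ob f 0 w ^+ 2))).
  by apply: cvgM => //; exact: cvg_cst.
apply: cvp_L2 lim0.
near=> n.
have n0 : (n%:R : R) != 0 by rewrite pnatr_eq0 -lt0n; near: n; exists 1%N.
have [h1 h2] := ob_mean_var n mf f2.
have E w : score (m n) (1%:M : 'M[R]_n) (Xmat X n w) (errv y X beta0 n w) j 0 - 0 = Num.sqrt (m n)%:R / n%:R * \sum_(i < n) (ob f i w - Ex P (ob f 0)).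
  by rewrite subr0 score_ols; congr (_ * _); apply: eq_bigr => i _; rewrite Ef subr0.
split; first by apply: eq_L2 (L2Z (Num.sqrt (m n)%:R / n%:R) h1) => w; rewrite E.
rewrite (@eq_Ex _ _ _ _ _ (fun w => (Num.sqrt (m n)%:R / n%:R) ^+ 2 * (\sum_(i < n) (ob f i w - Ex P (ob f 0))) ^+ 2)); last first.
  by move=> w; rewrite E exprMn.
rewrite (ExZ _ h1.2).
apply: (le_trans (ler_wpM2l (sqr_ge0 _) h2)).
rewrite le_eqVlt; apply/orP; left; apply/eqP.
by rewrite exprMn sqr_sqrtr ?ler0n//; field.
Unshelve. all: end_near. Qed.

End regression_data.

Lemma null_bigsetU {d : measure_display} {T : measurableType d} {R : realType}
    (P : probability T R) (I : Type) (r : seq I) (A : I -> set T) :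
  (forall i, measurable (A i) /\ P (A i) = 0%E) ->
  measurable (\big[setU/set0]_(i <- r) A i) /\ P (\big[setU/set0]_(i <- r) A i) = 0%E.
Proof.
move=> A0; apply: (big_ind (fun B => measurable B /\ P B = 0%E)) => //.
  by move=> B C [mB B0] [mC C0]; split; [exact: measurableU|rewrite measureU0].
Qed.

Section mutual_independence.
Context {d : measure_display} {T : measurableType d} {R : realType}.
Variables (P : probability T R) (I : finType) (F : I -> set (T -> R)).

Lemma indep_family_sigma_gen : mutually_independent P F ->
  indep_family P (fun i => sigma_gen (F i)).
Proof.
move=> indF A FA; have := @indF (enum I) A (enum_uniq _) (fun i _ => FA i).
by rewrite !big_enum.
Qed.

Hypothesis mF : forall i f, F i f -> measurable_fun setT f.

Lemma sigma_gen_sub_measurable i : sigma_gen (F i) `<=` measurable.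
Proof.
apply: smallest_sub; first exact: sigma_algebra_measurable.
by move=> _ [f Ff [B mB <-]]; rewrite -[X in measurable X]setTI; exact: mF Ff _ _ _.
Qed.

Lemma pi_family_sigma_gen : pi_family (fun i => sigma_gen (F i)).
Proof.
move=> i; pose g : set (set T) := [set f @^-1` B | f in F i & B in [set B : set R | measurable B]].
split; last exact: sigma_gen_sub_measurable.
  exact: (@measurableT _ (g_sigma_algebraType g)).
exact: (@measurableI _ (g_sigma_algebraType g)).
Qed.

End mutual_independence.

Section observation_blocks.
Context {d : measure_display} {T : measurableType d} {R : realType}.
Variables (P : probability T R) (n : nat) (I : finType) (G : I -> set (set T)).
Variable idx : I -> option 'I_n.
Hypothesis piG : pi_family G.
Hypothesis indG : indep_family P G.

(** Collects all independent sources attached to the observations in [A], such as the data and a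
    selection indicator or sign. The value [None] of [idx] marks sources attached to no observation,
    as the hash locations will be. *)
Definition obsblock (A : {set 'I_n}) : {set I} :=
  [set x | if idx x is Some i then i \in A else false]%SET.

Definition om (A : {set 'I_n}) (f : T -> R) := bmeas G (obsblock A) f.

Lemma om_meas A f : om A f -> measurable_fun setT f.
Proof. exact: (bmeas_meas piG). Qed.

Lemma om_sub (A B : {set 'I_n}) f : {subset A <= B} -> om A f -> om B f.
Proof.
move=> AB; apply: bmeas_sub; apply/fintype.subsetP => x; rewrite !inE.
by case: (idx x) => // i; exact: AB.
Qed.

Lemma om_indep (A B : {set 'I_n}) f g : {in A, forall i, i \notin B} ->
  om A f -> om B g -> indep2 P f g.
Proof.
move=> AB; apply: (bmeas_indep piG indG) => x; rewrite !inE.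
by case: (idx x) => // i; exact: AB.
Qed.

Lemma om_cst A (k : R) : om A (fun=> k). Proof. exact: measurable_cst. Qed.

Lemma om_sum A (J : eqType) (r : seq J) (F : J -> T -> R) :
  (forall j, j \in r -> om A (F j)) -> om A (fun w => \sum_(j <- r) F j w).
Proof.
elim: r => [_|j r IH rF].
  rewrite (_ : (fun w => _) = fun=> 0); first exact: om_cst.
  by apply/funext => w; rewrite big_nil.
rewrite (_ : (fun w => _) = fun w => F j w + \sum_(i <- r) F i w); last first.
  by apply/funext => w; rewrite big_cons.
apply: measurable_funD; first by apply: rF; rewrite inE eqxx.
by apply: IH => i ir; apply: rF; rewrite inE ir orbT.
Qed.

Lemma omM A f g : om A f -> om A g -> om A (fun w => f w * g w).
Proof. exact: measurable_funM. Qed.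

Lemma omD A f g : om A f -> om A g -> om A (fun w => f w + g w).
Proof. exact: measurable_funD. Qed.

(** Provides the independence hypothesis of [clt_inequality] for summands that live on disjoint sets
    of observations. *)
Lemma blocks_indep (N : nat) (xi : nat -> T -> R) (A : nat -> {set 'I_n}) :
  (forall k, (k < N)%N -> om (A k) (xi k)) ->
  (forall j k, (j < k)%N -> {in A j, forall i, i \notin A k}) ->
  forall k, (k < N)%N -> indep2 P (fun w => \sum_(j < k) xi j w) (xi k).
Proof.
move=> omA disj k kN.
pose U := [set i | [exists j : 'I_k, i \in A j]]%SET.
apply: (@om_indep U (A k)); last exact: omA.
  by move=> i; rewrite inE => /existsP[j ij]; exact: disj (ltn_ord j) _ ij.
apply: om_sum => j _; apply: om_sub (omA _ (ltn_trans (ltn_ord j) kN)).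
by move=> i ij; rewrite inE; apply/existsP; exists j.
Qed.

End observation_blocks.

(** * Bernoulli sampling *)

Section bernoulli_sampling.
Context {d : measure_display} {T : measurableType d} {R : realType}.
Variables (P : probability T R) (p : nat).
Variables (y : nat -> T -> R) (X : nat -> 'I_p -> T -> R) (beta0 : 'cV[R]_p).
Hypothesis my : forall i, measurable_fun setT (y i).
Hypothesis mX : forall i j, measurable_fun setT (X i j).
Hypothesis law : forall i, same_law_vec P (y i) (X i) (y 0%N) (X 0%N).
Local Notation ob := (ob y X).

Variables (n m : nat) (B : T -> 'M[R]_(n, n)).
Hypothesis n0 : (0 < n)%N.
Hypothesis m0 : (0 < m)%N.
Let q : R := m%:R / n%:R.
Hypothesis mB : forall i j, measurable_fun setT (fun w => B w i j).
Hypothesis offdiag : forall w (i j : 'I_n), i != j -> B w i j = 0.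
Hypothesis B1 : forall i : 'I_n, P [set w | B w i i = 1] = q%:E.
Hypothesis B0 : forall i : 'I_n, P [set w | B w i i = 0] = (1 - q)%:E.

Let F (a : 'I_n + 'I_n) : set (T -> R) := match a with
  | inl i => [set y i] `|` [set X i j | j in [set: 'I_p]]
  | inr k => [set fun w => B w k k]
  end.
Hypothesis indF : mutually_independent P F.

Let G a := sigma_gen (F a).
Let idx (a : 'I_n + 'I_n) := Some (match a with inl i => i | inr i => i end).

Let mF a f : F a f -> measurable_fun setT f.
Proof. by case: a => [i [->|[j _ <-]]|k ->]; [exact: my|exact: mX|exact: mB]. Qed.

Let piG : pi_family G. Proof. exact: pi_family_sigma_gen. Qed.
Let indG : indep_family P G. Proof. exact: indep_family_sigma_gen. Qed.

Let hit i : set T := [set w | B w i i = 1].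

Let hitE i : hit i = (fun w => B w i i) @^-1` [set 1]. Proof. by []. Qed.

Let mhit i : measurable (hit i).
Proof. by rewrite hitE -[X in measurable X]setTI; exact: mB. Qed.

(** The diagonal entry is Bernoulli only almost surely; this version takes the values zero and one
    everywhere, so that [b ^+ 2 = b] holds pointwise. *)
Let b i : T -> R := \1_(hit i).

Let bb i w : b i w ^+ 2 = b i w.
Proof. by rewrite /b indicE; case: (_ \in _); rewrite ?expr1n ?expr0n. Qed.

Let b_block i : bmeas G [set inr i]%SET (b i).
Proof.
apply: bmeas_indic; apply: sub_sigma_algebra; exists (fun w => B w i i) => //.
by exists [set 1] => //; exact: measurable_set1.
Qed.

Let ob_block f i : obsfun f -> bmeas G [set inl i]%SET (ob f i).
Proof. by move=> mf; apply: bmeas1 => A mA; exact: (ob_datameas (i := i)). Qed.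

Let b_om i : om G idx [set i]%SET (b i).
Proof.
have S : ([set inr i] : {set 'I_n + 'I_n})%SET \subset obsblock idx [set i]%SET.
  by apply/fintype.subsetP => x; rewrite !inE => /eqP ->; rewrite /= inE.
exact: bmeas_sub S (@b_block i).
Qed.

Let ob_om f (i : 'I_n) : obsfun f -> om G idx [set i]%SET (ob f i).
Proof.
move=> mf; have S : ([set inl i] : {set 'I_n + 'I_n})%SET \subset obsblock idx [set i]%SET.
  by apply/fintype.subsetP => x; rewrite !inE => /eqP ->; rewrite /= inE.
exact: bmeas_sub S (@ob_block f i mf).
Qed.

Let b_ob f (i : 'I_n) : obsfun f -> indep2 P (b i) (ob f i).
Proof.
move=> mf; apply: (bmeas_indep piG indG _ (@b_block i) (@ob_block f i mf)) => x.
by rewrite !inE => /eqP ->.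
Qed.

Let b_itg i : itg P (b i). Proof. exact: itg_indic. Qed.

Let Eb i : Ex P (b i) = q. Proof. by rewrite Ex_indic// B1. Qed.

Definition bzeta f (i : 'I_n) (w : T) : R := b i w * ob f i w.

Let bzeta_om f i : obsfun f -> om G idx [set i]%SET (bzeta f i).
Proof. by move=> mf; apply: omM; [exact: b_om|exact: ob_om]. Qed.

Let bzeta_Ex f i : obsfun f -> itg P (ob f 0) -> itg P (bzeta f i) /\ Ex P (bzeta f i) = q * Ex P (ob f 0).
Proof.
move=> mf f0; have [fi fE] := ob_law my mX law i mf f0.
by have [h1 h2] := ExM (b_ob i mf) (b_itg i) fi; split => //; rewrite h2 Eb fE.
Qed.

(** Since [b] is an indicator, [g] passes through it; every such moment of a sampled term is then
    [q] times the moment of an observation. *)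
Let bzeta_comp (g : R -> R) f i : g 0 = 0 -> forall w, g (bzeta f i w) = bzeta (fun u v => g (f u v)) i w.
Proof.
move=> g0 w; rewrite /bzeta /b indicE; case: (_ \in _); rewrite ?mul1r//.
by rewrite !mul0r.
Qed.

Let bzeta_L2 f i : obsfun f -> L2 P (ob f 0) -> L2 P (bzeta f i) /\
  Ex P (fun w => bzeta f i w ^+ 2) = q * Ex P (fun w => ob f 0 w ^+ 2).
Proof.
move=> mf f2; have [h1 h2] := bzeta_Ex i (obsfunX 2 mf) f2.2.
have E w : bzeta f i w ^+ 2 = bzeta (fun u v => f u v ^+ 2) i w.
  by rewrite (@bzeta_comp (fun x => x ^+ 2))// expr0n.
split; last by rewrite (eq_Ex P E).
split; first exact: (om_meas piG (@bzeta_om f i mf)).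
by apply: eq_itg h1 => w; rewrite E.
Qed.

Lemma bernoulli_mean_var f : obsfun f -> L2 P (ob f 0) ->
  L2 P (fun w => \sum_(i < n) (bzeta f i w - q * Ex P (ob f 0))) /\
  Ex P (fun w => (\sum_(i < n) (bzeta f i w - q * Ex P (ob f 0))) ^+ 2) <=
    m%:R * Ex P (fun w => ob f 0 w ^+ 2).
Proof.
move=> mf f2; set a := q * Ex P (ob f 0).
have z2 i := bzeta_L2 i mf f2.
have zE i : Ex P (bzeta f i) = a := (bzeta_Ex i mf (L2_itg f2)).2.
have c2 i : L2 P (fun w => bzeta f i w - a) := L2B (z2 i).1 (L2_cst P a).
have c0 i : Ex P (fun w => bzeta f i w - a) = 0.
  by rewrite (ExB (L2_itg (z2 i).1) (itg_cst P a)) Ex_cst zE subrr.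
have com i : om G idx [set i]%SET (fun w => bzeta f i w - a).
  by apply: omD; [exact: bzeta_om|exact: om_cst].
have [h1 h2] : L2 P (fun w => \sum_(i < n) (bzeta f i w - a)) /\
    Ex P (fun w => (\sum_(i < n) (bzeta f i w - a)) ^+ 2) = \sum_(i < n) Ex P (fun w => (bzeta f i w - a) ^+ 2).
  apply: (@Ex_sqr_sum _ _ _ P 'I_n (index_enum 'I_n) (fun i w => bzeta f i w - a)) => //.
    exact: index_enum_uniq.
  move=> i l _ _ il.
  have ind : indep2 P (fun w => bzeta f i w - a) (fun w => bzeta f l w - a).
    by apply: (om_indep piG indG _ (com i) (com l)) => k; rewrite !inE => /eqP ->.
  by rewrite (ExM ind (L2_itg (c2 i)) (L2_itg (c2 l))).2 c0 mul0r.
split=> //; rewrite h2.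
apply: (@le_trans _ _ (\sum_(i < n) q * Ex P (fun w => ob f 0 w ^+ 2))).
  apply: ler_sum => i _; rewrite -(z2 i).2 -{1}(zE i) Ex_sqr_center; last exact: (z2 i).1.
  by rewrite gerBl sqr_ge0.
rewrite sumr_const card_ord -[leLHS]mulr_natl mulrA /q mulrCA mulfV ?mulr1//.
by rewrite pnatr_eq0 -lt0n.
Qed.

(** Each summand has variance [v / n], so the squared variances add up to [v ^+ 2 / n], while the
    remainders carry the factor [n * q = m]. *)
Lemma bernoulli_clt f (c v : R) : obsfun f -> L2 P (ob f 0) -> Ex P (ob f 0) = 0 ->
  v = Ex P (fun w => ob f 0 w ^+ 2) ->
  `|Ex P (fun w => cos ((Num.sqrt m%:R)^-1 * (\sum_(i < n) bzeta f i w) + c)) - expR (- (v / 2)) * cos c| <=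
  4 * (m%:R * Ex P (fun w => tail2 ((Num.sqrt m%:R)^-1 * ob f 0 w))) + v ^+ 2 / n%:R.
Proof.
move=> mf f2 f0 vE; set r := (Num.sqrt m%:R)^-1.
have m0' : (0 : R) < m%:R by rewrite ltr0n.
have n0' : (0 : R) < n%:R by rewrite ltr0n.
have r2 : r ^+ 2 = m%:R^-1 by rewrite exprVn sqr_sqrtr// ltW.
(* [clt_inequality] indexes its summands by all naturals; beyond the sample they are set to zero. *)
pose xi k w := if insub k is Some i then r * bzeta f i w else 0.
pose A k : {set 'I_n} := if insub k is Some i then [set i]%SET else finset.set0.
have xiE (i : 'I_n) : xi i = fun w => r * bzeta f i w by apply/funext => w; rewrite /xi valK.
have AE (i : 'I_n) : A i = [set i]%SET by rewrite /A valK.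
have z2 i := bzeta_L2 i mf f2.
have x2 k : (k < n)%N -> L2 P (xi k).
  by move=> kn; rewrite (xiE (Ordinal kn)); apply: L2Z; exact: (z2 _).1.
have x0 k : (k < n)%N -> Ex P (xi k) = 0.
  move=> kn; rewrite (xiE (Ordinal kn)) (ExZ _ (L2_itg (z2 _).1)).
  by rewrite (bzeta_Ex _ mf (L2_itg f2)).2 f0 !mulr0.
have omx k : (k < n)%N -> om G idx (A k) (xi k).
  move=> kn; rewrite (xiE (Ordinal kn)) (AE (Ordinal kn)).
  by apply: omM; [exact: om_cst|exact: bzeta_om].
have disj j k : (j < k)%N -> {in A j, forall i, i \notin A k}.
  move=> jk i; rewrite /A; case: insubP => [i1 _ e1|_]; last by rewrite inE.
  case: insubP => [i2 _ e2|_]; last by rewrite !inE.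
  rewrite !inE => /eqP ->; apply/eqP => e12.
  by move: jk; rewrite -e1 -e2 e12 ltnn.
have := @clt_inequality _ _ _ P n xi c x2 x0 (blocks_indep piG indG omx disj).
have sE (k : 'I_n) : Ex P (fun w => xi k w ^+ 2) = v / n%:R.
  rewrite xiE (@eq_Ex _ _ _ _ _ (fun w => m%:R^-1 * bzeta f k w ^+ 2)); last by move=> w; rewrite exprMn r2.
  rewrite (ExZ _ (z2 k).1.2) (z2 k).2 /q -vE.
  by field; rewrite !gt_eqF.
have tE (k : 'I_n) : Ex P (fun w => tail2 (xi k w)) = q * Ex P (fun w => tail2 (r * ob f 0 w)).
  rewrite xiE; pose g x := tail2 (r * x).
  have g0 : g 0 = 0 by rewrite /g mulr0 /tail2 normr0 !expr0n minxx.
  have mg : measurable_fun setT g.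
    have mr : measurable_fun setT (fun x : R => r * x) by exact: measurable_funM.
    by apply: measurable_minr; apply: measurable_funX => //; exact: measurableT_comp.
  rewrite (eq_Ex P (bzeta_comp f k g0)) (bzeta_Ex k (obsfun_comp mg mf) _).2//.
  by apply: (itg_tail2 (f := fun w => r * ob f 0 w)); exact: L2Z.
have S1 : \sum_(k < n) Ex P (fun w => xi k w ^+ 2) = v.
  rewrite (eq_bigr (fun=> v / n%:R)); last by move=> k _; exact: sE.
  by rewrite sumr_const card_ord -[LHS]mulr_natl; field; rewrite gt_eqF.
have S2 : \sum_(k < n) (4 * Ex P (fun w => tail2 (xi k w)) + (Ex P (fun w => xi k w ^+ 2)) ^+ 2) =
    4 * (m%:R * Ex P (fun w => tail2 (r * ob f 0 w))) + v ^+ 2 / n%:R.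
  rewrite (eq_bigr (fun=> 4 * (q * Ex P (fun w => tail2 (r * ob f 0 w))) + (v / n%:R) ^+ 2)); last first.
    by move=> k _; rewrite tE sE.
  by rewrite sumr_const card_ord -[LHS]mulr_natl /q; field; rewrite gt_eqF.
rewrite S1 S2.
rewrite (@eq_Ex _ _ _ _ (fun w => cos (\sum_(i < n) xi i w + c)) (fun w => cos (r * (\sum_(i < n) bzeta f i w) + c)))//.
move=> w; rewrite mulr_sumr; congr (cos (_ + _)).
by apply: eq_bigr => i _; rewrite xiE.
Qed.

(** The null event on which some diagonal entry is neither zero nor one; the exact formulas for Gram
    matrix and score hold off it. *)
Let bad : set T := \big[setU/set0]_(i < n) (~` (hit i `|` [set w | B w i i = 0])).

Lemma bernoulli_bad : measurable bad /\ P bad = 0%E.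
Proof.
have m0i i : measurable [set w | B w i i = 0].
  rewrite (_ : [set w | _] = (fun w => B w i i) @^-1` [set 0])//.
  by rewrite -[X in measurable X]setTI; exact: mB.
have mU i : measurable (hit i `|` [set w | B w i i = 0]) by exact: measurableU.
have P0 i : P (~` (hit i `|` [set w | B w i i = 0])) = 0%E.
  rewrite probability_setC// measureU//; last first.
    by apply/seteqP; split => // w [/= ->] /eqP; rewrite oner_eq0.
  rewrite [X in (1 - (X + _))%E]B1 [X in (1 - (_ + X))%E]B0 -EFinD addrC subrK.
  by rewrite subrr.
by apply: null_bigsetU => i; split; [exact: measurableC|exact: P0].
Qed.

Let goodE i w : ~ bad w -> B w i i = b i w.
Proof.
move=> nb; rewrite /b indicE.
have [h1|h1] := pselect (B w i i = 1); first by rewrite mem_set//.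
rewrite memNset//; apply: contrapT => h0; apply: nb.
by rewrite /bad (bigD1 i)//=; left => -[].
Qed.

Let BX w (i : 'I_n) (A : 'M[R]_(n, p)) j : (B w *m A) i j = B w i i * A i j.
Proof.
rewrite mxE (bigD1 i)//= big1 ?addr0// => k ki.
by rewrite offdiag ?mul0r// eq_sym.
Qed.

Let Bx w (i : 'I_n) (A : 'cV[R]_n) : (B w *m A) i 0 = B w i i * A i 0.
Proof.
rewrite mxE (bigD1 i)//= big1 ?addr0// => k ki.
by rewrite offdiag ?mul0r// eq_sym.
Qed.

Lemma bernoulli_gram w j k : ~ bad w ->
  gram (Num.sqrt (n%:R / m%:R) *: B w) (Xmat X n w) j k =
  m%:R^-1 * \sum_(i < n) bzeta (fun _ v => v j * v k) i w.
Proof.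
move=> nb; set r := Num.sqrt _.
have r2 : r * r = n%:R / m%:R by rewrite -expr2 sqr_sqrtr// divr_ge0.
have n0' : (n%:R : R) != 0 by rewrite pnatr_eq0 -lt0n.
have m0' : (m%:R : R) != 0 by rewrite pnatr_eq0 -lt0n.
rewrite /gram -!scalemxAl !mxE !mulr_sumr; apply: eq_bigr => i _.
rewrite mxE [X in _ * (X * _)]mxE [X in _ * (_ * X)]mxE !BX !goodE// !mxE /bzeta.
rewrite -[in RHS](bb i w) /ob.
have -> : r * (b i w * X i j w) * (r * (b i w * X i k w)) = (r * r) * (b i w ^+ 2 * (X i j w * X i k w)) by ring.
by rewrite r2; field; rewrite n0' m0'.
Qed.

Lemma bernoulli_score w j : ~ bad w ->
  score m (Num.sqrt (n%:R / m%:R) *: B w) (Xmat X n w) (errv y X beta0 n w) j 0 =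
  (Num.sqrt m%:R)^-1 * \sum_(i < n) bzeta (fun u v => errf beta0 u v * v j) i w.
Proof.
move=> nb; set r := Num.sqrt (n%:R / m%:R); set s := Num.sqrt m%:R.
have r2 : r * r = n%:R / m%:R by rewrite -expr2 sqr_sqrtr// divr_ge0.
have s2 : m%:R = s ^+ 2 by rewrite sqr_sqrtr.
have s0 : s != 0 by rewrite gt_eqF// sqrtr_gt0 ltr0n.
have n0' : (n%:R : R) != 0 by rewrite pnatr_eq0 -lt0n.
rewrite /score -!scalemxAl -/s !mxE !mulr_sumr; apply: eq_bigr => i _.
rewrite mxE [X in _ * (X * _)]mxE [X in _ * (_ * X)]mxE BX Bx !goodE// errvE !mxE /bzeta.
rewrite -[in RHS](bb i w) /ob.
have -> : r * (b i w * X i j w) * (r * (b i w * errf beta0 (y i w) (X i ^~ w))) =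
  (r * r) * (b i w ^+ 2 * (errf beta0 (y i w) (X i ^~ w) * X i j w)) by ring.
by rewrite r2 s2; field; rewrite n0' s0.
Qed.

End bernoulli_sampling.

Section null_tail.
Context {d : measure_display} {T : measurableType d} {R : realType}.
Variable P : probability T R.

Lemma Ex_dominated (F : nat -> T -> R) (g : T -> R) :
  (forall n, measurable_fun setT (F n)) -> itg P g -> (forall n w, `|F n w| <= g w) ->
  (forall w, F ^~ w @ \oo --> (0 : R)) -> (fun n => Ex P (F n)) @ \oo --> (0 : R).
Proof.
move=> mF gi Fg F0.
have Fi n : itg P (F n) by exact: itg_dom gi.
have [||||| _ _] := @dominated_convergence _ _ _ P setT measurableT (fun n w => (F n w)%:E) (fun=> 0%E) (fun w => (g w)%:E).
- by move=> n; apply/measurable_EFinP; exact: mF.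
- exact: measurable_cst.
- by apply: aeW => w _; apply: cvg_EFin; [exact: nearW|exact: F0].
- exact: gi.
- by apply: aeW => w n0 _; rewrite /= lee_fin.
rewrite integral0.
rewrite (_ : [sequence _]_n = fun n => (Ex P (F n))%:E); last first.
  by apply/funext => n; rewrite /= itgP.
by move/fine_cvg.
Qed.

(** Dominated convergence with two moments only: the quadratic side of [tail2] gives the dominating
    function [f ^+ 2], the cubic side gives pointwise decay like [m ^ (-1/2)]. *)
Lemma tail2_scale_cvg (f : T -> R) (m : nat -> nat) : L2 P f ->
  (forall M : nat, \forall n \near \oo, (M <= m n)%N) ->
  (fun n => (m n)%:R * Ex P (fun w => tail2 ((Num.sqrt (m n)%:R)^-1 * f w))) @ \oo --> (0 : R).
Proof.
move=> f2 minf.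
pose F n w := (m n)%:R * tail2 ((Num.sqrt (m n)%:R)^-1 * f w).
have mF n : measurable_fun setT (F n).
  apply: measurable_funM => //.
  exact: itg_meas (itg_tail2 (L2Z _ f2)).
have s2 k : (Num.sqrt k%:R : R) ^+ 2 = k%:R by rewrite sqr_sqrtr.
have Fb n w : `|F n w| <= f w ^+ 2.
  rewrite /F ger0_norm ?mulr_ge0 ?tail2_ge0//.
  apply: le_trans (ler_wpM2l _ (tail2_sqr _)) _ => //.
  rewrite exprMn exprVn s2 mulrA; have [->|k0] := eqVneq ((m n)%:R : R) 0.
    by rewrite mul0r mul0r sqr_ge0.
  by rewrite mulfV// mul1r.
have F0 w : F ^~ w @ \oo --> (0 : R).
  apply/cvgrPdist_le => e e0.
  pose K := `|f w| ^+ 3 / e.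
  have K0 : 0 <= K by rewrite divr_ge0 ?(ltW e0)// exprn_ge0.
  near=> n.
  have hm : (Num.bound (K ^+ 2) < m n)%N by near: n; exact: minf.
  have m1 : (0 : R) < (m n)%:R by rewrite ltr0n (leq_ltn_trans _ hm).
  have s0 : (0 : R) < Num.sqrt (m n)%:R by rewrite sqrtr_gt0.
  have hK : K <= Num.sqrt (m n)%:R.
    rewrite -(@ler_pXn2r _ 2)// ?nnegrE ?(ltW s0)// s2 ltW//.
    apply: lt_trans (archi_boundP (sqr_ge0 K)) _; by rewrite ltr_nat.
  rewrite sub0r normrN /F ger0_norm ?mulr_ge0 ?tail2_ge0//.
  apply: le_trans (ler_wpM2l _ (tail2_cube _)) _ => //.
  rewrite normrM normfV exprMn (ger0_norm (ltW s0)) -{1}s2.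
  rewrite (_ : _ * _ = `|f w| ^+ 3 / Num.sqrt (m n)%:R); last by field; rewrite gt_eqF.
  by rewrite ler_pdivrMr// mulrC -ler_pdivrMr.
have E : (fun n => (m n)%:R * Ex P (fun w => tail2 ((Num.sqrt (m n)%:R)^-1 * f w))) = (fun n => Ex P (F n)).
  by apply/funext => n; rewrite /F ExZ//; exact: itg_tail2 (L2Z _ f2).
by rewrite E; exact: Ex_dominated mF f2.2 Fb F0.
Unshelve. all: end_near. Qed.

End null_tail.

Section quadratic_forms.
Context {d : measure_display} {T : measurableType d} {R : realType}.
Variables (P : probability T R) (p : nat).

Lemma quad_form_Ex (a : 'cV[R]_p) (g : 'I_p -> T -> R) : (forall j, L2 P (g j)) ->
  (a^T *m (\matrix_(j, k) Ex P (fun w => g j w * g k w)) *m a) 0 0 =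
  Ex P (fun w => (\sum_j a j 0 * g j w) ^+ 2).
Proof.
move=> g2; have gi j k : itg P (fun w => g j w * g k w) by exact: L2M.
rewrite (@eq_Ex _ _ _ _ _ (fun w => \sum_k \sum_j (a j 0 * a k 0) * (g j w * g k w))); last first.
  move=> w; rewrite expr2 mulr_sumr; apply: eq_bigr => k _; rewrite mulr_suml.
  by apply: eq_bigr => j _; ring.
rewrite Ex_sum; last by move=> k _; apply: itg_sum => j _; exact: itgZ.
rewrite mxE; apply: eq_bigr => k _; rewrite Ex_sum; last by move=> j _; exact: itgZ.
rewrite mxE mulr_suml; apply: eq_bigr => j _; rewrite ExZ// !mxE; ring.
Qed.

Lemma dot_invmx_sym (S V : 'M[R]_p) (t : 'cV[R]_p) : S^T = S ->
  t^T *m (invmx S *m V *m invmx S) *m t = (invmx S *m t)^T *m V *m (invmx S *m t).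
Proof. by move=> sS; rewrite trmx_mul trmx_inv sS !mulmxA. Qed.

Lemma dot_invmx_score (S : 'M[R]_p) (t s : 'cV[R]_p) : S^T = S ->
  (t^T *m (invmx S *m s)) 0 0 = \sum_j (invmx S *m t) j 0 * s j 0.
Proof.
move=> sS; have -> : t^T *m (invmx S *m s) = (invmx S *m t)^T *m s.
  by rewrite trmx_mul trmx_inv sS mulmxA.
by rewrite mxE; apply: eq_bigr => j _; rewrite [X in X * _]mxE.
Qed.

End quadratic_forms.

Section sample_sizes.
Context {R : realType}.

Lemma eventually_sizes (m : nat -> nat) : (forall M : nat, \forall n \near \oo, (M <= m n)%N) ->
  (fun n => (m n)%:R / n%:R : R) @ \oo --> (0 : R) ->
  \forall n \near \oo, [/\ (0 < n)%N, (0 < m n)%N & (m n <= n)%N].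
Proof.
move=> minf /cvgrPdist_le/(_ _ ltr01) mn; near=> n.
have n0 : (0 < n)%N by near: n; exists 1%N.
split => //; first by near: n; exact: minf.
have : `|0 - (m n)%:R / n%:R : R| <= 1 by near: n.
by rewrite sub0r normrN ger0_norm// ler_pdivrMr ?ltr0n// mul1r ler_nat.
Unshelve. all: end_near. Qed.

Lemma cvg_Vm (m : nat -> nat) (c : R) : (forall M : nat, \forall n \near \oo, (M <= m n)%N) ->
  (fun n => c / (m n)%:R) @ \oo --> (0 : R).
Proof.
move=> minf; apply/cvgrPdist_le => e e0; near=> n.
have hm : (Num.bound (`|c| / e) < m n)%N by near: n; exact: minf.
have m0 : (0 : R) < (m n)%:R by rewrite ltr0n (leq_ltn_trans _ hm).
rewrite sub0r normrN normrM normfV (ger0_norm (ltW m0)).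
rewrite ler_pdivrMr// mulrC -ler_pdivrMr// ltW//.
apply: lt_trans (archi_boundP _) _; first by rewrite divr_ge0 ?(ltW e0).
by rewrite ltr_nat.
Unshelve. all: end_near. Qed.

End sample_sizes.

(** * The limit law under Bernoulli sampling *)

Section bernoulli_limit.
Context {d : measure_display} {T : measurableType d} {R : realType}.
Variables (P : probability T R) (p : nat).
Variables (y : nat -> T -> R) (X : nat -> 'I_p -> T -> R) (beta0 : 'cV[R]_p) (m : nat -> nat).
Hypothesis my : forall i, measurable_fun setT (y i).
Hypothesis mX : forall i j, measurable_fun setT (X i j).
Hypothesis law : forall i, same_law_vec P (y i) (X i) (y 0%N) (X 0%N).
Hypothesis ind : mutually_independent P (fun i : nat => [set y i] `|` [set X i j | j in [set: 'I_p]]).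
Hypothesis y4 : (\int[P]_w ((y 0%N w) ^+ 4)%:E < +oo)%E.
Hypothesis X4 : (\int[P]_w ((\sum_j (X 0%N j w) ^+ 2) ^+ 2)%:E < +oo)%E.
Hypothesis minf : forall M : nat, \forall n \near \oo, (M <= m n)%N.
Hypothesis mn0 : (fun n => (m n)%:R / n%:R : R) @ \oo --> (0 : R).
Hypothesis eX0 : forall j, Ex P (ob y X (fun u v => errf beta0 u v * v j) 0) = 0.
Local Notation ob := (ob y X).
Local Notation er := (errf beta0).

Let Sxx : 'M[R]_p := \matrix_(j, k) Ex P (ob (fun _ v => v j * v k) 0).
Let Omega : 'M[R]_p := \matrix_(j, k) Ex P (ob (fun u v => er u v ^+ 2 * v j * v k) 0).
Hypothesis uS : Sxx \in unitmx.

Let Ssym : Sxx^T = Sxx.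
Proof.
apply/matrixP => j k; rewrite !mxE; apply: eq_Ex => w; exact: mulrC.
Qed.

Variable B : forall n, T -> 'M[R]_(n, n).
Hypothesis HB : forall n, (m n <= n)%N ->
  (forall i j, measurable_fun setT (fun w => B n w i j)) /\
  (forall w (i j : 'I_n), i != j -> B n w i j = 0) /\
  (forall i : 'I_n,
     P [set w | B n w i i = 1] = ((m n)%:R / n%:R : R)%:E /\
     P [set w | B n w i i = 0] = (1 - (m n)%:R / n%:R : R)%:E) /\
  mutually_independent P
    (fun a : 'I_n + 'I_n => match a with
       | inl i => [set y i] `|` [set X i j | j in [set: 'I_p]]
       | inr k => [set fun w => B n w k k]
       end).

Let Pi n w : 'M[R]_n := Num.sqrt (n%:R / (m n)%:R) *: B n w.
Let bz n f i := bzeta y X (B n) f i.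

Let repr n : (0 < n)%N -> (0 < m n)%N -> (m n <= n)%N ->
  exists N : set T, [/\ measurable N, P N = 0%E & forall w, ~ N w ->
    (forall j k, gram (Pi n w) (Xmat X n w) j k = (m n)%:R^-1 * \sum_(i < n) bz (fun _ v => v j * v k) i w) /\
    (forall j, score (m n) (Pi n w) (Xmat X n w) (errv y X beta0 n w) j 0 =
       (Num.sqrt (m n)%:R)^-1 * \sum_(i < n) bz (fun u v => er u v * v j) i w)].
Proof.
move=> n0 m0 mn; have [mB [dB [lB _]]] := HB mn.
have [h1 h2] := bernoulli_bad mB (fun i => (lB i).1) (fun i => (lB i).2).
eexists; split; [exact: h1|exact: h2|move=> w nw; split => [j k|j]].
  exact: bernoulli_gram.
exact: bernoulli_score.
Qed.

Let gram_limit : cvp_mx P (fun n w => gram (Pi n w) (Xmat X n w)) Sxx.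
Proof.
move=> j k; pose f := fun (_ : R) (v : 'I_p -> R) => v j * v k.
have mf : obsfun f := obsfun_XX j k; have f2 : L2 P (ob f 0) := L2_XX y mX X4 j k.
pose D n w := (m n)%:R^-1 * \sum_(i < n) bz f i w.
apply: (@cvp_off _ _ _ _ D).
  move=> e e0; near=> n.
  have [n0 m0 mn] : [/\ (0 < n)%N, (0 < m n)%N & (m n <= n)%N].
    by near: n; exact: eventually_sizes minf mn0.
  have [N [mN N0 NE]] := repr n0 m0 mn.
  exists N => //; split; first by rewrite N0 ltW.
  by move=> w /NE[-> _].
rewrite mxE; apply: cvp_L2 (cvg_Vm (Ex P (fun w => ob f 0 w ^+ 2)) minf).
near=> n.
have [n0 m0 mn] : [/\ (0 < n)%N, (0 < m n)%N & (m n <= n)%N].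
  by near: n; exact: eventually_sizes minf mn0.
have [mB [dB [lB iB]]] := HB mn.
have [h1 h2] := bernoulli_mean_var my mX law n0 mB (fun i => (lB i).1) iB mf f2.
have n0' : (n%:R : R) != 0 by rewrite pnatr_eq0 -lt0n.
have m0' : ((m n)%:R : R) != 0 by rewrite pnatr_eq0 -lt0n.
have E w : D n w - Ex P (ob f 0) = (m n)%:R^-1 * \sum_(i < n) (bzeta y X (B n) f i w - (m n)%:R / n%:R * Ex P (ob f 0)).
  rewrite sumrB sumr_const card_ord mulrBr; congr (_ - _).
  by rewrite -[in RHS]mulr_natl; field; rewrite n0' m0'.
split; first by apply: eq_L2 (L2Z (m n)%:R^-1 h1) => w; rewrite E.
rewrite (eq_Ex P (fun w => congr1 (fun x => x ^+ 2) (E w))).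
rewrite (@eq_Ex _ _ _ _ _ (fun w => ((m n)%:R^-1) ^+ 2 * (\sum_(i < n) (bzeta y X (B n) f i w - (m n)%:R / n%:R * Ex P (ob f 0))) ^+ 2)); last first.
  by move=> w; rewrite exprMn.
rewrite (ExZ _ h1.2).
apply: (le_trans (ler_wpM2l (sqr_ge0 _) h2)).
by rewrite le_eqVlt; apply/orP; left; apply/eqP; field.
Unshelve. all: end_near. Qed.

Let score_bip j : bip P (fun n w => score (m n) (Pi n w) (Xmat X n w) (errv y X beta0 n w) j 0).
Proof.
pose f := fun u (v : 'I_p -> R) => er u v * v j.
have mf : obsfun f := obsfun_eX beta0 j; have f2 : L2 P (ob f 0) := L2_eX beta0 my mX y4 X4 j.
pose D n w := (Num.sqrt (m n)%:R)^-1 * \sum_(i < n) bz f i w.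
have bD : bip P D.
  apply: (@bip_L2 _ _ _ _ _ (Ex P (fun w => ob f 0 w ^+ 2))).
  near=> n.
  have [n0 m0 mn] : [/\ (0 < n)%N, (0 < m n)%N & (m n <= n)%N].
    by near: n; exact: eventually_sizes minf mn0.
  have [mB [dB [lB iB]]] := HB mn.
  have [h1 h2] := bernoulli_mean_var my mX law n0 mB (fun i => (lB i).1) iB mf f2.
  have E w : D n w = (Num.sqrt (m n)%:R)^-1 * \sum_(i < n) (bzeta y X (B n) f i w - (m n)%:R / n%:R * Ex P (ob f 0)).
    by rewrite /D eX0 mulr0; under [in RHS]eq_bigr do rewrite subr0.
  split; first by apply: eq_L2 (L2Z _ h1) => w; rewrite E.
  rewrite (eq_Ex P (fun w => congr1 (fun x => x ^+ 2) (E w))).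
  rewrite (@eq_Ex _ _ _ _ _ (fun w => ((Num.sqrt (m n)%:R)^-1) ^+ 2 * (\sum_(i < n) (bzeta y X (B n) f i w - (m n)%:R / n%:R * Ex P (ob f 0))) ^+ 2)); last first.
    by move=> w; rewrite exprMn.
  rewrite (ExZ _ h1.2) exprVn sqr_sqrtr//.
  rewrite mulrC ler_pdivrMr ?ltr0n//.
  by apply: (le_trans h2); rewrite mulrC.
move=> e e0.
have e2 : 0 < e / 2 by rewrite divr_gt0.
have [K K0 hK] := bD _ e2; exists K => //.
near=> n.
have [n0 m0 mn] : [/\ (0 < n)%N, (0 < m n)%N & (m n <= n)%N].
  by near: n; exact: eventually_sizes minf mn0.
have [N [mN N0 NE]] := repr n0 m0 mn.
have h1 : off P (e / 2) (fun w => `|D n w| <= K) by near: n.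
have h2 : off P (e / 2) (fun w => ~ N w) by exists N => //; split => //; rewrite N0 ltW.
apply: off_imp (off_and h1 h2) => [|w [w1 /NE[_ ->]]]; [lra|exact: w1].
Unshelve. all: end_near. Qed.

Lemma bernoulli_normal :
  cvg_dist_normal P (fun n w => Num.sqrt (m n)%:R *:
    (beta_sk (Pi n w) (Xmat X n w) (yvec y n w) - beta_ols (Xmat X n w) (yvec y n w)))
    (invmx Sxx *m Omega *m invmx Sxx).
Proof.
have e2 j := L2_eX beta0 my mX y4 X4 j.
have VE t : (t^T *m (invmx Sxx *m Omega *m invmx Sxx) *m t) 0 0 =
    Ex P (fun w => ob (fun u v => linf (invmx Sxx *m t) u v * er u v) 0 w ^+ 2).
  rewrite dot_invmx_sym// (_ : Omega = \matrix_(j, k) Ex P (fun w => ob (fun u v => er u v * v j) 0 w * ob (fun u v => er u v * v k) 0 w)); last first.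
    by apply/matrixP => j k; rewrite !mxE; apply: eq_Ex => w; rewrite /ob; ring.
  rewrite quad_form_Ex//; apply: eq_Ex => w; congr (_ ^+ 2).
  by rewrite /ob /linf mulr_suml; apply: eq_bigr => j _; ring.
have mPi : \forall n \near \oo, mmx (Pi n).
  near=> n.
  have [n0 m0 mn] : [/\ (0 < n)%N, (0 < m n)%N & (m n <= n)%N].
    by near: n; exact: eventually_sizes minf mn0.
  have [mB _] := HB mn.
  by move=> i j; under eq_fun do rewrite mxE; exact: measurable_funM.
apply: (@regression_clt _ _ _ P p y X beta0 m my mX Sxx) => //.
- by move=> t; rewrite VE; apply: Ex_ge0 => w; exact: sqr_ge0.
- exact: cvp_gram_ols.
- by move=> i; exact: cvp_score_ols.
move=> t c; pose a := invmx Sxx *m t.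
(* Cramer-Wold reduction: the linear form of the score along [t] is a scaled sum of sampled copies
   of this scalar function. *)
pose f := fun u v => linf a u v * er u v.
have mf : obsfun f by apply: obsfunM; [exact: obsfun_lin|exact: obsfun_err].
have f2 : L2 P (ob f 0) := L4M (L4_lin0 y mX X4 a) (L4_err0 beta0 my mX y4 X4).
have f0 : Ex P (ob f 0) = 0.
  rewrite (@eq_Ex _ _ _ _ _ (fun w => \sum_j a j 0 * ob (fun u v => er u v * v j) 0 w)); last first.
    by move=> w; rewrite /ob /f /linf mulr_suml; apply: eq_bigr => j _; ring.
  rewrite Ex_sum; last by move=> j _; apply: itgZ; exact: L2_itg.
  by rewrite big1// => j _; rewrite ExZ ?eX0 ?mulr0//; exact: L2_itg.
set v := (t^T *m _ *m t) 0 0.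
have vE : v = Ex P (fun w => ob f 0 w ^+ 2) by exact: VE.
have lim : (fun n => 4 * ((m n)%:R * Ex P (fun w => tail2 ((Num.sqrt (m n)%:R)^-1 * ob f 0 w))) + v ^+ 2 / n%:R) @ \oo --> (0 : R).
  rewrite -[X in _ --> X](addr0 0) -[X in _ --> X + _](mulr0 4).
  apply: cvgD; last exact: cvg_cinv.
  by apply: cvgM; [exact: cvg_cst|exact: tail2_scale_cvg].
apply/cvgrPdist_le => e e0.
move/cvgrPdist_le/(_ _ e0): lim => lim.
near=> n.
have [n0 m0 mn] : [/\ (0 < n)%N, (0 < m n)%N & (m n <= n)%N].
  by near: n; exact: eventually_sizes minf mn0.
have [mB [dB [lB iB]]] := HB mn.
have := bernoulli_clt my mX law n0 m0 mB (fun i => (lB i).1) iB c mf f2 f0 vE.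
have [N [mN N0 NE]] := repr n0 m0 mn.
set F := fun w => cos ((Num.sqrt (m n)%:R)^-1 * \sum_(i < n) bzeta y X (B n) f i w + c).
set H := fun w => cos ((t^T *m (invmx Sxx *m score (m n) (Pi n w) (Xmat X n w) (errv y X beta0 n w))) 0 0 + c).
have FH w : ~ N w -> H w = F w.
  move=> /NE[_ sE]; rewrite /H /F dot_invmx_score//; congr (cos (_ + _)).
  under eq_bigr do rewrite sE mulrCA.
  rewrite -mulr_sumr; congr (_ * _).
  under eq_bigr do rewrite mulr_sumr.
  rewrite exchange_big; apply: eq_bigr => i _.
  rewrite /bz /bzeta /ob /f /linf mulr_suml mulr_sumr; apply: eq_bigr => j _; rewrite -/a; ring.
have mPn : mmx (Pi n) by near: n.
have iH : itg P H.
  apply: itg_cos.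
  apply: measurable_funD => //.
  have mcst q r (A : 'M[R]_(q, r)) : mmx (fun _ : T => A) by move=> i j.
  have mXm : mmx (Xmat X n) by move=> i j; under eq_fun do rewrite mxE; exact: mX.
  have mev : mmx (errv y X beta0 n).
    move=> i j; rewrite (ord1 j); under eq_fun do rewrite errvE.
    by apply: ob_meas => //; exact: obsfun_err.
  apply: (mmx_mul (mcst _ _ t^T)); apply: (mmx_mul (mcst _ _ _)).
  move=> i j; under eq_fun do rewrite mxE; apply: measurable_funM => //.
  by do ?[apply: mmx_mul|apply: mmx_tr].
have iF : itg P F.
  apply: itg_cos.
  apply: measurable_funD => //; apply: measurable_funM => //; apply: measurable_sum => i.
  apply: measurable_funM; last exact: ob_meas.
  apply: measurable_indic; rewrite (_ : [set w | _] = (fun w => B n w i i) @^-1` [set 1])//.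
  by rewrite -[X in measurable X]setTI; exact: mB.
have [_ <-] := itg_ae_eq (itg_meas iH) mN N0 (fun w nw => esym (FH w nw)) iF.
move=> h; rewrite distrC; apply: (le_trans h).
apply: (le_trans (ler_norm _)); rewrite -normrN -sub0r.
by near: n.
Unshelve. all: end_near. Qed.

End bernoulli_limit.

(** * Cross terms of a sign-weighted product *)

Section cross_terms.
Context {d : measure_display} {T : measurableType d} {R : realType}.
Variables (P : probability T R) (n : nat) (I : finType) (G : I -> set (set T)).
Variable idx : I -> option 'I_n.
Hypothesis piG : pi_family G.
Hypothesis indG : indep_family P G.
Local Notation om := (om G idx).
Local Notation supp r := [set i in r]%SET.

Definition ssum (u : 'I_n -> T -> R) (r : seq 'I_n) (w : T) : R := \sum_(i <- r) u i w.

Lemma ssum_cons u i r w : ssum u (i :: r) w = u i w + ssum u r w.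
Proof. exact: big_cons. Qed.

Lemma Ex_block (i : 'I_n) (r : seq 'I_n) (f g : T -> R) : i \notin r ->
  om [set i]%SET f -> om (supp r) g -> itg P f -> itg P g ->
  itg P (fun w => f w * g w) /\ Ex P (fun w => f w * g w) = Ex P f * Ex P g.
Proof.
move=> ir of1 og; apply: ExM; apply: (om_indep piG indG _ of1 og) => k.
by rewrite !inE => /eqP ->.
Qed.

Lemma L4_block (i : 'I_n) (r : seq 'I_n) (f g : T -> R) : i \notin r ->
  om [set i]%SET f -> om (supp r) g -> L4 P f -> L4 P g -> L4 P (fun w => f w * g w).
Proof.
move=> ir of1 og; apply: indep2_L4; apply: (om_indep piG indG _ of1 og) => k.
by rewrite !inE => /eqP ->.
Qed.

Lemma om_cons (i : 'I_n) r (f : T -> R) : om (supp r) f -> om (supp (i :: r)) f.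
Proof. by apply: om_sub => k; rewrite !inE => ->; rewrite orbT. Qed.

Lemma om_head (i : 'I_n) r (f : T -> R) : om [set i]%SET f -> om (supp (i :: r)) f.
Proof. by apply: om_sub => k; rewrite !inE => ->. Qed.

Lemma itg4 (a b c e : T -> R) : L4 P a -> L4 P b -> L4 P c -> L4 P e ->
  itg P (fun w => a w * b w * (c w * e w)).
Proof. by move=> a4 b4 c4 e4; exact: L2M (L4M a4 b4) (L4M c4 e4). Qed.

Lemma itg3 (a b c : T -> R) : L4 P a -> L4 P b -> L4 P c ->
  itg P (fun w => a w * (b w * c w)).
Proof.
move=> a4 b4 c4; apply: eq_itg (itg4 a4 b4 c4 (L4_cst P 1)) => w.
by rewrite mulr1 mulrA.
Qed.

Lemma omX A k (f : T -> R) : om A f -> om A (fun w => f w ^+ k).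
Proof. by move=> of1; exact: measurable_funX. Qed.

Section centered_family.
Variable u : 'I_n -> T -> R.
Hypothesis uom : forall i, om [set i]%SET (u i).

Lemma om_ssum r : om (supp r) (ssum u r).
Proof.
elim: r => [|i r IH].
  rewrite (_ : ssum u [::] = fun=> 0); first exact: om_cst.
  by apply/funext => w; rewrite /ssum big_nil.
rewrite (_ : ssum u (i :: r) = fun w => u i w + ssum u r w); last first.
  by apply/funext => w; rewrite ssum_cons.
by apply: omD; [exact: om_head|exact: om_cons].
Qed.

Hypothesis u4 : forall i, L4 P (u i).

Lemma L4_ssum r : L4 P (ssum u r).
Proof. exact: (@L4_sum _ _ _ _ _ r xpredT u (fun i _ => u4 i)). Qed.

Hypothesis u1 : forall i, Ex P (u i) = 0.
Hypothesis u3 : forall i, Ex P (fun w => u i w ^+ 3) = 0.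
Variables (k2 k4 : R).
Hypothesis uE2 : forall i, Ex P (fun w => u i w ^+ 2) = k2.
Hypothesis uE4 : forall i, Ex P (fun w => u i w ^+ 4) <= k4.
Hypothesis k24 : k2 ^+ 2 <= k4.

Lemma Ex_ssum_sqr r : uniq r -> Ex P (fun w => ssum u r w ^+ 2) = (size r)%:R * k2.
Proof.
elim: r => [_|i r IH /= /andP[ir ur]].
  rewrite mul0r (@eq_Ex _ _ _ _ _ (fun=> 0)) ?Ex_cst// => w.
  by rewrite /ssum big_nil expr0n.
have [c1 c2] := Ex_block ir (@uom i) (@om_ssum r) (L4_itg (u4 i)) (L4_itg (L4_ssum r)).
rewrite (@eq_Ex _ _ _ _ _ (fun w => (u i w ^+ 2 + 2 * (u i w * ssum u r w)) + ssum u r w ^+ 2)); last first.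
  by move=> w; rewrite ssum_cons; ring.
have i2 := (L4_L2 (u4 i)).2; have r2 := (L4_L2 (L4_ssum r)).2.
rewrite (ExD (itgD i2 (itgZ 2 c1)) r2) (ExD i2 (itgZ 2 c1)) ExZ// c2 u1 mul0r mulr0 addr0 uE2 IH//.
by rewrite -natr1; ring.
Qed.

(** Terms odd in the new summand vanish. The increment [6 * N * k2 ^+ 2 + k4] is at most
    [k4 * (6 * N + 1)], which fits under [3 * k4 * ((N + 1) ^+ 2 - N ^+ 2)]. *)
Lemma Ex_ssum_pow4 r : uniq r -> Ex P (fun w => ssum u r w ^+ 4) <= 3 * k4 * (size r)%:R ^+ 2.
Proof.
elim: r => [_|i r IH /= /andP[ir ur]].
  rewrite expr0n mulr0 (@eq_Ex _ _ _ _ _ (fun=> 0)) ?Ex_cst// => w.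
  by rewrite /ssum big_nil expr0n.
set Z := ssum u r; have Z4 : L4 P Z := L4_ssum r; have x4 := u4 i.
have oZ : om (supp r) Z := @om_ssum r.
have [a1 a2] := Ex_block ir (@uom i) (omX 3 oZ) (L4_itg x4) (itg3 Z4 Z4 Z4).
have [b1 b2] := Ex_block ir (omX 2 (@uom i)) (omX 2 oZ) (L4_L2 x4).2 (L4_L2 Z4).2.
have [c1 c2] := Ex_block ir (omX 3 (@uom i)) oZ (itg3 x4 x4 x4) (L4_itg Z4).
rewrite (@eq_Ex _ _ _ _ _ (fun w => Z w ^+ 4 + (4 * (u i w * Z w ^+ 3) + (6 * (u i w ^+ 2 * Z w ^+ 2) + (4 * (u i w ^+ 3 * Z w) + u i w ^+ 4))))); last first.
  by move=> w; rewrite ssum_cons -/Z; ring.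
have j1 := itgD (itgZ 4 c1) x4.2; have j2 := itgD (itgZ 6 b1) j1; have j3 := itgD (itgZ 4 a1) j2.
rewrite (ExD Z4.2 j3) (ExD (itgZ 4 a1) j2) (ExD (itgZ 6 b1) j1) (ExD (itgZ 4 c1) x4.2) !ExZ//.
rewrite a2 b2 c2 u1 u3 !mul0r !mulr0 !add0r uE2 Ex_ssum_sqr//.
have h1 := IH ur; have h2 := uE4 i; have h3 : 0 <= k4 by apply: le_trans k24; exact: sqr_ge0.
rewrite -/Z in h1; rewrite -natr1.
have N0 : (0 : R) <= (size r)%:R by [].
have h4 : k2 ^+ 2 * (size r)%:R <= k4 * (size r)%:R by rewrite ler_wpM2r.
nra.
Qed.

End centered_family.

Definition centered (f : T -> R) := itg P f /\ Ex P f = 0.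

Lemma centeredD f g : centered f -> centered g -> centered (fun w => f w + g w).
Proof. by move=> [f1 f0] [g1 g0]; split; [exact: itgD|rewrite ExD// f0 g0 addr0]. Qed.

Lemma centeredZ k f : centered f -> centered (fun w => k * f w).
Proof. by move=> [f1 f0]; split; [exact: itgZ|rewrite ExZ// f0 mulr0]. Qed.

Lemma centered_block (i : 'I_n) (r : seq 'I_n) (f g : T -> R) : i \notin r ->
  om [set i]%SET f -> om (supp r) g -> centered f -> itg P g -> centered (fun w => f w * g w).
Proof.
move=> ir of1 og [fi f0] gi; have [h1 h2] := Ex_block ir of1 og fi gi.
by split => //; rewrite h2 f0 mul0r.
Qed.

Lemma Ex_centered f g : itg P f -> centered g -> Ex P (fun w => f w + g w) = Ex P f.
Proof. by move=> fi [gi g0]; rewrite ExD// g0 addr0. Qed.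

Section paired_families.
Variables x z : 'I_n -> T -> R.

(* The cross terms [\sum_(i != l) x i * z l] over the indices listed in [r]. *)
Definition cross (r : seq 'I_n) (w : T) : R :=
  ssum x r w * ssum z r w - \sum_(i <- r) x i w * z i w.

Lemma cross_nil w : cross [::] w = 0.
Proof. by rewrite /cross /ssum !big_nil mul0r subr0. Qed.

Lemma cross_cons i r w :
  cross (i :: r) w = cross r w + (x i w * ssum z r w + z i w * ssum x r w).
Proof. by rewrite /cross !ssum_cons big_cons; ring. Qed.

Hypothesis xom : forall i, om [set i]%SET (x i).
Hypothesis zom : forall i, om [set i]%SET (z i).

Lemma om_cross r : om (supp r) (cross r).
Proof.
elim: r => [|i r IH].
  rewrite (_ : cross [::] = fun=> 0); first exact: om_cst.
  by apply/funext => w; rewrite cross_nil.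
rewrite (_ : cross (i :: r) = fun w => cross r w + (x i w * ssum z r w + z i w * ssum x r w)); last first.
  by apply/funext => w; rewrite cross_cons.
apply: omD; first exact: om_cons.
by apply: omD; apply: omM; do ?[exact: om_head|apply: om_cons; exact: om_ssum].
Qed.

Hypothesis x4 : forall i, L4 P (x i).
Hypothesis z4 : forall i, L4 P (z i).
Hypothesis x1 : forall i, Ex P (x i) = 0.
Hypothesis z1 : forall i, Ex P (z i) = 0.

Let X4 r : L4 P (ssum x r) := L4_ssum x4 r.
Let Z4 r : L4 P (ssum z r) := L4_ssum z4 r.

Lemma L4_cross r : uniq r -> L4 P (cross r).
Proof.
elim: r => [_|i r IH /= /andP[ir ur]].
  by apply: eq_L4 (L4_cst P 0) => w; rewrite cross_nil.
apply: (@eq_L4 _ _ _ _ (fun w => cross r w + (x i w * ssum z r w + z i w * ssum x r w))).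
  by move=> w; rewrite cross_cons.
apply: L4D; first exact: IH.
by apply: L4D; apply: (L4_block ir) => //; exact: om_ssum.
Qed.

Variables (A B C : R).
Hypothesis xx : forall i, Ex P (fun w => x i w ^+ 2) = A.
Hypothesis zz : forall i, Ex P (fun w => z i w ^+ 2) = B.
Hypothesis xz : forall i, Ex P (fun w => x i w * z i w) = C.

Lemma Ex_ssumM r : uniq r -> Ex P (fun w => ssum x r w * ssum z r w) = (size r)%:R * C.
Proof.
elim: r => [_|i r IH /= /andP[ir ur]].
  rewrite mul0r (@eq_Ex _ _ _ _ _ (fun=> 0)) ?Ex_cst// => w.
  by rewrite /ssum big_nil mul0r.
have h1 : centered (fun w => x i w * ssum z r w).
  by apply: (centered_block ir) => //; [exact: om_ssum|split => //; exact: L4_itg|exact: L4_itg].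
have h2 : centered (fun w => z i w * ssum x r w).
  by apply: (centered_block ir) => //; [exact: om_ssum|split => //; exact: L4_itg|exact: L4_itg].
rewrite (@eq_Ex _ _ _ _ _ (fun w => (x i w * z i w + ssum x r w * ssum z r w) + (x i w * ssum z r w + z i w * ssum x r w))); last first.
  by move=> w; rewrite !ssum_cons; ring.
have i1 := L2M (L4_L2 (x4 i)) (L4_L2 (z4 i)); have i2 := L2M (L4_L2 (X4 r)) (L4_L2 (Z4 r)).
rewrite (Ex_centered (itgD i1 i2) (centeredD h1 h2)) (ExD i1 i2) xz IH//.
by rewrite -natr1; ring.
Qed.

(** A new element adds [2 * N * (A * B + C ^+ 2)]: two products of second moments and twice the
    mixed one. The factor [N * (N - 1)] counts ordered pairs. *)
Lemma Ex_cross_sqr r : uniq r ->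
  Ex P (fun w => cross r w ^+ 2) = (size r)%:R * ((size r)%:R - 1) * (A * B + C ^+ 2).
Proof.
elim: r => [_|i r IH /= /andP[ir ur]].
  rewrite !mul0r (@eq_Ex _ _ _ _ _ (fun=> 0)) ?Ex_cst// => w.
  by rewrite cross_nil expr0n.
have Q4 := L4_cross ur; have Q2 := L4_L2 Q4.
have oQ := @om_cross r; have oX := @om_ssum _ xom r; have oZ := @om_ssum _ zom r.
have i2 := L4_L2 (X4 r); have j2 := L4_L2 (Z4 r).
have h1 : centered (fun w => x i w * (cross r w * ssum z r w)).
  apply: (centered_block ir) => //; [exact: omM|split => //; exact: L4_itg|exact: L2M].
have h2 : centered (fun w => z i w * (cross r w * ssum x r w)).
  apply: (centered_block ir) => //; [exact: omM|split => //; exact: L4_itg|exact: L2M].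
have [a1 a2] := Ex_block ir (omX 2 (@xom i)) (omX 2 oZ) (L4_L2 (x4 i)).2 j2.2.
have [b1 b2] := Ex_block ir (omX 2 (@zom i)) (omX 2 oX) (L4_L2 (z4 i)).2 i2.2.
have [c1 c2] := Ex_block ir (omM (@xom i) (@zom i)) (omM oX oZ) (L2M (L4_L2 (x4 i)) (L4_L2 (z4 i))) (L2M i2 j2).
rewrite (@eq_Ex _ _ _ _ _ (fun w => (cross r w ^+ 2 + (x i w ^+ 2 * ssum z r w ^+ 2 + (z i w ^+ 2 * ssum x r w ^+ 2 + 2 * (x i w * z i w * (ssum x r w * ssum z r w))))) + (2 * (x i w * (cross r w * ssum z r w)) + 2 * (z i w * (cross r w * ssum x r w))))); last first.
  by move=> w; rewrite cross_cons; ring.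
have k1 := itgD b1 (itgZ 2 c1); have k2 := itgD a1 k1.
rewrite (Ex_centered (itgD Q2.2 k2) (centeredD (centeredZ 2 h1) (centeredZ 2 h2))).
rewrite (ExD Q2.2 k2) (ExD a1 k1) (ExD b1 (itgZ 2 c1)) ExZ// a2 b2 c2 IH// xx zz xz Ex_ssumM//.
rewrite (Ex_ssum_sqr xom x4 x1 xx ur) (Ex_ssum_sqr zom z4 z1 zz ur).
by rewrite -natr1; ring.
Qed.

Lemma centered_cross r : uniq r -> centered (cross r).
Proof.
elim: r => [_|i r IH /= /andP[ir ur]].
  have -> : cross [::] = fun=> 0 by apply/funext => w; rewrite cross_nil.
  by split; [exact: itg_cst|rewrite Ex_cst].
have -> : cross (i :: r) = fun w => cross r w + (x i w * ssum z r w + z i w * ssum x r w).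
  by apply/funext => w; rewrite cross_cons.
apply: centeredD; first exact: IH.
by apply: centeredD; apply: (centered_block ir) => //; do ?[exact: om_ssum|split => //; exact: L4_itg|exact: L4_itg].
Qed.

Variable k4 : R.
Hypothesis xE4 : forall i, Ex P (fun w => x i w ^+ 4) <= k4.
Hypothesis zE4 : forall i, Ex P (fun w => z i w ^+ 4) <= k4.
Hypothesis A24 : A ^+ 2 <= k4.
Hypothesis B24 : B ^+ 2 <= k4.
Hypothesis x3 : forall i, Ex P (fun w => x i w ^+ 3) = 0.
Hypothesis z3 : forall i, Ex P (fun w => z i w ^+ 3) = 0.
Hypothesis x2z : forall i, Ex P (fun w => x i w * (x i w * z i w)) = 0.
Hypothesis xz2 : forall i, Ex P (fun w => x i w * (z i w * z i w)) = 0.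

Let k40 : 0 <= k4. Proof. by apply: le_trans A24; exact: sqr_ge0. Qed.

Let pow4D (a b : R) : (a + b) ^+ 4 <= 8 * (a ^+ 4 + b ^+ 4).
Proof.
have := sqr_ge0 (a - b); have := sqr_ge0 (a ^+ 2 - b ^+ 2).
have := sqr_ge0 (a + b); nra.
Qed.

(** With increment [D], the odd terms [Q ^+ 3 * D] and [Q * D ^+ 3] are centered because all first
    and third moments of a pair vanish. The mixed term is split by a weighted square into
    [3 / N * Q ^+ 4 + 3 * N * D ^+ 4]; as [D ^+ 4] has mean of order [N ^+ 2], the recursion is
    compatible with growth [N ^+ 4]. *)
Lemma Ex_cross_pow4 r : uniq r -> Ex P (fun w => cross r w ^+ 4) <= 192 * k4 ^+ 2 * (size r)%:R ^+ 4.
Proof.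
elim: r => [_|i r IH /= /andP[ir ur]].
  rewrite expr0n mulr0 (@eq_Ex _ _ _ _ _ (fun=> 0)) ?Ex_cst// => w.
  by rewrite cross_nil expr0n.
pose Q := cross r; pose X := ssum x r; pose Z := ssum z r.
have Q4 : L4 P Q := L4_cross ur; have aX4 : L4 P X := X4 r; have aZ4 : L4 P Z := Z4 r.
have oQ : om (supp r) Q := @om_cross r.
have oX : om (supp r) X := @om_ssum _ xom r; have oZ : om (supp r) Z := @om_ssum _ zom r.
pose D w := x i w * Z w + z i w * X w.
have D4 : L4 P D.
  by apply: L4D; [exact: L4_block ir (@xom i) oZ (x4 i) (Z4 r)|exact: L4_block ir (@zom i) oX (z4 i) (X4 r)].
have d1 : centered (x i) by split => //; exact: L4_itg.
have d2 : centered (z i) by split => //; exact: L4_itg.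
have d3 : centered (fun w => x i w ^+ 3) by split => //; exact: itg3.
have d4 : centered (fun w => z i w ^+ 3) by split => //; exact: itg3.
have d5 : centered (fun w => x i w * (x i w * z i w)) by split => //; exact: itg3.
have d6 : centered (fun w => x i w * (z i w * z i w)) by split => //; exact: itg3.
have odd : centered (fun w => 4 * (Q w ^+ 3 * D w) + 4 * (Q w * D w ^+ 3)).
  have o1 : centered (fun w => x i w * (Q w * Q w * (Q w * Z w))).
    apply: (centered_block ir) => //; last exact: itg4.
    by do ?[exact: oQ|exact: oZ|exact: oX|apply: omM].
  have o2 : centered (fun w => z i w * (Q w * Q w * (Q w * X w))).
    apply: (centered_block ir) => //; last exact: itg4.
    by do ?[exact: oQ|exact: oZ|exact: oX|apply: omM].
  have o3 : centered (fun w => x i w ^+ 3 * (Q w * Z w * (Z w * Z w))).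
    apply: (centered_block ir (omX 3 (@xom i))) => //; last exact: itg4.
    by do ?[exact: oQ|exact: oZ|exact: oX|apply: omM].
  have o4 : centered (fun w => x i w * (x i w * z i w) * (Q w * Z w * (Z w * X w))).
    apply: (centered_block ir (omM (@xom i) (omM (@xom i) (@zom i)))) => //; last exact: itg4.
    by do ?[exact: oQ|exact: oZ|exact: oX|apply: omM].
  have o5 : centered (fun w => x i w * (z i w * z i w) * (Q w * Z w * (X w * X w))).
    apply: (centered_block ir (omM (@xom i) (omM (@zom i) (@zom i)))) => //; last exact: itg4.
    by do ?[exact: oQ|exact: oZ|exact: oX|apply: omM].
  have o6 : centered (fun w => z i w ^+ 3 * (Q w * X w * (X w * X w))).
    apply: (centered_block ir (omX 3 (@zom i))) => //; last exact: itg4.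
    by do ?[exact: oQ|exact: oZ|exact: oX|apply: omM].
  have := centeredZ 4 (centeredD o1 (centeredD o2 (centeredD o3 (centeredD (centeredZ 3 o4) (centeredD (centeredZ 3 o5) o6))))).
  by congr centered; apply/funext => w; rewrite /D; ring.
have qd2 : itg P (fun w => Q w * Q w * (D w * D w)) by exact: itg4.
have E1 : Ex P (fun w => cross (i :: r) w ^+ 4) = Ex P (fun w => Q w ^+ 4 + (6 * (Q w * Q w * (D w * D w)) + D w ^+ 4)).
  have -> : (fun w => cross (i :: r) w ^+ 4) = fun w => (Q w ^+ 4 + (6 * (Q w * Q w * (D w * D w)) + D w ^+ 4)) + (4 * (Q w ^+ 3 * D w) + 4 * (Q w * D w ^+ 3)).
    by apply/funext => w; rewrite cross_cons -/(D w) -/(Q w); ring.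
  by apply: Ex_centered => //; exact: itgD Q4.2 (itgD (itgZ 6 qd2) D4.2).
rewrite E1.
set N : R := (size r)%:R.
have [a1 a2] := Ex_block ir (omX 4 (@xom i)) (omX 4 oZ) (x4 i).2 (Z4 r).2.
have [b1 b2] := Ex_block ir (omX 4 (@zom i)) (omX 4 oX) (z4 i).2 (X4 r).2.
(* The constant is 8 from convexity, times two summands, times 3 from [Ex_ssum_pow4]. The final 192
   is four times this, so that the new contribution fits into [(N + 1) ^+ 4 - N ^+ 4] beside
   [3 * N ^+ 3]. *)
have ED : Ex P (fun w => D w ^+ 4) <= 48 * k4 ^+ 2 * N ^+ 2.
  apply: (@le_trans _ _ (Ex P (fun w => 8 * (x i w ^+ 4 * Z w ^+ 4 + z i w ^+ 4 * X w ^+ 4)))).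
    apply: Ex_le => [||w]; [exact: D4.2|exact: itgZ (itgD a1 b1)|].
    by rewrite -!exprMn; exact: pow4D.
  rewrite (ExZ _ (itgD a1 b1)) (ExD a1 b1) a2 b2.
  have p1 := Ex_ssum_pow4 xom x4 x1 x3 xx xE4 A24 ur; have p2 := Ex_ssum_pow4 zom z4 z1 z3 zz zE4 B24 ur.
  have e0 (f : T -> R) : 0 <= Ex P (fun w => f w ^+ 4) by apply: Ex_ge0 => w; exact: exprn_even_ge0.
  have q1 := ler_pM (e0 (x i)) (e0 Z) (xE4 i) p2; have q2 := ler_pM (e0 (z i)) (e0 X) (zE4 i) p1.
  by rewrite -/N in q1 q2; lra.
(* The weight [3 / N] needs [N > 0]; without earlier elements [Q] is zero. *)
have [r0|r0] := eqVneq r [::].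
  rewrite (@eq_Ex _ _ _ _ _ (fun w => D w ^+ 4)); last first.
    by move=> w; rewrite /Q r0 cross_nil; ring.
  apply: (le_trans ED); rewrite /N r0 /= expr0n /= mulr0 expr1n mulr1.
  by rewrite mulr_ge0 ?sqr_ge0.
have N1 : 1 <= N by rewrite ler1n lt0n size_eq0.
have N0 : 0 < N by lra.
apply: (@le_trans _ _ (Ex P (fun w => (1 + 3 / N) * Q w ^+ 4 + (3 * N + 1) * D w ^+ 4))).
  apply: Ex_le => [||w].
  - exact: itgD Q4.2 (itgD (itgZ 6 qd2) D4.2).
  - exact: itgD (itgZ _ Q4.2) (itgZ _ D4.2).
  have : 0 <= 3 / N * (Q w ^+ 2 - N * D w ^+ 2) ^+ 2 by rewrite mulr_ge0 ?sqr_ge0// divr_ge0// ltW.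
  have -> : 3 / N * (Q w ^+ 2 - N * D w ^+ 2) ^+ 2 = 3 / N * Q w ^+ 4 + 3 * N * D w ^+ 4 - 6 * (Q w * Q w * (D w * D w)).
    by field; rewrite gt_eqF.
  lra.
rewrite (ExD (itgZ _ Q4.2) (itgZ _ D4.2)) !ExZ//; [|exact: D4.2|exact: Q4.2].
have h1 : (1 + 3 / N) * Ex P (fun w => Q w ^+ 4) <= (1 + 3 / N) * (192 * k4 ^+ 2 * N ^+ 4).
  apply: ler_wpM2l; last exact: IH.
  by rewrite addr_ge0// divr_ge0// ltW.
have h2 : (3 * N + 1) * Ex P (fun w => D w ^+ 4) <= (3 * N + 1) * (48 * k4 ^+ 2 * N ^+ 2).
  by apply: ler_wpM2l => //; lra.
apply: (le_trans (lerD h1 h2)).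
have -> : (size r).+1%:R = N + 1 :> R by rewrite -natr1.
have -> : (1 + 3 / N) * (192 * k4 ^+ 2 * N ^+ 4) = 192 * k4 ^+ 2 * (N ^+ 4 + 3 * N ^+ 3) by field; rewrite gt_eqF.
have -> : (3 * N + 1) * (48 * k4 ^+ 2 * N ^+ 2) = 192 * k4 ^+ 2 * ((3 * N + 1) * N ^+ 2 / 4) by field.
rewrite -mulrDr; apply: ler_wpM2l; first by rewrite mulr_ge0 ?sqr_ge0.
have N2 : 0 <= N ^+ 2 by exact: sqr_ge0.
have N3 : N ^+ 2 <= N ^+ 3 by rewrite [leRHS]exprS ler_peMl.
nra.
Qed.

End paired_families.

End cross_terms.

(** * Central limit bound for a fixed hash *)

Section buckets.
Context {d : measure_display} {T : measurableType d} {R : realType}.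
Variables (P : probability T R) (n m : nat) (I : finType) (G : I -> set (set T)).
Variable idx : I -> option 'I_n.
Hypothesis piG : pi_family G.
Hypothesis indG : indep_family P G.
Local Notation om := (om G idx).

Definition bucket (h : 'I_n -> 'I_m) (k : 'I_m) : seq 'I_n := [seq i <- enum 'I_n | h i == k].
Definition bsize (h : 'I_n -> 'I_m) (k : 'I_m) : R := (size (bucket h k))%:R.

Lemma uniq_bucket h k : uniq (bucket h k).
Proof. by rewrite filter_uniq// enum_uniq. Qed.

Lemma mem_bucket h k i : (i \in bucket h k) = (h i == k).
Proof. by rewrite mem_filter mem_enum andbT. Qed.

Lemma sum_bucket (V : nmodType) h k (F : 'I_n -> V) :
  \sum_(i <- bucket h k) F i = \sum_(i < n | h i == k) F i.
Proof. by rewrite big_filter big_enum_cond. Qed.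

Lemma bsizeE h k : bsize h k = \sum_(i < n) (h i == k)%:R.
Proof.
rewrite /bsize -sum1_size sum_bucket natr_sum big_mkcond.
by apply: eq_bigr => i _; case: (h i == k).
Qed.

Lemma sum_bsize h : \sum_(k < m) bsize h k = n%:R.
Proof.
under eq_bigr do rewrite bsizeE.
rewrite exchange_big (eq_bigr (fun=> 1)) ?sumr_const ?card_ord// => i _.
by rewrite (bigD1 (h i))//= eqxx big1 ?addr0// => k /negbTE; rewrite eq_sym => ->.
Qed.

Variables x z : 'I_n -> T -> R.
Hypothesis xom : forall i, om [set i]%SET (x i).
Hypothesis zom : forall i, om [set i]%SET (z i).
Hypothesis x4 : forall i, L4 P (x i).
Hypothesis z4 : forall i, L4 P (z i).
Hypothesis x1 : forall i, Ex P (x i) = 0.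
Hypothesis z1 : forall i, Ex P (z i) = 0.
Variables (A B C : R).
Hypothesis xx : forall i, Ex P (fun w => x i w ^+ 2) = A.
Hypothesis zz : forall i, Ex P (fun w => z i w ^+ 2) = B.
Hypothesis xz : forall i, Ex P (fun w => x i w * z i w) = C.
Let V := A * B + C ^+ 2.

Variable h : 'I_n -> 'I_m.
Let Q k := cross x z (bucket h k).

Let Q4 k : L4 P (Q k) := L4_cross piG indG xom zom x4 z4 (uniq_bucket h k).
Let QE k := Ex_cross_sqr piG indG xom zom x4 z4 x1 z1 xx zz xz (uniq_bucket h k).
Let Q0 k : Ex P (Q k) = 0 := (centered_cross piG indG xom zom x4 z4 x1 z1 (uniq_bucket h k)).2.

Let supp_disj j k : j != k -> {in [set i in bucket h j]%SET, forall i, i \notin [set i in bucket h k]%SET}.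
Proof. by move=> jk i; rewrite !inE !mem_bucket => /eqP ->. Qed.

Lemma cross_sum_sqr : 0 <= V -> L2 P (fun w => \sum_(k < m) Q k w) /\
  Ex P (fun w => (\sum_(k < m) Q k w) ^+ 2) <= V * \sum_(k < m) bsize h k ^+ 2.
Proof.
move=> V0.
have [h1 h2] : L2 P (fun w => \sum_(k < m) Q k w) /\
    Ex P (fun w => (\sum_(k < m) Q k w) ^+ 2) = \sum_(k < m) Ex P (fun w => Q k w ^+ 2).
  apply: (@Ex_sqr_sum _ _ _ P 'I_m (index_enum 'I_m) Q); first exact: index_enum_uniq.
    by move=> k _; exact: L4_L2.
  move=> j k _ _ jk.
  have ind := om_indep piG indG (supp_disj jk) (@om_cross _ _ _ _ _ _ _ _ _ xom zom (bucket h j))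
    (@om_cross _ _ _ _ _ _ _ _ _ xom zom (bucket h k)).
  by rewrite (ExM ind (L4_itg (Q4 j)) (L4_itg (Q4 k))).2 Q0 mul0r.
split => //; rewrite h2 mulr_sumr; apply: ler_sum => k _.
rewrite QE -/(bsize h k) mulrC; apply: ler_wpM2l => //.
by rewrite mulrBr mulr1 -expr2 gerBl.
Qed.

Variable k4 : R.
Hypothesis xE4 : forall i, Ex P (fun w => x i w ^+ 4) <= k4.
Hypothesis zE4 : forall i, Ex P (fun w => z i w ^+ 4) <= k4.
Hypothesis A24 : A ^+ 2 <= k4.
Hypothesis B24 : B ^+ 2 <= k4.
Hypothesis x3 : forall i, Ex P (fun w => x i w ^+ 3) = 0.
Hypothesis z3 : forall i, Ex P (fun w => z i w ^+ 3) = 0.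
Hypothesis x2z : forall i, Ex P (fun w => x i w * (x i w * z i w)) = 0.
Hypothesis xz2 : forall i, Ex P (fun w => x i w * (z i w * z i w)) = 0.

Lemma Ex_sqr_le (f : T -> R) : L2 P f -> Ex P f ^+ 2 <= Ex P (fun w => f w ^+ 2).
Proof.
move=> f2; rewrite -subr_ge0 -Ex_sqr_center//.
by apply: Ex_ge0 => w; exact: sqr_ge0.
Qed.

(** A completed square trades the third moment for second and fourth ones. The free parameter
    replaces a square root, so the later averages over the hash stay linear in the bucket
    moments. *)
Lemma Ex_tail2_le (f : T -> R) (eta : R) : L4 P f -> 0 < eta ->
  2 * Ex P (fun w => tail2 (f w)) <= eta * Ex P (fun w => f w ^+ 2) + eta^-1 * Ex P (fun w => f w ^+ 4).
Proof.
move=> f4 e0; have f2 := L4_L2 f4; have it := itg_tail2 f2.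
rewrite -ExZ// -(ExZ _ f2.2) -(ExZ _ f4.2) -(ExD (itgZ _ f2.2) (itgZ _ f4.2)).
apply: Ex_le => [||w]; [exact: itgZ|exact: itgD (itgZ _ f2.2) (itgZ _ f4.2)|].
have t := tail2_cube (f w); set a := `|f w| in t *.
have -> : f w ^+ 2 = a ^+ 2 by rewrite real_normK// num_real.
have -> : f w ^+ 4 = a ^+ 4 by rewrite (exprM _ 2 2) -[f w ^+ 2]real_normK ?num_real// -exprM.
have : 0 <= eta * (a - eta^-1 * a ^+ 2) ^+ 2 by rewrite mulr_ge0 ?sqr_ge0// ltW.
have -> : eta * (a - eta^-1 * a ^+ 2) ^+ 2 = eta * a ^+ 2 + eta^-1 * a ^+ 4 - 2 * a ^+ 3.
  by field; rewrite gt_eqF.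
lra.
Qed.

(** The hash [h] is a deterministic parameter here. The three errors are the second moments weighted
    by [eta], the fourth moments from remainders and squared variances, and the deviation of the
    total variance from [V], passed through the Lipschitz exponential. *)
Lemma bucket_clt (rho eta c : R) : 0 <= V -> 0 < eta ->
  `|Ex P (fun w => cos (rho * (\sum_(k < m) Q k w) + c)) - expR (- (V / 2)) * cos c| <=
  2 * eta * V * (rho ^+ 2 * \sum_(k < m) bsize h k ^+ 2)
  + (2 / eta + 1) * (192 * k4 ^+ 2) * (rho ^+ 4 * \sum_(k < m) bsize h k ^+ 4)
  + V / 2 * `|rho ^+ 2 * (\sum_(k < m) bsize h k ^+ 2 - n%:R) - 1|.
Proof.
move=> V0 e0.
pose xi k w := if insub k is Some i then rho * Q i w else 0.
pose S k : {set 'I_n} := if insub k is Some j then [set i in bucket h j]%SET else finset.set0.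
have xiE (k : 'I_m) : xi k = fun w => rho * Q k w by apply/funext => w; rewrite /xi valK.
have SE (k : 'I_m) : S k = [set i in bucket h k]%SET by rewrite /S valK.
have xi4 (k : 'I_m) : L4 P (xi k) by rewrite xiE; exact: L4Z.
have x2 k : (k < m)%N -> L2 P (xi k) by move=> km; exact: L4_L2 (xi4 (Ordinal km)).
have x0 k : (k < m)%N -> Ex P (xi k) = 0.
  by move=> km; rewrite (xiE (Ordinal km)) (ExZ _ (L4_itg (Q4 _))) Q0 mulr0.
have omx k : (k < m)%N -> om (S k) (xi k).
  move=> km; rewrite (xiE (Ordinal km)) (SE (Ordinal km)).
  by apply: omM; [exact: om_cst|exact: om_cross].
have disj j k : (j < k)%N -> {in S j, forall i, i \notin S k}.
  move=> jk; rewrite /S; case: insubP => [i1 _ e1|_]; last by move=> i; rewrite inE.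
  case: insubP => [i2 _ e2|_ i]; last by rewrite !inE.
  by apply: supp_disj; apply/eqP => e12; move: jk; rewrite -e1 -e2 e12 ltnn.
have := @clt_inequality _ _ _ P m xi c x2 x0 (blocks_indep piG indG omx disj).
have s2 (k : 'I_m) : Ex P (fun w => xi k w ^+ 2) = rho ^+ 2 * (bsize h k * (bsize h k - 1) * V).
  rewrite xiE (@eq_Ex _ _ _ _ _ (fun w => rho ^+ 2 * Q k w ^+ 2)); last by move=> w; rewrite exprMn.
  by rewrite (ExZ _ (L4_L2 (Q4 k)).2) QE.
have s4 (k : 'I_m) : Ex P (fun w => xi k w ^+ 4) <= rho ^+ 4 * (192 * k4 ^+ 2 * bsize h k ^+ 4).
  rewrite xiE (@eq_Ex _ _ _ _ _ (fun w => rho ^+ 4 * Q k w ^+ 4)); last by move=> w; rewrite exprMn.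
  rewrite (ExZ _ (Q4 k).2); apply: ler_wpM2l; first exact: exprn_even_ge0.
  by apply: Ex_cross_pow4 => //; exact: uniq_bucket.
have Ssum : \sum_(k < m) Ex P (fun w => xi k w ^+ 2) = V * (rho ^+ 2 * (\sum_(k < m) bsize h k ^+ 2 - n%:R)).
  rewrite (eq_bigr (fun k => V * (rho ^+ 2 * (bsize h k ^+ 2 - bsize h k)))); last first.
    by move=> k _; rewrite s2; ring.
  by rewrite -mulr_sumr -mulr_sumr sumrB sum_bsize.
rewrite Ssum; set tau := rho ^+ 2 * _.
have bnd : \sum_(k < m) (4 * Ex P (fun w => tail2 (xi k w)) + Ex P (fun w => xi k w ^+ 2) ^+ 2) <=
    2 * eta * V * (rho ^+ 2 * \sum_(k < m) bsize h k ^+ 2)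
    + (2 / eta + 1) * (192 * k4 ^+ 2) * (rho ^+ 4 * \sum_(k < m) bsize h k ^+ 4).
  rewrite !mulr_sumr -big_split /=; apply: ler_sum => k _.
  have t1 := Ex_tail2_le (xi4 k) e0.
  have t2 := Ex_sqr_le (L4M (xi4 k) (xi4 k)).
  have e1 : Ex P (fun w => xi k w * xi k w) = Ex P (fun w => xi k w ^+ 2) by apply: eq_Ex => w; rewrite expr2.
  have e4 : Ex P (fun w => (xi k w * xi k w) ^+ 2) = Ex P (fun w => xi k w ^+ 4).
    by apply: eq_Ex => w; ring.
  rewrite e1 e4 in t2.
  have t3 := s4 k.
  have t4 : Ex P (fun w => xi k w ^+ 2) <= V * (rho ^+ 2 * bsize h k ^+ 2).
    rewrite s2 (_ : _ * V = V * (bsize h k * (bsize h k - 1))); last by rewrite mulrC.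
    rewrite mulrCA; apply: ler_wpM2l => //; apply: ler_wpM2l; first exact: sqr_ge0.
    by rewrite mulrBr mulr1 -expr2 gerBl.
  have t5 : eta * Ex P (fun w => xi k w ^+ 2) <= eta * (V * (rho ^+ 2 * bsize h k ^+ 2)).
    by apply: ler_wpM2l => //; exact: ltW.
  have t6 : (2 / eta + 1) * Ex P (fun w => xi k w ^+ 4) <= (2 / eta + 1) * (rho ^+ 4 * (192 * k4 ^+ 2 * bsize h k ^+ 4)).
    by apply: ler_wpM2l => //; rewrite addr_ge0// divr_ge0// ltW.
  lra.
have lip : `|expR (- (V * tau / 2)) * cos c - expR (- (V / 2)) * cos c| <= V / 2 * `|tau - 1|.
  rewrite -mulrBl normrM; apply: (@le_trans _ _ (`|expR (- (V * tau / 2)) - expR (- (V / 2))|)).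
    by rewrite ler_piMr// ler_norml cos_geN1 cos_le1.
  have tau0 : 0 <= V * tau / 2.
    rewrite divr_ge0// -Ssum sumr_ge0// => k _; apply: Ex_ge0 => w; exact: sqr_ge0.
  apply: (le_trans (expRN_lip tau0 _)); first by rewrite divr_ge0.
  have -> : V * tau / 2 - V / 2 = V / 2 * (tau - 1) by ring.
  by rewrite normrM ger0_norm// divr_ge0.
move=> clt; have E : Ex P (fun w => cos (\sum_(k < m) xi k w + c)) = Ex P (fun w => cos (rho * (\sum_(k < m) Q k w) + c)).
  apply: eq_Ex => w; rewrite mulr_sumr; congr (cos (_ + _)).
  by apply: eq_bigr => k _; rewrite xiE.
rewrite E in clt.
apply: (le_trans (ler_distD (expR (- (V * tau / 2)) * cos c) _ _)).
exact: lerD (le_trans clt bnd) lip.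
Qed.

End buckets.

(** * Averages over the hash *)

Section hash_averages.
Context {R : realType}.
Variables (n m : nat).
Hypothesis n0 : (0 < n)%N.
Hypothesis m0 : (0 < m)%N.
Local Notation hash := {ffun 'I_n -> 'I_m}.
Local Notation N h k := (bsize h k : R).

Let n0' : (n%:R : R) != 0. Proof. by rewrite pnatr_eq0 -lt0n. Qed.
Let m0' : (m%:R : R) != 0. Proof. by rewrite pnatr_eq0 -lt0n. Qed.

Definition avg (F : hash -> R) : R := m%:R ^- n * \sum_h F h.

Lemma avgD F1 F2 : avg (fun h => F1 h + F2 h) = avg F1 + avg F2.
Proof. by rewrite /avg big_split mulrDr. Qed.

Lemma avgZ c F : avg (fun h => c * F h) = c * avg F.
Proof. by rewrite /avg -mulr_sumr mulrCA. Qed.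

Lemma avg_sum (J : Type) (r : seq J) (p : pred J) (F : J -> hash -> R) :
  avg (fun h => \sum_(j <- r | p j) F j h) = \sum_(j <- r | p j) avg (F j).
Proof. by rewrite /avg exchange_big mulr_sumr. Qed.

Lemma le_avg F1 F2 : (forall h, F1 h <= F2 h) -> avg F1 <= avg F2.
Proof.
move=> F12; apply: ler_wpM2l; first by rewrite invr_ge0 exprn_ge0.
by apply: ler_sum => h _.
Qed.

Lemma eq_avg F1 F2 : F1 =1 F2 -> avg F1 = avg F2.
Proof. by move=> /funext ->. Qed.

Lemma norm_avg F : `|avg F| <= avg (fun h => `|F h|).
Proof.
rewrite /avg normrM ger0_norm ?invr_ge0 ?exprn_ge0//.
by apply: ler_wpM2l; [rewrite invr_ge0 exprn_ge0|exact: ler_norm_sum].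
Qed.

(** Independence of the coordinates of a uniform hash, here an instance of distributivity. *)
Lemma avg_prod (F : 'I_n -> 'I_m -> R) :
  avg (fun h => \prod_i F i (h i)) = \prod_i (m%:R^-1 * \sum_k F i k).
Proof.
by rewrite big_split /= prodr_const card_ord bigA_distr_bigA exprVn.
Qed.

Lemma avg_cst c : avg (fun=> c) = c.
Proof.
rewrite /avg sumr_const card_ffun !card_ord -[c *+ _]mulr_natl natrX mulKf//.
by rewrite expf_neq0.
Qed.

Let sum_eq (k : 'I_m) : \sum_a (a == k)%:R = 1 :> R.
Proof. by rewrite (bigD1 k)//= eqxx big1 ?addr0// => a /negbTE ->. Qed.

Lemma avg_pair (i l : 'I_n) k : i != l ->
  avg (fun h => (h i == k)%:R * (h l == k)%:R) = m%:R ^- 2.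
Proof.
move=> il; have li : l != i by rewrite eq_sym.
pose F j (a : 'I_m) : R := if (j == i) || (j == l) then (a == k)%:R else 1.
rewrite (@eq_avg _ (fun h => \prod_j F j (h j))); last first.
  move=> h; rewrite (bigD1 i)//= (bigD1 l)//= /F !eqxx orbT /= big1 ?mulr1// => j /andP[ji jl].
  by rewrite (negbTE ji) (negbTE jl).
rewrite avg_prod (bigD1 i)//= (bigD1 l)//= /F !eqxx orbT /= sum_eq mulr1.
rewrite big1 ?mulr1 ?exprVn ?expr2 ?invfM// => j /andP[ji jl].
by rewrite (negbTE ji) (negbTE jl) sumr_const card_ord mulVf.
Qed.

Lemma avg_single (i : 'I_n) k : avg (fun h => (h i == k)%:R) = m%:R^-1.
Proof.
pose F j (a : 'I_m) : R := if j == i then (a == k)%:R else 1.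
rewrite (@eq_avg _ (fun h => \prod_j F j (h j))); last first.
  move=> h; rewrite (bigD1 i)//= /F eqxx big1 ?mulr1// => j ji.
  by rewrite (negbTE ji).
rewrite avg_prod (bigD1 i)//= /F eqxx sum_eq mulr1 big1 ?mulr1// => j ji.
by rewrite (negbTE ji) sumr_const card_ord mulVf.
Qed.

Lemma avg_bsize_sqr : avg (fun h => \sum_k N h k ^+ 2) <= n%:R + n%:R ^+ 2 / m%:R.
Proof.
rewrite avg_sum.
have Ek (k : 'I_m) : avg (fun h => N h k ^+ 2) <= n%:R / m%:R + n%:R ^+ 2 / m%:R ^+ 2.
  rewrite (@eq_avg _ (fun h => \sum_i \sum_l (h i == k)%:R * (h l == k)%:R)); last first.
    by move=> h; rewrite bsizeE expr2 mulr_suml; apply: eq_bigr => i _; rewrite mulr_sumr.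
  rewrite avg_sum.
  apply: (@le_trans _ _ (\sum_(i < n) (m%:R^-1 + n%:R * m%:R ^- 2))); last first.
    by rewrite sumr_const card_ord -[leLHS]mulr_natl mulrDr mulrA -expr2.
  apply: ler_sum => i _; rewrite avg_sum (bigD1 i)//=.
  rewrite (@eq_avg _ (fun h => (h i == k)%:R)); last first.
    by move=> h; case: (h i == k); rewrite ?mulr1 ?mulr0.
  rewrite avg_single lerD2l (eq_bigr (fun=> m%:R ^- 2)); last first.
    by move=> l li; rewrite avg_pair// eq_sym.
  rewrite sumr_const -[leLHS]mulr_natl; apply: ler_wpM2r; first by rewrite invr_ge0 exprn_ge0.
  by rewrite ler_nat -[leqRHS](card_ord n) max_card.
apply: (le_trans (ler_sum _ (fun k _ => Ek k))).
rewrite sumr_const card_ord -[leLHS]mulr_natl le_eqVlt; apply/orP; left; apply/eqP.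
by field.
Qed.

Let bernoulli_ineq (x : R) k : 0 <= x -> k%:R * x <= (1 + x) ^+ k.
Proof.
move=> x0; suff h : 1 + k%:R * x <= (1 + x) ^+ k by apply: le_trans h; rewrite lerDr.
elim: k => [|k IH]; first by rewrite mul0r addr0 expr0.
rewrite exprS; apply: (@le_trans _ _ ((1 + x) * (1 + k%:R * x))).
  rewrite -natr1; have : 0 <= k%:R * (x * x) by rewrite !mulr_ge0.
  lra.
by apply: ler_wpM2l => //; rewrite addr_ge0.
Qed.

(* With [mu := n / m >= 1], [N <= mu (1 + 1 / mu) ^ N] and [(1 + 1 / mu) ^ 4 <= 1 + 15 / mu] turn the
   fourth moment into a product over the coordinates of the hash. *)
Lemma avg_bsize_pow4 : (m <= n)%N ->
  avg (fun h => \sum_k N h k ^+ 4) <= m%:R * ((n%:R / m%:R) ^+ 4 * expR 15).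
Proof.
move=> mn; set mu : R := n%:R / m%:R.
have m1 : (0 : R) < m%:R by rewrite ltr0n.
have n1 : (0 : R) < n%:R by rewrite ltr0n.
have mu1 : 1 <= mu by rewrite ler_pdivlMr// mul1r ler_nat.
have mu0 : 0 < mu by lra.
pose r := mu^-1.
have r0 : 0 <= r by rewrite invr_ge0 ltW.
have r1 : r <= 1 by rewrite invf_le1.
have r15 : (1 + r) ^+ 4 <= 1 + 15 * r.
  have rk k : r ^+ k.+1 <= r by rewrite -[leRHS]expr1 ler_wiXn2l.
  have -> : (1 + r) ^+ 4 = 1 + (4 * r + 6 * r ^+ 2 + 4 * r ^+ 3 + r ^+ 4) by ring.
  by move: (rk 1%N) (rk 2%N) (rk 3%N) => h2 h3 h4; lra.
rewrite avg_sum.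
have -> : m%:R * (mu ^+ 4 * expR 15) = \sum_(k < m) mu ^+ 4 * expR 15 :> R.
  by rewrite sumr_const card_ord mulr_natl.
apply: ler_sum => k _.
have NE (h : hash) : N h k ^+ 4 <= mu ^+ 4 * \prod_i (1 + 15 * r * (h i == k)%:R).
  have -> : \prod_i (1 + 15 * r * (h i == k)%:R) = (1 + 15 * r) ^+ size (bucket h k).
    rewrite (eq_bigr (fun i => if h i == k then 1 + 15 * r else 1)); last first.
      by move=> i _; case: ifP => _; rewrite ?mulr1// mulr0 addr0.
    rewrite -big_mkcond prodr_const; congr (_ ^+ _).
    by rewrite cardE /enum_mem /bucket !size_filter enumT.
  apply: (@le_trans _ _ (mu ^+ 4 * (1 + r) ^+ 4 ^+ size (bucket h k))).
    rewrite exprAC -exprMn lerXn2r ?nnegrE//; first by rewrite mulr_ge0 ?exprn_ge0 ?addr_ge0// ltW.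
    by rewrite mulrC -ler_pdivrMr// bernoulli_ineq.
  apply: ler_wpM2l; first by rewrite exprn_ge0// ltW.
  by apply: lerXn2r => //; rewrite nnegrE ?exprn_ge0 ?addr_ge0 ?mulr_ge0.
apply: (le_trans (le_avg NE)); rewrite avgZ.
have -> : avg (fun h => \prod_i (1 + 15 * r * (h i == k)%:R)) = \prod_(i < n) (m%:R^-1 * \sum_(a < m) (1 + 15 * r * (a == k)%:R)).
  exact: (avg_prod (fun _ a => 1 + 15 * r * (a == k)%:R)).
apply: ler_wpM2l; first by rewrite exprn_ge0// ltW.
(* Each coordinate hits bucket [k] with probability [m^-1], and [r / m = n^-1]; the product of the
   [n] factors is therefore at most [expR 15], uniformly in the sizes. *)
have F1 : m%:R^-1 * (\sum_(a < m) (1 + 15 * r * (a == k)%:R)) = 1 + 15 / n%:R.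
  rewrite big_split /= -mulr_sumr sum_eq sumr_const card_ord mulr1 /r /mu.
  by field; rewrite n0' m0'.
rewrite (eq_bigr (fun=> 1 + 15 / n%:R)); last by move=> i _; exact: F1.
rewrite prodr_const card_ord.
apply: (@le_trans _ _ (expR (15 / n%:R) ^+ n)).
  by apply: lerXn2r; rewrite ?nnegrE ?expR_ge0 ?expR_ge1Dx ?addr_ge0 ?divr_ge0.
by rewrite -expRM_natl mulrC divfK.
Qed.

(** The Cauchy bound gives the rescaled sum of squares [s >= 1], so the absolute deviation is at
    most [(s - 1) + m / n]. Its average then follows from the mean of [s] alone, and no variance of
    the bucket sizes has to be computed. *)
Lemma avg_bsize_dev :
  avg (fun h => `|(m%:R / n%:R ^+ 2) * (\sum_k N h k ^+ 2 - n%:R) - 1|) <= 2 * (m%:R / n%:R).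
Proof.
have m1 : (0 : R) < m%:R by rewrite ltr0n.
have n1 : (0 : R) < n%:R by rewrite ltr0n.
have mn0 : 0 < m%:R / n%:R ^+ 2 :> R by rewrite divr_gt0 ?exprn_gt0.
have cs (h : hash) : 1 <= m%:R / n%:R ^+ 2 * \sum_k N h k ^+ 2.
  have h1 : 0 <= \sum_k (N h k - n%:R / m%:R) ^+ 2 by apply: sumr_ge0 => k _; exact: sqr_ge0.
  have h2 : \sum_k (N h k - n%:R / m%:R) ^+ 2 = \sum_k N h k ^+ 2 - n%:R ^+ 2 / m%:R.
    rewrite (eq_bigr (fun k => N h k ^+ 2 - (2 * (n%:R / m%:R) * N h k - (n%:R / m%:R) ^+ 2))); last first.
      by move=> k _; ring.
    rewrite sumrB sumrB -mulr_sumr sum_bsize sumr_const card_ord -[(_ ^+ 2) *+ m]mulr_natl.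
    by congr (_ - _); field.
  rewrite h2 subr_ge0 in h1.
  have := ler_wpM2l (ltW mn0) h1; congr (_ <= _).
  by field; rewrite n0' m0'.
apply: (@le_trans _ _ (avg (fun h => m%:R / n%:R ^+ 2 * \sum_k N h k ^+ 2 + (m%:R / n%:R - 1)))).
  apply: le_avg => h; have := cs h; set s := _ * \sum_k _ => s1.
  have -> : m%:R / n%:R ^+ 2 * (\sum_k N h k ^+ 2 - n%:R) - 1 = s - m%:R / n%:R - 1.
    by rewrite mulrBr -/s; congr (_ - _ - _); field.
  have q0 : 0 < m%:R / n%:R :> R by rewrite divr_gt0.
  by rewrite ler_norml; apply/andP; split; lra.
rewrite avgD avg_cst avgZ.
have := ler_wpM2l (ltW mn0) avg_bsize_sqr.
have -> : m%:R / n%:R ^+ 2 * (n%:R + n%:R ^+ 2 / m%:R) = m%:R / n%:R + 1 :> R by field; rewrite n0' m0'.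
lra.
Qed.

End hash_averages.

Lemma bigsetUP {T : Type} (I : finType) (F : I -> set T) w :
  (\big[setU/set0]_i F i) w <-> exists i, F i w.
Proof.
rewrite -bigcup_seq; split=> [[i _ Fi]|[i Fi]]; first by exists i.
by exists i => //=; exact: mem_index_enum.
Qed.

Lemma bigsetIP {T : Type} (I : finType) (F : I -> set T) w :
  (\big[setI/setT]_i F i) w <-> forall i, F i w.
Proof.
rewrite -bigcap_seq; split=> [Fi i|Fi i _]; last exact: Fi.
by apply: Fi => /=; exact: mem_index_enum.
Qed.

(** * Countsketch *)

Section countsketch.
Context {d : measure_display} {T : measurableType d} {R : realType}.
Variables (P : probability T R) (p : nat).
Variables (y : nat -> T -> R) (X : nat -> 'I_p -> T -> R).
Hypothesis my : forall i, measurable_fun setT (y i).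
Hypothesis mX : forall i j, measurable_fun setT (X i j).
Hypothesis law : forall i, same_law_vec P (y i) (X i) (y 0%N) (X 0%N).
Local Notation ob := (ob y X).

Variables (n m : nat) (Pi : T -> 'M[R]_(m, n)).
Hypothesis m0 : (0 < m)%N.
Hypothesis mPi : forall i j, measurable_fun setT (fun w => Pi w i j).
Hypothesis lawPi : forall (k : 'I_m) (j : 'I_n) (s : R), (s = 1 \/ s = -1) ->
  P [set w | Pi w k j = s /\ forall k', k' != k -> Pi w k' j = 0] = ((2 * m%:R)^-1 : R)%:E.

Let F (a : 'I_n + 'I_n) : set (T -> R) := match a with
  | inl i => [set y i] `|` [set X i j | j in [set: 'I_p]]
  | inr j => [set fun w => Pi w k j | k in [set: 'I_m]]
  end.
Hypothesis indF : mutually_independent P F.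

Let mF a f : F a f -> measurable_fun setT f.
Proof. by case: a => [i [->|[j _ <-]]|j [k _ <-]]; [exact: my|exact: mX|exact: mPi]. Qed.

Let m0' : (m%:R : R) != 0. Proof. by rewrite pnatr_eq0 -lt0n. Qed.

Definition cell (k : 'I_m) (s : R) (j : 'I_n) : set T :=
  [set w | Pi w k j = s /\ forall k', k' != k -> Pi w k' j = 0].

Lemma sigma_cell k s j : sigma_gen (F (inr j)) (cell k s j).
Proof.
pose g : set (set T) := [set f @^-1` B | f in F (inr j) & B in [set B : set R | measurable B]].
have mg i (c : R) : @measurable _ (g_sigma_algebraType g) [set w | Pi w i j = c].
  by apply: sub_sigma_algebra; exists (fun w => Pi w i j); [exists i|exists [set c]; [exact: measurable_set1|]].
have -> : cell k s j = [set w | Pi w k j = s] `&` \bigcap_(k' in [set k' | k' != k]) [set w | Pi w k' j = 0] by [].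
apply: (@measurableI _ (g_sigma_algebraType g)) => //.
apply: (@fin_bigcap_measurable _ (g_sigma_algebraType g)) => [|k1 _]; [exact: finite_finset|exact: mg].
Qed.

Let mcell k s j : measurable (cell k s j).
Proof. exact: (sigma_gen_sub_measurable mF (@sigma_cell k s j)). Qed.

Let cell_inj k k' s s' j w : s != 0 -> cell k s j w -> cell k' s' j w -> k = k' /\ s = s'.
Proof.
move=> s0 [e1 z1] [e2 z2]; have [kk|kk] := eqVneq k k'.
  by split => //; rewrite -e1 -e2 kk.
by move: s0; rewrite -e1 z2 ?eqxx.
Qed.

Let Pcell k s j : s = 1 \/ s = -1 -> P (cell k s j) = ((2 * m%:R)^-1)%:E.
Proof. exact: lawPi. Qed.

Definition pos (j : 'I_n) : set T := \big[setU/set0]_(k < m) cell k 1 j.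
Definition hit (k : 'I_m) (j : 'I_n) : set T := cell k 1 j `|` cell k (-1) j.

Let mpos j : measurable (pos j). Proof. by apply: bigsetU_measurable => k _; exact: mcell. Qed.
Let mhit k j : measurable (hit k j). Proof. by apply: measurableU; exact: mcell. Qed.

Let Psum (A : 'I_m -> set T) (c : R) : (forall k, measurable (A k)) -> trivIset setT A ->
  (forall k, P (A k) = c%:E) -> P (\big[setU/set0]_(k < m) A k) = (m%:R * c)%:E.
Proof.
move=> mA tA PA; rewrite measure_semi_additive_ord//; last exact: bigsetU_measurable.
rewrite (eq_bigr (fun=> c%:E)); last by move=> k _; exact: PA.
by rewrite sumEFin sumr_const card_ord mulr_natl.
Qed.

Let one_neq0 : (1 : R) != 0. Proof. exact: oner_neq0. Qed.
Let none_neq0 : (-1 : R) != 0. Proof. by rewrite oppr_eq0 oner_neq0. Qed.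
Let one_none : (1 : R) <> -1. Proof. by move=> h; have := @ltr01 R; lra. Qed.

Let Ppos j : P (pos j) = (2^-1)%:E.
Proof.
rewrite (@Psum _ (2 * m%:R)^-1).
- by congr EFin; field.
- by move=> k; exact: mcell.
- by move=> k k' _ _ [w [/= h1 h2]]; case: (cell_inj one_neq0 h1 h2).
- by move=> k; apply: Pcell; left.
Qed.

Let Phit k j : P (hit k j) = (m%:R^-1)%:E.
Proof.
rewrite measureU//; last first.
  by apply/seteqP; split => // w [h1 h2]; case: (cell_inj one_neq0 h1 h2) => _ /one_none.
rewrite [X in (X + _)%E](Pcell k j (or_introl erefl)) [X in (_ + X)%E](Pcell k j (or_intror erefl)).
by rewrite -EFinD; congr EFin; field.
Qed.

Let hit_inj k k' j w : hit k j w -> hit k' j w -> k = k'.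
Proof.
by move=> [h1|h1] [h2|h2]; [case: (cell_inj one_neq0 h1 h2)|case: (cell_inj one_neq0 h1 h2)|
  case: (cell_inj none_neq0 h1 h2)|case: (cell_inj none_neq0 h1 h2)].
Qed.

Let pos_hit k j : pos j `&` hit k j = cell k 1 j.
Proof.
apply/seteqP; split => w; last by move=> h; split; [apply/bigsetUP; exists k|left].
move=> [/bigsetUP[k' h1] [//|h2]].
by case: (cell_inj one_neq0 h1 h2) => _ /one_none.
Qed.

Let neg_hit k j : ~` pos j `&` hit k j = cell k (-1) j.
Proof.
apply/seteqP; split => w.
  by move=> [h1 [h2|//]]; exfalso; apply: h1; apply/bigsetUP; exists k.
move=> h; split; last by right.
by move=> /bigsetUP[k' h1]; case: (cell_inj one_neq0 h1 h) => _ /one_none.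
Qed.

(** Finite pi-systems suffice for [pi_family], and they turn independence of sign and location into
    a finite case check. *)
Definition sign_sets (j : 'I_n) : set (set T) := [set setT; set0] `|` [set pos j; ~` pos j].
Definition hash_sets (j : 'I_n) : set (set T) := [set setT; set0] `|` [set hit k j | k in [set: 'I_m]].

(* The sign and the location of a column are independent, so that together with the data they
   form a three-fold independent family. *)
Definition csfam (a : ('I_n + 'I_n) + 'I_n) : set (set T) := match a with
  | inl (inl i) => sigma_gen (F (inl i))
  | inl (inr j) => sign_sets j
  | inr j => hash_sets j
  end.

(** The sign of a column travels with its observation, whereas the location is attached to none;
    anything built from observations is thus independent of the hash. *)
Definition csidx (a : ('I_n + 'I_n) + 'I_n) : option 'I_n := match a with
  | inl (inl i) => Some i
  | inl (inr j) => Some j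
  | inr j => None
  end.

Let colgen j : set (set T) := [set f @^-1` B | f in F (inr j) & B in [set B : set R | measurable B]].

Let col_pos j : sigma_gen (F (inr j)) (pos j).
Proof.
apply: (@bigsetU_measurable _ (g_sigma_algebraType (colgen j))) => k _; exact: sigma_cell.
Qed.

Let col_sign j A : sign_sets j A -> sigma_gen (F (inr j)) A.
Proof.
move=> [[->|->]|[->|->]].
- exact: (@measurableT _ (g_sigma_algebraType (colgen j))).
- exact: (@measurable0 _ (g_sigma_algebraType (colgen j))).
- exact: col_pos.
- by apply: (@measurableC _ (g_sigma_algebraType (colgen j))); exact: col_pos.
Qed.

Let col_hash j A : hash_sets j A -> sigma_gen (F (inr j)) A.
Proof.
move=> [[->|->]|[k _ <-]].
- exact: (@measurableT _ (g_sigma_algebraType (colgen j))).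
- exact: (@measurable0 _ (g_sigma_algebraType (colgen j))).
- by apply: (@measurableU _ (g_sigma_algebraType (colgen j))); exact: sigma_cell.
Qed.

Let col_meas j A : sigma_gen (F (inr j)) A -> measurable A.
Proof. exact: (sigma_gen_sub_measurable mF (i := inr j)). Qed.

Let piG : pi_family csfam.
Proof.
move=> [[i|j]|j].
- exact: (pi_family_sigma_gen mF (inl i)).
- split; first by left; left.
    move=> A B [[->|->]|[->|->]] [[->|->]|[->|->]];
      rewrite ?setTI ?setIT ?set0I ?setI0 ?setIid ?setICr ?setICl; try (by left; left); try (by left; right);
      try (by right; left); by right; right.
  by move=> A /col_sign/col_meas.
- split; first by left; left.
    move=> A B [[->|->]|[k _ <-]] [[->|->]|[l _ <-]];
      rewrite ?setTI ?setIT ?set0I ?setI0; try (by left; left); try (by left; right);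
      try (by right; exists l); try (by right; exists k).
    have [->|kl] := eqVneq k l; first by rewrite setIid; right; exists l.
    left; right; apply/seteqP; split => // w [h1 h2].
    by move/eqP: kl; apply; exact: hit_inj h1 h2.
  by move=> A /col_hash/col_meas.
Qed.

Let col_indep j A B : sign_sets j A -> hash_sets j B ->
  fine (P (A `&` B)) = fine (P A) * fine (P B).
Proof.
move=> sA [[->|->]|[k _ <-]].
- by rewrite setIT probability_setT mulr1.
- by rewrite setI0 measure0 mulr0.
case: sA => [[->|->]|[->|->]].
- by rewrite setTI probability_setT mul1r.
- by rewrite set0I measure0 mul0r.
- rewrite pos_hit Ppos Phit Pcell; last by left.
  by rewrite /= invfM.
- rewrite neg_hit probability_setC// Ppos Phit Pcell; last by right.
  by rewrite /=; field.
Qed.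

(** Sign and location events of a column are merged into one column event, the assumed independence
    of columns and data is applied, and [col_indep] splits each column again. *)
Let indG : indep_family P csfam.
Proof.
move=> A GA.
pose C (a : 'I_n + 'I_n) := match a with
  | inl i => A (inl (inl i))
  | inr j => A (inl (inr j)) `&` A (inr j)
  end.
have FC a : sigma_gen (F a) (C a).
  case: a => [i|j]; first exact: GA (inl (inl i)).
  apply: (@measurableI _ (g_sigma_algebraType (colgen j))).
    exact: col_sign (GA (inl (inr j))).
  exact: col_hash (GA (inr j)).
have := indep_family_sigma_gen indF FC.
have -> : \big[setI/setT]_a C a = \big[setI/setT]_a A a.
  apply/seteqP; split => w /bigsetIP h; apply/bigsetIP.
    move=> [[i|j]|j]; [exact: h (inl i)|exact: (h (inr j)).1|exact: (h (inr j)).2].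
  move=> [i|j]; [exact: h (inl (inl i))|by split; [exact: h (inl (inr j))|exact: h (inr j)]].
move=> ->; congr EFin; rewrite !big_sumType /= -mulrA; congr (_ * _).
rewrite -big_split /=; apply: eq_bigr => j _.
by apply: (@col_indep j); [exact: GA (inl (inr j))|exact: GA (inr j)].
Qed.

Definition hash_event (h : {ffun 'I_n -> 'I_m}) : set T := \big[setI/setT]_j hit (h j) j.

Let mhash h : measurable (hash_event h).
Proof. by apply: bigsetI_measurable => j _; exact: mhit. Qed.

Let Phash h : fine (P (hash_event h)) = m%:R ^- n.
Proof.
pose A (a : ('I_n + 'I_n) + 'I_n) := match a with inl _ => setT | inr j => hit (h j) j end.
have GA a : csfam a (A a).
  case: a => [[i|j]|j].
  - by have [] := piG (inl (inl i)).
  - by left; left.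
  - by right; exists (h j).
have -> : hash_event h = \big[setI/setT]_a A a.
  apply/seteqP; split => w /bigsetIP hw; apply/bigsetIP; last by move=> j; exact: hw (inr j).
  by move=> [a|j]; [by []|exact: hw].
rewrite (indG GA) /= big_sumType /= big1 ?mul1r; last first.
  by move=> a _; rewrite probability_setT.
rewrite (eq_bigr (fun=> m%:R^-1)); last by move=> j _; rewrite Phit.
by rewrite prodr_const card_ord exprVn.
Qed.

Let bad : set T := \big[setU/set0]_(j < n) ~` (\big[setU/set0]_(k < m) hit k j).

Let mbad : measurable bad /\ P bad = 0%E.
Proof.
apply: null_bigsetU => j.
have mU : measurable (\big[setU/set0]_(k < m) hit k j) by apply: bigsetU_measurable => k _; exact: mhit.
split; first exact: measurableC.
rewrite probability_setC// (@Psum _ m%:R^-1) ?mulfV ?subee//.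
by move=> k k' _ _ [w [/= h1 h2]]; exact: hit_inj h1 h2.
Qed.

Let good_hash w : ~ bad w -> exists h, hash_event h w.
Proof.
move=> nb.
have h1 j : exists k, hit k j w.
  by apply/(bigsetUP (hit ^~ j)); apply: contrapT => nh; apply: nb; apply/bigsetUP; exists j.
have [h hE] := choice h1.
by exists [ffun j => h j]; apply/bigsetIP => j; rewrite ffunE.
Qed.

Let hash_inj h h' w : hash_event h w -> hash_event h' w -> h = h'.
Proof.
move=> /bigsetIP h1 /bigsetIP h2; apply/ffunP => j; exact: hit_inj (h1 j) (h2 j).
Qed.

Local Notation om := (om csfam csidx).

Let hash_block h : bmeas csfam [set a | if a is inr _ then true else false]%SET (\1_(hash_event h) : T -> R).
Proof.
apply: measurable_indic.
apply: (@bigsetI_measurable _ (g_sigma_algebraType (block csfam _))) => j _.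
apply: sub_sigma_algebra; exists (inr j); first by rewrite inE.
by right; exists (h j).
Qed.

(** Conditioning on the hash in elementary form: the events [hash_event h] partition the space up to
    a null set, have equal probabilities, and are independent of the variables [Yh h] that represent
    [Y] on them. *)
Lemma hash_mixture (Y : T -> R) (Yh : {ffun 'I_n -> 'I_m} -> T -> R) :
  measurable_fun setT Y -> (forall h, om [set: 'I_n]%SET (Yh h)) -> (forall h, itg P (Yh h)) ->
  (forall h w, hash_event h w -> Y w = Yh h w) ->
  itg P Y /\ Ex P Y = avg (fun h => Ex P (Yh h)).
Proof.
move=> mY oY iY YE.
pose Z w := \sum_h \1_(hash_event h) w * Yh h w.
have ih h : itg P (fun w => \1_(hash_event h) w * Yh h w) /\
    Ex P (fun w => \1_(hash_event h) w * Yh h w) = m%:R ^- n * Ex P (Yh h).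
  have ind : indep2 P (\1_(hash_event h) : T -> R) (Yh h).
    by apply: (bmeas_indep piG indG _ (@hash_block h) (oY h)) => -[[i|j]|j]; rewrite !inE.
  have [h1 h2] := ExM ind (itg_indic P (@mhash h)) (iY h).
  by split => //; rewrite h2 Ex_indic// Phash.
have iZ : itg P Z by apply: itg_sum => h _; exact: (ih h).1.
have EZ : Ex P Z = avg (fun h => Ex P (Yh h)).
  rewrite Ex_sum; last by move=> h _; exact: (ih h).1.
  by rewrite /avg mulr_sumr; apply: eq_bigr => h _; exact: (ih h).2.
have [mb Pb] := mbad.
have [h1 <-] : itg P Y /\ Ex P Z = Ex P Y.
  apply: (itg_ae_eq mY mb Pb _ iZ) => w /good_hash[h hw].
  rewrite /Z (bigD1 h)//= big1 ?addr0 => [|h' hh'].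
    by rewrite indicE mem_set// mul1r (YE h).
  rewrite indicE memNset ?mul0r// => hw'.
  by move/eqP: hh'; apply; exact: hash_inj hw' hw.
by split.
Qed.

(** Takes the values one and minus one everywhere, also on the null event of malformed columns, so
    that [sgn ^+ 2 = 1] needs no exception. *)
Definition sgn (j : 'I_n) (w : T) : R := 2 * \1_(pos j) w - 1.

Let sgn_sqr j w : sgn j w ^+ 2 = 1.
Proof. by rewrite /sgn indicE; case: (_ \in _) => /=; ring. Qed.

Let Esgn j : itg P (sgn j) /\ Ex P (sgn j) = 0.
Proof.
have i1 := itg_indic P (@mpos j).
split; first exact: itgB (itgZ 2 i1) (itg_cst P 1).
by rewrite (ExB (itgZ 2 i1) (itg_cst P 1)) (ExZ 2 i1) Ex_cst Ex_indic// Ppos /=; field.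
Qed.

Let sgn_block j : bmeas csfam [set inl (inr j)]%SET (sgn j).
Proof.
apply: measurable_funB; last exact: measurable_cst.
apply: measurable_funM; first exact: measurable_cst.
by apply: (@bmeas_indic _ _ _ _ csfam (inl (inr j))); right; left.
Qed.

Let ob_block f i : obsfun f -> bmeas csfam [set inl (inl i)]%SET (ob f i).
Proof. by move=> mf; apply: bmeas1 => A mA; exact: (ob_datameas (i := i)). Qed.

Let sgn_om j : om [set j]%SET (sgn j).
Proof.
have S : ([set inl (inr j)] : {set ('I_n + 'I_n) + 'I_n})%SET \subset obsblock csidx [set j]%SET.
  by apply/fintype.subsetP => x; rewrite !inE => /eqP ->; rewrite /= inE.
exact: bmeas_sub S (@sgn_block j).
Qed.

Let ob_om f (i : 'I_n) : obsfun f -> om [set i]%SET (ob f i).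
Proof.
move=> mf; have S : ([set inl (inl i)] : {set ('I_n + 'I_n) + 'I_n})%SET \subset obsblock csidx [set i]%SET.
  by apply/fintype.subsetP => x; rewrite !inE => /eqP ->; rewrite /= inE.
exact: bmeas_sub S (@ob_block f i mf).
Qed.

Let sgn_ob f (i : 'I_n) : obsfun f -> indep2 P (sgn i) (ob f i).
Proof.
move=> mf; apply: (bmeas_indep piG indG _ (@sgn_block i) (@ob_block f i mf)) => x.
by rewrite !inE => /eqP ->.
Qed.

(** The sign disappears from even products, which therefore have the moments of the data, and makes
    odd products centered even where the data are not. *)
Definition sx f (i : 'I_n) (w : T) : R := sgn i w * ob f i w.

Let sx_om f i : obsfun f -> om [set i]%SET (sx f i).
Proof. by move=> mf; apply: omM; [exact: sgn_om|exact: ob_om]. Qed.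

Let sx_odd f i : obsfun f -> itg P (ob f 0) -> itg P (sx f i) /\ Ex P (sx f i) = 0.
Proof.
move=> mf f0; have [fi fE] := ob_law my mX law i mf f0.
have [h1 h2] := ExM (sgn_ob i mf) (Esgn i).1 fi.
by split => //; rewrite h2 (Esgn i).2 mul0r.
Qed.

Let sx_even f g i w : sx f i w * sx g i w = ob (fun u v => f u v * g u v) i w.
Proof. by rewrite /sx mulrACA -expr2 sgn_sqr mul1r. Qed.

Let sx_pow4 f i w : sx f i w ^+ 4 = ob (fun u v => f u v ^+ 4) i w.
Proof. by rewrite /sx exprMn (exprM _ 2 2) sgn_sqr expr1n mul1r. Qed.

Let sx_cube f g k i w : sx f i w * (sx g i w * sx k i w) = sx (fun u v => f u v * (g u v * k u v)) i w.
Proof. by rewrite sx_even /sx -mulrA. Qed.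

Let sx_L4 f i : obsfun f -> L4 P (ob f 0) -> L4 P (sx f i).
Proof.
move=> mf f4; split; first exact: (om_meas piG (@sx_om f i mf)).
by apply: eq_itg (ob_law my mX law i (obsfunX 4 mf) f4.2).1 => w; rewrite sx_pow4.
Qed.

Section cross_product.
Variables f g : R -> ('I_p -> R) -> R.
Hypothesis mf : obsfun f.
Hypothesis mg : obsfun g.
Hypothesis f4 : L4 P (ob f 0).
Hypothesis g4 : L4 P (ob g 0).

(* The part of [(Pi f)^T (Pi g)] coming from colliding pairs of distinct observations. *)
Definition collisions (w : T) : R :=
  \sum_k (\sum_i Pi w k i * ob f i w) * (\sum_i Pi w k i * ob g i w) - \sum_(i < n) ob f i w * ob g i w.

Lemma measurable_collisions : measurable_fun setT collisions.
Proof.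
have mo e (i : 'I_n) : obsfun e -> measurable_fun setT (ob e i) by move=> me; exact: ob_meas.
apply: measurable_funB; apply: measurable_sum => k.
  by apply: measurable_funM; apply: measurable_sum => i; apply: measurable_funM => //; exact: mo.
by apply: measurable_funM; exact: mo.
Qed.

Let PiE h w k j : hash_event h w -> Pi w k j = sgn j w * (h j == k)%:R.
Proof.
move=> /bigsetIP/(_ j) hw.
have [<-|hk] := eqVneq (h j) k; last first.
  by rewrite mulr0; case: hw => -[_ ->]//; rewrite eq_sym.
rewrite mulr1 /sgn indicE; case: hw => hw; have [e1 _] := hw.
  by rewrite e1 mem_set ?mulr1 /=; [ring|apply/bigsetUP; exists (h j)].
rewrite e1 memNset ?mulr0 ?sub0r// => /bigsetUP[k' h1].
by case: (cell_inj one_neq0 h1 hw) => _ /one_none.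
Qed.

(** The subtracted diagonal is the same for every hash: squared signs are one and each observation
    lies in exactly one bucket. *)
Let collisionsE h w : hash_event h w ->
  collisions w = \sum_(k < m) cross (sx f) (sx g) (bucket h k) w.
Proof.
move=> hw; rewrite /cross sumrB; congr (_ - _).
  apply: eq_bigr => k _; rewrite /ssum !sum_bucket; congr (_ * _); rewrite [RHS]big_mkcond /=;
    apply: eq_bigr => i _; rewrite (PiE _ _ hw) /sx; by case: (h i == k); rewrite ?mulr1// mulr0 mul0r.
rewrite (eq_bigr (fun k => \sum_(i < n | h i == k) ob f i w * ob g i w)); last first.
  by move=> k _; rewrite sum_bucket; apply: eq_bigr => i _; rewrite sx_even.
by rewrite (partition_big (fun i => h i) xpredT).
Qed.

Let V := Ex P (fun w => ob f 0 w ^+ 2) * Ex P (fun w => ob g 0 w ^+ 2)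
  + Ex P (fun w => ob f 0 w * ob g 0 w) ^+ 2.

Let V0 : 0 <= V.
Proof. by rewrite addr_ge0 ?sqr_ge0// mulr_ge0//; apply: Ex_ge0 => w; exact: sqr_ge0. Qed.

Let sx_sqr e i : obsfun e -> L4 P (ob e 0) -> Ex P (fun w => sx e i w ^+ 2) = Ex P (fun w => ob e 0 w ^+ 2).
Proof.
move=> me e4; rewrite -(ob_law my mX law i (obsfunX 2 me) (L4_L2 e4).2).2.
by apply: eq_Ex => w; rewrite expr2 sx_even.
Qed.

Let sx_M i : Ex P (fun w => sx f i w * sx g i w) = Ex P (fun w => ob f 0 w * ob g 0 w).
Proof.
rewrite -[RHS](ob_law my mX law i (obsfunM mf mg) (L2M (L4_L2 f4) (L4_L2 g4))).2.
by apply: eq_Ex => w; rewrite sx_even.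
Qed.

Let sx1 e i : obsfun e -> L4 P (ob e 0) -> Ex P (sx e i) = 0.
Proof. by move=> me e4; exact: (sx_odd i me (L4_itg e4)).2. Qed.

Let sx3 a b e i : obsfun a -> obsfun b -> obsfun e -> L4 P (ob a 0) -> L4 P (ob b 0) -> L4 P (ob e 0) ->
  Ex P (fun w => sx a i w * (sx b i w * sx e i w)) = 0.
Proof.
move=> ma mb me a4 b4 e4; rewrite (eq_Ex P (sx_cube a b e i)).
exact: (sx_odd i (obsfunM ma (obsfunM mb me)) (itg3 a4 b4 e4)).2.
Qed.

Let k4 := Ex P (fun w => ob f 0 w ^+ 4) + Ex P (fun w => ob g 0 w ^+ 4).

Let Ex4 e : 0 <= Ex P (fun w => ob e 0 w ^+ 4).
Proof. by apply: Ex_ge0 => w; exact: exprn_even_ge0. Qed.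

Let sx_E4 e i : obsfun e -> L4 P (ob e 0) -> Ex P (fun w => sx e i w ^+ 4) = Ex P (fun w => ob e 0 w ^+ 4).
Proof.
move=> me e4; rewrite -(ob_law my mX law i (obsfunX 4 me) e4.2).2.
by apply: eq_Ex => w; rewrite sx_pow4.
Qed.

Let sqr_E4 e : L4 P (ob e 0) -> Ex P (fun w => ob e 0 w ^+ 2) ^+ 2 <= Ex P (fun w => ob e 0 w ^+ 4).
Proof.
move=> e4; have := Ex_sqr_le (L4M e4 e4).
rewrite (@eq_Ex _ _ _ _ _ (fun w => ob e 0 w ^+ 2)); last by move=> w; rewrite expr2.
rewrite (@eq_Ex _ _ _ _ (fun w => (ob e 0 w * ob e 0 w) ^+ 2) (fun w => ob e 0 w ^+ 4))// => w.
ring.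
Qed.

Hypothesis n0 : (0 < n)%N.

Lemma collisions_sqr : L2 P collisions /\
  Ex P (fun w => collisions w ^+ 2) <= V * (n%:R + n%:R ^+ 2 / m%:R).
Proof.
have cs (h : {ffun 'I_n -> 'I_m}) := cross_sum_sqr piG indG (fun i => @sx_om f i mf) (fun i => @sx_om g i mg)
  (fun i => sx_L4 i mf f4) (fun i => sx_L4 i mg g4) (fun i => sx1 i mf f4) (fun i => sx1 i mg g4)
  (fun i => sx_sqr i mf f4) (fun i => sx_sqr i mg g4) sx_M h V0.
have oh (h : {ffun 'I_n -> 'I_m}) : om [set: 'I_n]%SET (fun w => \sum_(k < m) cross (sx f) (sx g) (bucket h k) w).
  apply: om_sum => k _.
  apply: (om_sub _ (@om_cross _ _ _ _ _ _ _ _ _ (fun i => @sx_om f i mf) (fun i => @sx_om g i mg) (bucket h k))) => i _.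
  by rewrite inE.
have oh2 (h : {ffun 'I_n -> 'I_m}) : om [set: 'I_n]%SET (fun w => (\sum_(k < m) cross (sx f) (sx g) (bucket h k) w) ^+ 2).
  by apply: omX; exact: oh.
have mY : measurable_fun setT (fun w => collisions w ^+ 2).
  by apply: measurable_funX; exact: measurable_collisions.
have [h1 h2] := hash_mixture (Yh := fun h w => (\sum_(k < m) cross (sx f) (sx g) (bucket h k) w) ^+ 2)
  mY oh2 (fun h => (cs h).1.2)
  (fun h w hw => congr1 (fun x => x ^+ 2) (collisionsE hw)).
split; first by split => //; exact: measurable_collisions.
rewrite h2; apply: (le_trans (le_avg (fun h => (cs h).2))).
rewrite avgZ; apply: ler_wpM2l => //; exact: avg_bsize_sqr.
Qed.

Lemma collisions_clt (eta c : R) : (m <= n)%N -> 0 < eta ->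
  `|Ex P (fun w => cos (Num.sqrt m%:R / n%:R * collisions w + c)) - expR (- (V / 2)) * cos c| <=
  2 * eta * V * (m%:R / n%:R + 1) + (2 / eta + 1) * (192 * k4 ^+ 2) * (expR 15 / m%:R)
  + V * (m%:R / n%:R).
Proof.
move=> mn e0; set rho := Num.sqrt m%:R / n%:R.
have kf : Ex P (fun w => ob f 0 w ^+ 4) <= k4 by rewrite lerDl.
have kg : Ex P (fun w => ob g 0 w ^+ 4) <= k4 by rewrite lerDr.
have xE i : Ex P (fun w => sx f i w ^+ 4) <= k4 by rewrite sx_E4.
have zE i : Ex P (fun w => sx g i w ^+ 4) <= k4 by rewrite sx_E4.
have clt (h : {ffun 'I_n -> 'I_m}) := bucket_clt piG indG (fun i => @sx_om f i mf) (fun i => @sx_om g i mg)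
  (fun i => sx_L4 i mf f4) (fun i => sx_L4 i mg g4) (fun i => sx1 i mf f4) (fun i => sx1 i mg g4)
  (fun i => sx_sqr i mf f4) (fun i => sx_sqr i mg g4) sx_M h (k4 := k4)
  xE zE
  (le_trans (sqr_E4 f4) kf) (le_trans (sqr_E4 g4) kg)
  (fun i => sx3 i mf mf mf f4 f4 f4) (fun i => sx3 i mg mg mg g4 g4 g4)
  (fun i => sx3 i mf mf mg f4 f4 g4) (fun i => sx3 i mf mg mg f4 g4 g4) rho c V0 e0.
rewrite -/V in clt.
have mcos : measurable_fun setT (fun x : R => cos (rho * x + c)).
  apply: measurableT_comp; first by apply: continuous_measurable_fun; exact: continuous_cos.
  by apply: measurable_funD => //; exact: measurable_funM.
have oh (h : {ffun 'I_n -> 'I_m}) : om [set: 'I_n]%SET (fun w => cos (rho * (\sum_(k < m) cross (sx f) (sx g) (bucket h k) w) + c)).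
  apply: (measurableT_comp mcos); apply: (@om_sum _ _ _ _ _ csfam csidx) => k _.
  apply: (om_sub _ (@om_cross _ _ _ _ _ _ _ _ _ (fun i => @sx_om f i mf) (fun i => @sx_om g i mg) (bucket h k))) => i _.
  by rewrite inE.
have ih (h : {ffun 'I_n -> 'I_m}) : itg P (fun w => cos (rho * (\sum_(k < m) cross (sx f) (sx g) (bucket h k) w) + c)).
  apply: (@itg_bounded _ _ _ _ _ 1); first exact: (om_meas piG (oh h)).
  by move=> w; rewrite ler_norml cos_geN1 cos_le1.
have mY : measurable_fun setT (fun w => cos (rho * collisions w + c)).
  by apply: (measurableT_comp mcos); exact: measurable_collisions.
have [_ ->] := hash_mixture mY oh ih (fun h w hw => congr1 (fun x => cos (rho * x + c)) (collisionsE hw)).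
(* The Gaussian value does not depend on the hash and equals its own average, so the bounds for
   fixed hashes may be averaged. *)
rewrite -[X in _ - X](avg_cst n m0) -mulN1r -avgZ -avgD.
apply: (le_trans (norm_avg _)).
under eq_avg do rewrite mulN1r.
apply: (le_trans (le_avg clt)).
have n1 : (0 : R) < n%:R by rewrite ltr0n.
have m1 : (0 : R) < m%:R by rewrite ltr0n.
have k40 : 0 <= k4 by rewrite addr_ge0.
rewrite !avgD !avgZ.
have r2 : rho ^+ 2 = m%:R / n%:R ^+ 2 by rewrite exprMn sqr_sqrtr// exprVn.
have r4 : rho ^+ 4 = (m%:R / n%:R ^+ 2) ^+ 2 by rewrite (exprM _ 2 2) r2.
apply: lerD; first apply: lerD.
- apply: ler_wpM2l; first by rewrite !mulr_ge0// ltW.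
  rewrite r2; apply: (le_trans (ler_wpM2l _ (avg_bsize_sqr n m0))).
    by rewrite divr_ge0// exprn_ge0.
  rewrite le_eqVlt; apply/orP; left; apply/eqP; by field; rewrite !gt_eqF.
- apply: ler_wpM2l.
    by rewrite !mulr_ge0 ?sqr_ge0// addr_ge0// divr_ge0// ltW.
  rewrite r4; apply: (le_trans (ler_wpM2l _ (avg_bsize_pow4 n0 m0 mn))).
    by rewrite exprn_ge0// divr_ge0// exprn_ge0.
  rewrite le_eqVlt; apply/orP; left; apply/eqP; by field; rewrite !gt_eqF.
- rewrite r2; apply: (@le_trans _ _ (V / 2 * (2 * (m%:R / n%:R)))).
    by apply: ler_wpM2l; [rewrite divr_ge0|exact: avg_bsize_dev].
  rewrite le_eqVlt; apply/orP; left; apply/eqP; by field; rewrite gt_eqF.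
Qed.

End cross_product.

End countsketch.

(** * Countsketch quantities as full-sample quantities plus collisions *)

Section collision_algebra.
Context {d : measure_display} {T : measurableType d} {R : realType}.
Variables (p : nat) (y : nat -> T -> R) (X : nat -> 'I_p -> T -> R) (beta0 : 'cV[R]_p).
Variables (n m : nat) (Pi : T -> 'M[R]_(m, n)).
Local Notation er := (errf beta0).
Local Notation col := (collisions y X Pi).

Lemma gram_collisions w j k : gram (Pi w) (Xmat X n w) j k =
  gram (1%:M : 'M[R]_n) (Xmat X n w) j k + n%:R^-1 * col (fun _ v => v j) (fun _ v => v k) w.
Proof.
rewrite (gram_ols y) /gram mxE -mulrDr; congr (_ * _); rewrite /collisions addrC subrK mxE.
by apply: eq_bigr => i _; rewrite mxE !mxE; congr (_ * _); apply: eq_bigr => l _; rewrite !mxE.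
Qed.

Lemma score_collisions (q : nat -> nat) w j : score (q n) (Pi w) (Xmat X n w) (errv y X beta0 n w) j 0 =
  score (q n) (1%:M : 'M[R]_n) (Xmat X n w) (errv y X beta0 n w) j 0 +
  Num.sqrt (q n)%:R / n%:R * col (fun _ v => v j) er w.
Proof.
rewrite score_ols /score mxE -mulrDr; congr (_ * _); rewrite /collisions.
rewrite (eq_bigr (fun i : 'I_n => ob y X (fun _ v => v j) i w * ob y X er i w)); last first.
  by move=> i _; rewrite /ob mulrC.
rewrite addrC subrK mxE; apply: eq_bigr => i _; rewrite mxE !mxE; congr (_ * _); apply: eq_bigr => l _.
  by rewrite !mxE.
by rewrite errvE.
Qed.

Lemma collisions_lin (a : 'cV[R]_p) g w :
  col (linf a) g w = \sum_j a j 0 * col (fun _ v => v j) g w.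
Proof.
have linE i : ob y X (linf a) i w = \sum_j a j 0 * ob y X (fun _ v => v j) i w by [].
rewrite /collisions; under [RHS]eq_bigr do rewrite mulrBr.
rewrite sumrB; congr (_ - _).
  under [RHS]eq_bigr do rewrite mulr_sumr.
  rewrite [RHS]exchange_big; apply: eq_bigr => k _ /=.
  under [RHS]eq_bigr do rewrite mulrA.
  rewrite -mulr_suml; congr (_ * _).
  under [RHS]eq_bigr do rewrite mulr_sumr.
  rewrite [RHS]exchange_big; apply: eq_bigr => i _ /=.
  by rewrite linE mulr_sumr; apply: eq_bigr => j _; rewrite mulrCA.
under [RHS]eq_bigr do rewrite mulr_sumr.
rewrite [RHS]exchange_big; apply: eq_bigr => i _ /=.
by rewrite linE mulr_suml; apply: eq_bigr => j _; rewrite mulrA.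
Qed.

End collision_algebra.

(** * The limit law under countsketch *)

Section countsketch_limit.
Context {d : measure_display} {T : measurableType d} {R : realType}.
Variables (P : probability T R) (p : nat).
Variables (y : nat -> T -> R) (X : nat -> 'I_p -> T -> R) (beta0 : 'cV[R]_p) (m : nat -> nat).
Hypothesis my : forall i, measurable_fun setT (y i).
Hypothesis mX : forall i j, measurable_fun setT (X i j).
Hypothesis law : forall i, same_law_vec P (y i) (X i) (y 0%N) (X 0%N).
Hypothesis ind : mutually_independent P (fun i : nat => [set y i] `|` [set X i j | j in [set: 'I_p]]).
Hypothesis y4 : (\int[P]_w ((y 0%N w) ^+ 4)%:E < +oo)%E.
Hypothesis X4 : (\int[P]_w ((\sum_j (X 0%N j w) ^+ 2) ^+ 2)%:E < +oo)%E.
Hypothesis minf : forall M : nat, \forall n \near \oo, (M <= m n)%N.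
Hypothesis mn0 : (fun n => (m n)%:R / n%:R : R) @ \oo --> (0 : R).
Hypothesis eX0 : forall j, Ex P (ob y X (fun u v => errf beta0 u v * v j) 0) = 0.
Local Notation ob := (ob y X).
Local Notation er := (errf beta0).

Let Sxx : 'M[R]_p := \matrix_(j, k) Ex P (ob (fun _ v => v j * v k) 0).
Hypothesis uS : Sxx \in unitmx.

Let Ssym : Sxx^T = Sxx.
Proof. by apply/matrixP => j k; rewrite !mxE; apply: eq_Ex => w; exact: mulrC. Qed.

Variable Pi : forall n, T -> 'M[R]_(m n, n).
Hypothesis HPi : forall n,
  (forall i j, measurable_fun setT (fun w => Pi n w i j)) /\
  (forall (k : 'I_(m n)) (j : 'I_n) (s : R), (s = 1 \/ s = -1) ->
     P [set w | Pi n w k j = s /\ forall k', k' != k -> Pi n w k' j = 0]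
     = ((2 * (m n)%:R)^-1 : R)%:E) /\
  mutually_independent P
    (fun a : 'I_n + 'I_n => match a with
       | inl i => [set y i] `|` [set X i j | j in [set: 'I_p]]
       | inr j => [set fun w => Pi n w k j | k in [set: 'I_(m n)]]
       end).
Local Notation col n := (collisions y X (Pi n)).

Let x4 j : L4 P (ob (fun _ v => v j) 0) := L4_X0 y mX X4 j.
Let e4 : L4 P (ob er 0) := L4_err0 beta0 my mX y4 X4.
Let mx j : obsfun (fun (_ : R) (v : 'I_p -> R) => v j) := obsfun_X j.
Let me : obsfun er := obsfun_err beta0.

Let gram_limit : cvp_mx P (fun n w => gram (Pi n w) (Xmat X n w)) Sxx.
Proof.
move=> j k.
have c1 : cvp P (fun n w => n%:R^-1 * col n (fun _ v => v j) (fun _ v => v k) w) 0.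
  set V := Ex P (fun w => ob (fun _ v => v j) 0 w ^+ 2) * Ex P (fun w => ob (fun _ v => v k) 0 w ^+ 2)
    + Ex P (fun w => ob (fun _ v => v j) 0 w * ob (fun _ v => v k) 0 w) ^+ 2.
  have lim : (fun n => V / n%:R + V / (m n)%:R) @ \oo --> (0 : R).
    rewrite -[X in _ --> X](addr0 0).
    by apply: cvgD; [exact: cvg_cinv|exact: cvg_Vm].
  apply: cvp_L2 lim; near=> n.
  have [n0 m0 mn] : [/\ (0 < n)%N, (0 < m n)%N & (m n <= n)%N].
    by near: n; exact: eventually_sizes minf mn0.
  have n1 : (n%:R : R) != 0 by rewrite pnatr_eq0 -lt0n.
  have m1 : ((m n)%:R : R) != 0 by rewrite pnatr_eq0 -lt0n.
  have [mP [lP iP]] := HPi n.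
  have [h1 h2] := collisions_sqr my mX law m0 mP lP iP (mx j) (mx k) (x4 j) (x4 k).
  split; first by apply: eq_L2 (L2Z n%:R^-1 h1) => w; rewrite subr0.
  rewrite (@eq_Ex _ _ _ _ _ (fun w => (n%:R^-1) ^+ 2 * col n (fun _ v => v j) (fun _ v => v k) w ^+ 2)); last first.
    by move=> w; rewrite subr0 exprMn.
  rewrite (ExZ _ h1.2); apply: (le_trans (ler_wpM2l (sqr_ge0 _) h2)).
  by rewrite -/V le_eqVlt; apply/orP; left; apply/eqP; field; rewrite n1 m1.
have := cvpD (cvp_gram_ols my mX law ind X4 j k) c1; rewrite addr0 -/Sxx.
by apply: eq_cvp; apply: nearW => n w; rewrite [in RHS](gram_collisions y).
Unshelve. all: end_near. Qed.

Let score_bip j : bip P (fun n w => score (m n) (Pi n w) (Xmat X n w) (errv y X beta0 n w) j 0).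
Proof.
set V := Ex P (fun w => ob (fun _ v => v j) 0 w ^+ 2) * Ex P (fun w => ob er 0 w ^+ 2)
  + Ex P (fun w => ob (fun _ v => v j) 0 w * ob er 0 w) ^+ 2.
have V0 : 0 <= V.
  by rewrite addr_ge0 ?sqr_ge0// mulr_ge0//; apply: Ex_ge0 => w; exact: sqr_ge0.
have b1 : bip P (fun n w => Num.sqrt (m n)%:R / n%:R * col n (fun _ v => v j) er w).
  apply: (@bip_L2 _ _ _ _ _ (2 * V)); near=> n.
  have [n0 m0 mn] : [/\ (0 < n)%N, (0 < m n)%N & (m n <= n)%N].
    by near: n; exact: eventually_sizes minf mn0.
  have n1 : (0 : R) < n%:R by rewrite ltr0n.
  have m1 : (0 : R) < (m n)%:R by rewrite ltr0n.
  have [mP [lP iP]] := HPi n.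
  have [h1 h2] := collisions_sqr my mX law m0 mP lP iP (mx j) me (x4 j) e4.
  split; first exact: (L2Z (Num.sqrt (m n)%:R / n%:R) h1).
  rewrite (@eq_Ex _ _ _ _ _ (fun w => (Num.sqrt (m n)%:R / n%:R) ^+ 2 * col n (fun _ v => v j) er w ^+ 2)); last first.
    by move=> w; rewrite exprMn.
  rewrite (ExZ _ h1.2); apply: (le_trans (ler_wpM2l (sqr_ge0 _) h2)); rewrite -/V.
  rewrite exprMn sqr_sqrtr ?ler0n// exprVn.
  have -> : (m n)%:R / n%:R ^+ 2 * (V * (n%:R + n%:R ^+ 2 / (m n)%:R)) = ((m n)%:R / n%:R + 1) * V.
    by field; rewrite !gt_eqF.
  by apply: ler_wpM2r => //; rewrite -lerBrDr ler_pdivrMr//; have : (m n)%:R <= n%:R :> R; [rewrite ler_nat|lra].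
have := bipD (bip_cvp (cvp_score_ols my mX law ind y4 X4 mn0 eX0 j)) b1.
by congr bip; apply/funext => n; apply/funext => w; rewrite [in RHS]score_collisions.
Unshelve. all: end_near. Qed.

(** The first absolute moment is what the Lipschitz bound on cosine consumes; it is controlled by
    the second moment, of order [m / n]. *)
Let diag_small (f : R -> ('I_p -> R) -> R) : obsfun f -> L2 P (ob f 0) -> Ex P (ob f 0) = 0 ->
  (fun n => Ex P (fun w => `|Num.sqrt (m n)%:R / n%:R * \sum_(i < n) ob f i w|)) @ \oo --> (0 : R).
Proof.
move=> mf f2 f0; apply/cvgrPdist_le => e e0.
set V := Ex P (fun w => ob f 0 w ^+ 2).
have lim : (fun n => (m n)%:R / n%:R * V) @ \oo --> (0 : R).
  by rewrite -[X in _ --> X](mul0r V); apply: cvgM => //; exact: cvg_cst.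
move/cvgrPdist_le/(_ (e ^+ 2)): lim => /(_ (exprn_gt0 _ e0)) lim.
near=> n.
have n0 : (0 < n)%N by near: n; exists 1%N.
have n1 : (0 : R) < n%:R by rewrite ltr0n.
set U := fun w => Num.sqrt (m n)%:R / n%:R * \sum_(i < n) ob f i w.
have [h1 h2] := ob_mean_var my mX law ind n mf f2.
have UE w : U w = Num.sqrt (m n)%:R / n%:R * \sum_(i < n) (ob f i w - Ex P (ob f 0)).
  by rewrite /U f0; under [in RHS]eq_bigr do rewrite subr0.
have U2 : L2 P U by apply: eq_L2 (L2Z (Num.sqrt (m n)%:R / n%:R) h1) => w; rewrite UE.
have EU : Ex P (fun w => U w ^+ 2) <= (m n)%:R / n%:R * V.
  rewrite (@eq_Ex _ _ _ _ _ (fun w => (Num.sqrt (m n)%:R / n%:R) ^+ 2 * (\sum_(i < n) (ob f i w - Ex P (ob f 0))) ^+ 2)); last first.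
    by move=> w; rewrite UE exprMn.
  rewrite (ExZ _ h1.2); apply: (le_trans (ler_wpM2l (sqr_ge0 _) h2)); rewrite -/V.
  rewrite exprMn sqr_sqrtr ?ler0n// le_eqVlt; apply/orP; left; apply/eqP.
  by field; rewrite gt_eqF.
have EUn : 0 <= Ex P (fun w => `|U w|) by apply: Ex_ge0.
rewrite sub0r normrN ger0_norm//.
have U1 : L2 P (fun w => `|U w|).
  split; first by apply: measurableT_comp => //; exact: U2.1.
  by apply: eq_itg U2.2 => w; rewrite real_normK ?num_real.
have := Ex_sqr_le U1; rewrite (@eq_Ex _ _ _ _ (fun w => `|U w| ^+ 2) (fun w => U w ^+ 2)); last first.
  by move=> w; rewrite real_normK ?num_real.
move=> h3; rewrite -(@ler_pXn2r _ 2)// ?nnegrE ?(ltW e0)//.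
apply: (le_trans h3); apply: (le_trans EU); apply: (le_trans (ler_norm _)).
by rewrite -normrN -sub0r; near: n.
Unshelve. all: end_near. Qed.

Lemma countsketch_normal :
  cvg_dist_normal P (fun n w => Num.sqrt (m n)%:R *:
    (beta_sk (Pi n w) (Xmat X n w) (yvec y n w) - beta_ols (Xmat X n w) (yvec y n w)))
    (Ex P (fun w => ob er 0 w ^+ 2) *: invmx Sxx).
Proof.
set s2 := Ex P (fun w => ob er 0 w ^+ 2).
have VE t : (t^T *m (s2 *: invmx Sxx) *m t) 0 0 =
    Ex P (fun w => ob (linf (invmx Sxx *m t)) 0 w ^+ 2) * s2.
  (* The sandwich form turns the quadratic form in [t] into a second moment of the linear form along
     [invmx Sxx *m t]. *)
  have -> : s2 *: invmx Sxx = s2 *: (invmx Sxx *m Sxx *m invmx Sxx).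
    by rewrite mulVmx// mul1mx.
  rewrite -scalemxAr -scalemxAl mxE dot_invmx_sym// mulrC; congr (_ * _).
  exact: (quad_form_Ex (invmx Sxx *m t) (fun j => L4_L2 (x4 j))).
have s20 : 0 <= s2 by apply: Ex_ge0 => w; exact: sqr_ge0.
apply: (@regression_clt _ _ _ P p y X beta0 m my mX Sxx) => //.
- by move=> t; rewrite VE mulr_ge0//; apply: Ex_ge0 => w; exact: sqr_ge0.
- by apply: nearW => n i j; exact: (HPi n).1.
- exact: cvp_gram_ols.
- by move=> i; exact: cvp_score_ols.
move=> t c; pose a := invmx Sxx *m t; rewrite VE -/a.
have ma : obsfun (linf (p := p) a) := obsfun_lin a.
have a4 : L4 P (ob (linf a) 0) := L4_lin0 y mX X4 a.
pose f := fun u v => linf a u v * er u v.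
have mf : obsfun f by exact: obsfunM.
have f2 : L2 P (ob f 0) := L4M a4 e4.
have f0 : Ex P (ob f 0) = 0.
  rewrite (@eq_Ex _ _ _ _ _ (fun w => \sum_j a j 0 * ob (fun u v => er u v * v j) 0 w)); last first.
    by move=> w; rewrite /ob /f /linf mulr_suml; apply: eq_bigr => j _; ring.
  have i1 j : itg P (ob (fun u v => er u v * v j) 0) := L2_itg (L2_eX beta0 my mX y4 X4 j).
  rewrite Ex_sum; last by move=> j _; exact: itgZ.
  by rewrite big1// => j _; rewrite ExZ// eX0 mulr0.
set V := _ * s2.
have V0 : 0 <= V by rewrite mulr_ge0//; apply: Ex_ge0 => w; exact: sqr_ge0.
have dot n w : (t^T *m (invmx Sxx *m score (m n) (Pi n w) (Xmat X n w) (errv y X beta0 n w))) 0 0 =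
    Num.sqrt (m n)%:R / n%:R * (\sum_(i < n) ob f i w) + Num.sqrt (m n)%:R / n%:R * col n (linf a) er w.
  rewrite dot_invmx_score// -/a; under eq_bigr do rewrite score_collisions mulrDr.
  rewrite big_split /=; congr (_ + _); last first.
    by rewrite collisions_lin mulr_sumr; apply: eq_bigr => j _; rewrite mulrCA.
  under eq_bigr do rewrite score_ols mulrCA.
  rewrite -mulr_sumr; congr (_ * _); under [LHS]eq_bigr do rewrite mulr_sumr.
  rewrite exchange_big; apply: eq_bigr => i _.
  by rewrite /ob /f /linf mulr_suml; apply: eq_bigr => j _; ring.
apply/cvgrPdist_le => e e0.
have e4' : 0 < e / 4 by rewrite divr_gt0.
(* Fixed before [n]: since [m / n <= 1], the first error is at most [4 * eta * V <= e / 4], and the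
   constant [K] depending on [eta] is then beaten by [m] tending to infinity. *)
pose eta := e / (16 * (V + 1)).
have V1 : 0 < V + 1 by lra.
have eta0 : 0 < eta by rewrite divr_gt0// mulr_gt0.
have etaV : 2 * eta * V * 2 <= e / 4.
  have : eta * V <= eta * (V + 1) by apply: ler_wpM2l; [exact: ltW|lra].
  have -> : eta * (V + 1) = e / 16 by rewrite /eta; field; rewrite gt_eqF.
  lra.
pose k4 := Ex P (fun w => ob (linf a) 0 w ^+ 4) + Ex P (fun w => ob er 0 w ^+ 4).
pose K := (2 / eta + 1) * (192 * k4 ^+ 2) * expR 15.
have l1 := diag_small mf f2 f0; move/cvgrPdist_le/(_ _ e4'): l1 => l1.
have l2 : (fun n => K / (m n)%:R) @ \oo --> (0 : R) by exact: cvg_Vm.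
move/cvgrPdist_le/(_ _ e4'): l2 => l2.
have l3 : (fun n => V * ((m n)%:R / n%:R)) @ \oo --> (0 : R).
  by rewrite -[X in _ --> X](mulr0 V); apply: cvgM => //; exact: cvg_cst.
move/cvgrPdist_le/(_ _ e4'): l3 => l3.
near=> n.
have [n0 m0 mn] : [/\ (0 < n)%N, (0 < m n)%N & (m n <= n)%N].
  by near: n; exact: eventually_sizes minf mn0.
have n1 : (0 : R) < n%:R by rewrite ltr0n.
have [mP [lP iP]] := HPi n.
pose r : R := Num.sqrt (m n)%:R / n%:R.
pose U w := r * \sum_(i < n) ob f i w; pose O w := r * col n (linf a) er w + c.
have mU : measurable_fun setT U.
  by apply: measurable_funM => //; apply: measurable_sum => i; exact: ob_meas.
have mO : measurable_fun setT O.
  by apply: measurable_funD => //; apply: measurable_funM => //; exact: measurable_collisions.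
have iU : itg P U.
  have [h1 _] := ob_mean_var my mX law ind n mf f2.
  apply: L2_itg; apply: eq_L2 (L2Z r h1) => w; rewrite /U f0.
  by under eq_bigr do rewrite subr0.
have -> : Ex P (fun w => cos ((t^T *m (invmx Sxx *m score (m n) (Pi n w) (Xmat X n w) (errv y X beta0 n w))) 0 0 + c)) =
    Ex P (fun w => cos (U w + O w)).
  by apply: eq_Ex => w; rewrite dot addrA.
have i1 := itg_cos P (measurable_funD mU mO); have i2 := itg_cos P mO.
have d1 : `|Ex P (fun w => cos (U w + O w)) - Ex P (fun w => cos (O w))| <= Ex P (fun w => `|U w|).
  rewrite -(ExB i1 i2); apply: (le_trans (Ex_norm (itgB i1 i2))).
  apply: Ex_le => [||w]; [exact: itg_norm (itgB i1 i2)|exact: itg_norm|].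
  by apply: (le_trans (cos_lip _ _)); rewrite addrK.
have d2 := collisions_clt my mX law m0 mP lP iP ma me a4 e4 n0 c mn eta0.
(* Orthogonality of errors and regressors removes the squared mixed moment from the collision
   variance and leaves the product form of the limit. *)
have Ef : Ex P (fun w => ob (linf a) 0 w * ob er 0 w) = 0 by exact: f0.
rewrite Ef expr0n addr0 -/s2 -/V -/k4 in d2.
have q1 : (m n)%:R / n%:R <= 1 :> R by rewrite ler_pdivrMr// mul1r ler_nat.
have h1 : `|0 - Ex P (fun w => `|Num.sqrt (m n)%:R / n%:R * \sum_(i < n) ob f i w|)| <= e / 4 by near: n.
have h2 : `|0 - K / (m n)%:R| <= e / 4 by near: n.
have h3 : `|0 - V * ((m n)%:R / n%:R)| <= e / 4 by near: n.
rewrite sub0r normrN in h1; rewrite sub0r normrN in h2; rewrite sub0r normrN in h3.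
have {}h1 := le_trans (ler_norm _) h1; have {}h2 := le_trans (ler_norm _) h2; have {}h3 := le_trans (ler_norm _) h3.
have h4 : 2 * eta * V * ((m n)%:R / n%:R + 1) <= 2 * eta * V * 2.
  apply: ler_wpM2l; last by lra.
  by apply: mulr_ge0 => //; apply: mulr_ge0 => //; exact: ltW.
have h5 : (2 / eta + 1) * (192 * k4 ^+ 2) * (expR 15 / (m n)%:R) = K / (m n)%:R by rewrite /K mulrA.
rewrite h5 in d2.
rewrite distrC; apply: (le_trans (ler_distD (Ex P (fun w => cos (O w))) _ _)).
have := lerD d1 d2; rewrite /O -/r; lra.
Unshelve. all: end_near. Qed.

End countsketch_limit.

Theorem theorem2p1 (R : realType) (d : measure_display) (T : measurableType d)
  (P : probability T R) (p : nat)
  (y : nat -> T -> R) (X : nat -> 'I_p -> T -> R) (beta0 : 'cV[R]_p)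
  (m : nat -> nat) :
  (* measurability of the data *)
  (forall i, measurable_fun setT (y i)) ->
  (forall i j, measurable_fun setT (X i j)) ->
  (* identically distributed observations (y_i, X_i) *)
  (forall i, same_law_vec P (y i) (X i) (y 0%N) (X 0%N)) ->
  (* independent observations (y_i, X_i) *)
  mutually_independent P
    (fun i : nat => [set y i] `|` [set X i j | j in [set: 'I_p]]) ->
  (* moment conditions: E(y^4) < oo, E(||X||^4) < oo *)
  (\int[P]_w ((y 0%N w) ^+ 4)%:E < +oo)%E ->
  (\int[P]_w ((\sum_j (X 0%N j w) ^+ 2) ^+ 2)%:E < +oo)%E ->
  let e := fun i w => y i w - (\row_j X i j w *m beta0) 0 0 in
  let Sxx := \matrix_(j, k) Ereal P (fun w => X 0%N j w * X 0%N k w) in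
  (* E(X X^T) has full rank p *)
  \rank Sxx = p ->
  (* E(e X) = 0 *)
  (forall j, Ereal P (fun w => e 0%N w * X 0%N j w) = 0) ->
  (* m -> oo and m / n -> 0 *)
  (forall M : nat, \forall n \near \oo, (M <= m n)%N) ->
  (fun n => (m n)%:R / n%:R : R) @ \oo --> (0 : R) ->
  let Omega := \matrix_(j, k)
      Ereal P (fun w => (e 0%N w) ^+ 2 * X 0%N j w * X 0%N k w) in
  let V1 := invmx Sxx *m Omega *m invmx Sxx in
  let V0 := Ereal P (fun w => (e 0%N w) ^+ 2) *: invmx Sxx in
  let Zn := fun k (Pi : forall n, T -> 'M[R]_(k n, n)) n w =>
      Num.sqrt (m n)%:R *:
        (beta_sk (Pi n w) (Xmat X n w) (yvec y n w)
         - beta_ols (Xmat X n w) (yvec y n w)) in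
  (* (i) Bernoulli sampling: Pi n = sqrt(n/m) B, B diagonal i.i.d. Bernoulli(m/n),
     independent of the data *)
  (forall B : forall n, T -> 'M[R]_(n, n),
     (forall n, (m n <= n)%N ->
        (forall i j, measurable_fun setT (fun w => B n w i j)) /\
        (forall w (i j : 'I_n), i != j -> B n w i j = 0) /\
        (forall i : 'I_n,
           P [set w | B n w i i = 1] = ((m n)%:R / n%:R : R)%:E /\
           P [set w | B n w i i = 0] = (1 - (m n)%:R / n%:R : R)%:E) /\
        mutually_independent P
          (fun a : 'I_n + 'I_n => match a with
             | inl i => [set y i] `|` [set X i j | j in [set: 'I_p]]
             | inr k => [set fun w => B n w k k]
             end)) ->
     cvg_dist_normal P
       (Zn (fun n => n) (fun n w => Num.sqrt ((n%:R : R) / (m n)%:R) *: B n w))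
       V1) /\
  (* (ii) countsketch: columns i.i.d., each with a single nonzero entry +-1,
     at a uniformly random row, sign independent of location,
     independent of the data *)
  (forall Pi : forall n, T -> 'M[R]_(m n, n),
     (forall n,
        (forall i j, measurable_fun setT (fun w => Pi n w i j)) /\
        (forall (k : 'I_(m n)) (j : 'I_n) (s : R), (s = 1 \/ s = -1) ->
           P [set w | Pi n w k j = s /\ forall k', k' != k -> Pi n w k' j = 0]
           = ((2 * (m n)%:R)^-1 : R)%:E) /\
        mutually_independent P
          (fun a : 'I_n + 'I_n => match a with
             | inl i => [set y i] `|` [set X i j | j in [set: 'I_p]]
             | inr j => [set fun w => Pi n w k j | k in [set: 'I_(m n)]]
             end)) ->
     cvg_dist_normal P (Zn m Pi) V0).
Proof.
move=> my mX law ind y4 X4 e Sxx rk eX0 minf mn0 Omega V1 V0 Zn.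
have eE i : e i = ob y X (errf beta0) i.
  apply/funext => w; rewrite /e /ob /errf mxE; congr (_ - _).
  by apply: eq_bigr => j _; rewrite mxE.
have SE : Sxx = \matrix_(j, k) Ex P (ob y X (fun _ v => v j * v k) 0).
  by apply/matrixP => j k; rewrite !mxE ErealE.
have uS : Sxx \in unitmx by rewrite -row_full_unit /row_full rk.
have eX j : Ex P (ob y X (fun u v => errf beta0 u v * v j) 0) = 0.
  by rewrite -[RHS](eX0 j) ErealE; apply: eq_Ex => w; rewrite eE.
have OE : Omega = \matrix_(j, k) Ex P (ob y X (fun u v => errf beta0 u v ^+ 2 * v j * v k) 0).
  by apply/matrixP => j k; rewrite !mxE ErealE; apply: eq_Ex => w; rewrite eE.
have s2E : Ereal P (fun w => e 0%N w ^+ 2) = Ex P (fun w => ob y X (errf beta0) 0 w ^+ 2).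
  by rewrite ErealE; apply: eq_Ex => w; rewrite eE.
rewrite SE in uS; split=> [B HB|Pi HPi].
  by rewrite /V1 OE SE; exact: bernoulli_normal.
by rewrite /V0 s2E SE; exact: countsketch_normal.
Qed.
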